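(* For every $j\ge 1$, the label process $\boldsymbol{\ell}^{(j)}$ appearing in the recursive definition of the iterated Brownian snakes (recalled in the context) is a (a.s.) continuous process on $[0,1]$, i.e. it admits a continuous version. Consequently, for every integer $D\ge 1$, the $D$th Brownian snake $$\mathbf{bs}[D]=\left(\left[\mathbf{h}^{(1)},\boldsymbol{\ell}^{(1)}\right],\ldots,\left[\mathbf{h}^{(D)},\boldsymbol{\ell}^{(D)}\right]\right)$$ is well defined.
   Context: Let $C[0,1]$ be the set of continuous functions $[0,1]\to\mathbb{R}$, $C^0[0,1]=\{g\in C[0,1]: g(0)=g(1)=0\}$ and $C^+[0,1]=\{g\in C^0[0,1]: g\ge 0\}$. For a function $g$ and $x,y\in[0,1]$ write $\check g(x,y)=\min\{g(u):\min(x,y)\le u\le \max(x,y)\}$. For $g\in C^+[0,1]$ write $x\sim_g y$ iff $g(x)=g(y)=\check g(x,y)$; the quotient $T_g=[0,1]/\sim_g$ is the tree with contour $g$. The space of (tours of) snakes is the set $\mathcal S$ of pairs $(g,\ell)\in C^+[0,1]\times C^0[0,1]$ such that $s\sim_g t\Rightarrow \ell(s)=\ell(t)$. The process $\mathbf{bs}[D]$ is required to take its values in $\mathcal S^{D}$. Given a random process $\mathbf X$ with values in $C^+[0,1]$, the Brownian snake with lifetime process $\mathbf X$ is the pair $(\mathbf X,\boldsymbol\ell)$ where, conditionally on $\mathbf X=g$, $\boldsymbol\ell=(\boldsymbol\ell(s),s\in[0,1])$ is a centered Gaussian process with covariance $\operatorname{cov}(\boldsymbol\ell(x),\boldsymbol\ell(y))=\check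 g(x,y)$; $\boldsymbol\ell$ is called its label process (it is taken in a continuous version when one exists). For $f\in C^0[0,1]$ let $m(f)=\min f$, $a(f)=\min\{x: f(x)=m(f)\}$, and let $\mathrm{Conj}(f)\in C^+[0,1]$ be defined by $\mathrm{Conj}(f)(x)=f\big((a(f)+x)\bmod 1\big)-m(f)$. Recursive definition: (i) $\mathbf h^{(1)}$ is a normalized Brownian excursion on $[0,1]$; (ii) for every $j\ge1$, conditionally on $[\mathbf h^{(1)},\boldsymbol\ell^{(1)},\ldots,\mathbf h^{(j-1)},\boldsymbol\ell^{(j-1)},\mathbf h^{(j)}]$, $\boldsymbol\ell^{(j)}$ is the label process of the Brownian snake with lifetime process $\mathbf h^{(j)}$; (iii) for every $j\ge 2$, $\mathbf h^{(j)}=\mathrm{Conj}(\boldsymbol\ell^{(j-1)})$ (which makes sense once $\boldsymbol\ell^{(j-1)}$ is continuous). *)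

(* Defs.v *)
From HB Require Import structures.
From mathcomp Require Export all_boot all_order all_algebra.
From mathcomp Require Export all_classical all_reals all_analysis.
Export Order.TTheory GRing.Theory Num.Theory.
Export numFieldNormedType.Exports.

Set Implicit Arguments.
Unset Strict Implicit.
Unset Printing Implicit Defensive.

Local Open Scope classical_set_scope.
Local Open Scope ring_scope.

(* A function on [0,1] is a function on R of which only the values on `[0, 1]
   are used; likewise a process on an index set D is a family X : I -> T -> R
   of which only the X i with i in D are used. *)

Section paths.
Context {R : realType}.
Implicit Types (f g l : R -> R) (x y : R).

Definition unitI : set R := `[0, 1].

Definition C0 f : Prop :=
  [/\ {within unitI, continuous f}, f 0 = 0 & f 1 = 0].

Definition Cplus g : Prop := C0 g /\ forall x, unitI x -> 0 <= g x.

(* For continuous functions the infima below are attained, so they are the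
   minima of the mathematical definitions. *)
Definition minseg g x y : R :=
  inf [set g u | u in `[Num.min x y, Num.max x y]].

Definition tree_equiv g x y : Prop := g x = g y /\ g y = minseg g x y.

Definition snake g l : Prop :=
  [/\ Cplus g, C0 l &
      forall s t, unitI s -> unitI t -> tree_equiv g s t -> l s = l t].

Definition minval f : R := inf [set f x | x in unitI].

Definition argminval f : R := inf [set x | unitI x /\ f x = minval f].

Definition mod1 x : R := x - (Num.floor x)%:~R.

Definition Conj f x : R := f (mod1 (argminval f + x)) - minval f.

End paths.

Section laws.
Context {R : realType}.

Definition cylinder_algebra (I : Type) (D : set I) : set (set (I -> R)) :=
  <<s [set E | exists i (B : set R),
        [/\ D i, measurable B & E = [set x | B (x i)]]] >>.

Definition path_event (I T : Type) (X : I -> T -> R) (E : set (I -> R)) : set T :=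
  [set w | E (X ^~ w)].

Definition same_law (I : Type) (D : set I)
    d (T : measurableType d) (P : probability T R) (X : I -> T -> R)
    d' (T' : measurableType d') (P' : probability T' R) (X' : I -> T' -> R) :=
  forall E, cylinder_algebra D E ->
    P (path_event X E) = P' (path_event X' E).

(* The centered normal law of variance v >= 0; the case v = 0 is separate
   because normal_prob 0 0 is, by convention, the uniform law on [0,1]. *)
Definition centered_normal (v : R) (B : set R) : \bar R :=
  if v == 0 then \d_(0 : R) B else normal_prob 0 (Num.sqrt v) B.

Definition lincomb (I T : Type) (X : I -> T -> R) n (c : 'I_n -> R)
  (t : 'I_n -> I) (w : T) : R := \sum_(k < n) c k * X (t k) w.

Definition lincomb_var (I : Type) (K : I -> I -> R) n (c : 'I_n -> R)
  (t : 'I_n -> I) : R := \sum_(k < n) \sum_(m < n) c k * c m * K (t k) (t m).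

Definition gaussian_process d (T : measurableType d) (P : probability T R)
    (I : Type) (D : set I) (X : I -> T -> R) (K : I -> I -> R) : Prop :=
  (forall i, D i -> measurable_fun setT (X i)) /\
  forall n (c : 'I_n -> R) (t : 'I_n -> I) (B : set R),
    (forall k, D (t k)) -> measurable B ->
    P (lincomb X c t @^-1` B) = centered_normal (lincomb_var K c t) B.

(* Conditionally on the family (Y j, j in C), X is a centered Gaussian process
   on D whose covariance is the random kernel K w: every linear combination has
   the stated conditional law given the sigma-algebra generated by Y, whose
   elements are the path_event Y E with E in cylinder_algebra C. *)
Definition cond_gaussian_process d (T : measurableType d) (P : probability T R)
    (J : Type) (C : set J) (Y : J -> T -> R)
    (I : Type) (D : set I) (X : I -> T -> R) (K : T -> I -> I -> R) : Prop :=
  (forall i, D i -> measurable_fun setT (X i)) /\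
  forall n (c : 'I_n -> R) (t : 'I_n -> I) (B : set R) (E : set (J -> R)),
    (forall k, D (t k)) -> measurable B -> cylinder_algebra C E ->
    P (path_event Y E `&` lincomb X c t @^-1` B) =
    (\int[P]_(w in path_event Y E) centered_normal (lincomb_var (K w) c t) B)%E.

Definition is_version d (T : measurableType d) (P : probability T R)
    (I : Type) (D : set I) (X X' : I -> T -> R) : Prop :=
  forall i, D i ->
    measurable_fun setT (X' i) /\ {ae P, forall w, X' i w = X i w}.

End laws.

Section brownian_excursion.
Context {R : realType}.

Definition brownian_motion d (T : measurableType d) (P : probability T R)
    (W : R -> T -> R) : Prop :=
  [/\ gaussian_process P (`[0, +oo[ : set R) W (fun s t => Num.min s t),
      forall w, W 0 w = 0 &
      forall w, {within `[0, +oo[, continuous (W ^~ w)}].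

Definition last_zero (f : R -> R) : R :=
  sup [set s | 0 <= s <= 1 /\ f s = 0].

Definition next_zero (f : R -> R) : R :=
  inf [set s | 1 <= s /\ f s = 0].

(* The excursion of f away from 0 straddling time 1, rescaled to length 1. *)
Definition rescaled_excursion (f : R -> R) (t : R) : R :=
  let a := last_zero f in let b := next_zero f in
  `|f (a + t * (b - a))| / Num.sqrt (b - a).

Definition brownian_excursion d (T : measurableType d) (P : probability T R)
    (X : R -> T -> R) : Prop :=
  [/\ forall t, unitI t -> measurable_fun setT (X t),
      forall w, Cplus (X ^~ w) &
      exists d' (T' : measurableType d') (P' : probability T' R)
             (W : R -> T' -> R),
        brownian_motion P' W /\
        same_law unitI P X P' (fun t w => rescaled_excursion (W ^~ w) t)].

End brownian_excursion.

Section iterated_snakes.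
Context {R : realType}.

(* h i and l i, for i >= 1, are the i-th lifetime and label processes. They are
   gathered in one family: inl (i, t) stands for h i t, inr (i, t) for l i t. *)
Definition tours (T : Type) (h l : nat -> R -> T -> R)
    (k : (nat * R) + (nat * R)) : T -> R :=
  match k with inl (i, t) => h i t | inr (i, t) => l i t end.

Definition stages (a b : nat) : set ((nat * R) + (nat * R)) :=
  [set k | match k with
           | inl (i, t) => (0 < i <= a)%N /\ unitI t
           | inr (i, t) => (0 < i <= b)%N /\ unitI t
           end].

Definition label_process d (T : measurableType d) (P : probability T R)
    (h l : nat -> R -> T -> R) (j : nat) : Prop :=
  cond_gaussian_process P (stages j j.-1) (tours h l) unitI (l j)
    (fun w => minseg (h j ^~ w)).

(* The recursive definition up to l j: continuous versions of l 1, ..., l j.-1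
   have been chosen, while no regularity of l j is assumed. *)
Definition snake_recursion d (T : measurableType d) (P : probability T R)
    (h l : nat -> R -> T -> R) (j : nat) : Prop :=
  [/\ brownian_excursion P (h 1%N),
      forall i, (0 < i <= j)%N -> label_process P h l i,
      forall i, (0 < i < j)%N -> forall w, C0 (l i ^~ w) &
      forall i, (1 < i <= j)%N -> forall w t, unitI t ->
        h i t w = Conj (l i.-1 ^~ w) t].

Definition brownian_snakes d (T : measurableType d) (P : probability T R)
    (h l : nat -> R -> T -> R) (D : nat) : Prop :=
  snake_recursion P h l D /\
  forall i, (0 < i <= D)%N -> forall w, snake (h i ^~ w) (l i ^~ w).

End iterated_snakes.

(* Main.v *)
(* Continuity: conditionally on a lifetime h with |h(s) - h(t)| = O(rho^n) for
   |s - t| <= 2^-n, the increment of the label between s and t is Gaussian of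
   variance h(s) + h(t) - 2 min_[s,t] h. Gaussian tails of arbitrarily high
   polynomial order and Borel-Cantelli over the 4^n pairs of dyadic points of
   level n bound the increments over all pairs whose variance is at most
   sigma^(2n), with rho < sigma^2. Chaining gives a continuous extension that
   inherits a geometric modulus; applied to pairs approximating s ~ t the same
   bound gives the compatibility with the tree. Conjugation preserves the
   modulus, so the argument iterates from the excursion.

   Existence: the kernel min_[s,t] h is ultrametric, hence positive semidefinite,
   and its Cholesky factors on an enumeration of the dyadic numbers, applied to
   independent normal variables, give the label. Brownian motion is the case of a
   tent-shaped lifetime, up to time inversion.

   Uniqueness: the law of a family is determined by its linear combinations,
   through trigonometric polynomials, and each stage is either a measurable
   functional of the previous ones or has a prescribed conditional law. *)

(* Increments are controlled over all pairs of dyadic points and not only over neighbours, because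
   two times identified by the tree may lie far apart in [0, 1]. The 4^n pairs cost nothing: with
   tails of order m the series has ratio 4 (sigma / theta)^m, and m is free. No Holder exponent is
   tracked; each stage needs only some rate below 1 and hands a larger one to the next stage.
   Regularity is always stated at dyadic times, hence by countably many conditions. The good paths
   thus form a measurable set, and the label is put to 0 outside it, so that every path is a snake
   and the next conjugation makes sense surely. Conditional laws enter only through probabilities of
   an event of the past intersected with an event on a linear combination; no conditional
   expectation is formed. Two solutions live on unrelated spaces, so a functional of the past is
   made common to both by reading it on a third space, whose sigma-algebra is generated by both
   pasts and which carries no probability. *)
From HB Require Import structures.
Require Import Defs.
From mathcomp Require Import ring lra zify measurable_realfun.

Set Implicit Arguments.
Unset Strict Implicit.
Unset Printing Implicit Defensive.

Local Open Scope classical_set_scope.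
Local Open Scope ring_scope.

(** * Laws determined by linear combinations *)

Section trigonometric_closure.
Context {R : realType} (I : Type) (D : set I).
Implicit Types (F G : (I -> R) -> R) (f : I -> R).

Definition evaluation (i : I) (f : I -> R) : R := f i.

(** Equality of the expectations of two families passes through each constructor, the last one by
    dominated convergence. Products are left out because they do not have this property; closure
    under them is derived in [trig_mul]. *)
Inductive trig_closure : ((I -> R) -> R) -> Prop :=
| trig_cos n (c : 'I_n -> R) (t : 'I_n -> I) : (forall k, D (t k)) ->
    trig_closure (fun f => cos (lincomb evaluation c t f))
| trig_sin n (c : 'I_n -> R) (t : 'I_n -> I) : (forall k, D (t k)) ->
    trig_closure (fun f => sin (lincomb evaluation c t f))
| trig_add F G : trig_closure F -> trig_closure G ->
    trig_closure (fun f => F f + G f)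
| trig_scale a F : trig_closure F -> trig_closure (fun f => a * F f)
| trig_lim (F_ : nat -> (I -> R) -> R) F (M : R) :
    (forall n, trig_closure (F_ n)) -> (forall n f, `|F_ n f| <= M) ->
    (forall f, F_ n f @[n --> \oo] --> F f) -> trig_closure F.

Lemma lincomb_cat (T : Type) (X : I -> T -> R) n m (c : 'I_n -> R)
    (c' : 'I_m -> R) t t' w :
  lincomb X (fun k => match fintype.split k with inl i => c i | inr j => c' j end)
    (fun k => match fintype.split k with inl i => t i | inr j => t' j end) w =
  lincomb X c t w + lincomb X c' t' w.
Proof.
rewrite /lincomb big_split_ord/=; congr (_ + _); apply: eq_bigr => i _.
  by rewrite (unsplitK (inl i)).
by rewrite (unsplitK (inr i)).
Qed.

Lemma lincombN (T : Type) (X : I -> T -> R) n (c : 'I_n -> R) t w :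
  lincomb X (fun k => - c k) t w = - lincomb X c t w.
Proof. by rewrite /lincomb -sumrN; apply: eq_bigr => i _; rewrite mulNr. Qed.

Lemma lincomb_catP n m (c : 'I_n -> R) (c' : 'I_m -> R) t t' :
  (forall k, D (t k)) -> (forall k, D (t' k)) ->
  exists p (d : 'I_p -> R) s, (forall k, D (s k)) /\
    forall f, lincomb evaluation d s f =
              lincomb evaluation c t f + lincomb evaluation c' t' f.
Proof.
move=> Dt Dt'; eexists; eexists; eexists; split; last first.
  by move=> f; exact: lincomb_cat.
by move=> k /=; case: (fintype.split k).
Qed.

Lemma trig_ext F G : trig_closure F -> (forall f, F f = G f) -> trig_closure G.
Proof. by move=> tF /funext <-. Qed.

Lemma trig_bounded F : trig_closure F -> exists M : R, forall f, `|F f| <= M.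
Proof.
elim=> [n c t _|n c t _|{}F G _ [M FM] _ [N GN]|a {}F _ [M FM]|F_ {}F M _ _ FM FF].
- by exists 1 => f; rewrite ler_norml cos_geN1 cos_le1.
- by exists 1 => f; rewrite ler_norml sin_geN1 sin_le1.
- by exists (M + N) => f; rewrite (le_trans (ler_normD _ _))// lerD.
- by exists (`|a| * M) => f; rewrite normrM ler_wpM2l.
- exists M => f; have := FF f => /(@cvg_norm _ R^o) FFn.
  rewrite -(cvg_lim _ FFn)//; apply: limr_le; first by apply/cvg_ex; eexists; exact: FFn.
  exact: nearW.
Qed.

Lemma trig_opp F : trig_closure F -> trig_closure (fun f => - F f).
Proof. by move=> tF; apply: trig_ext (trig_scale (-1) tF) _ => f; rewrite mulN1r. Qed.

Lemma trig_sub F G : trig_closure F -> trig_closure G ->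
  trig_closure (fun f => F f - G f).
Proof. by move=> tF tG; apply: trig_add => //; exact: trig_opp. Qed.

Lemma cvg_near_eq (u : nat -> R) (l : R) :
  (\forall n \near \oo, u n = l) -> u n @[n --> \oo] --> l.
Proof.
move=> ul; apply/cvgrPdist_le => e e0; near=> n.
have -> : u n = l by near: n.
by rewrite subrr normr0 ltW.
Unshelve. all: by end_near. Qed.

Lemma cvg_mull (u : nat -> R) (a l : R) : u n @[n --> \oo] --> l ->
  a * u n @[n --> \oo] --> a * l.
Proof. by move=> ul; apply: cvgM => //; exact: cvg_cst. Qed.

(** Product-to-sum formulas treat two generators, the sum and the difference of the arguments being
    again linear combinations. An induction on [G] with a generator on the left, then one on [F],
    reaches all products. *)
Lemma trig_mul F G : trig_closure F -> trig_closure G ->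
  trig_closure (fun f => F f * G f).
Proof.
have trigM_lin (b1 b2 : bool) n (c : 'I_n -> R) t m (c' : 'I_m -> R) t' :
    (forall k, D (t k)) -> (forall k, D (t' k)) ->
  let tr (b : bool) := if b then @cos R else @sin R in
  trig_closure (fun f => tr b1 (lincomb evaluation c t f) *
                         tr b2 (lincomb evaluation c' t' f)).
  move=> Dt Dt'.
  have [p [d [s [Ds ds]]]] := lincomb_catP c c' Dt Dt'.
  have [p' [d' [s' [Ds' ds']]]] := lincomb_catP c (fun k => - c' k) Dt Dt'.
  have := (trig_cos d Ds, trig_cos d' Ds').
  have := (trig_sin d Ds, trig_sin d' Ds').
  move=> [S S'] [C C'] /=; case: b1 b2 => -[].
  - apply: trig_ext (trig_scale 2^-1 (trig_add C C')) _ => f.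
    by rewrite ds ds' lincombN cosB cosD; field.
  - apply: trig_ext (trig_scale 2^-1 (trig_sub S S')) _ => f.
    by rewrite ds ds' lincombN sinB sinD; field.
  - apply: trig_ext (trig_scale 2^-1 (trig_add S S')) _ => f.
    by rewrite ds ds' lincombN sinB sinD; field.
  - apply: trig_ext (trig_scale 2^-1 (trig_sub C' C)) _ => f.
    by rewrite ds ds' lincombN cosB cosD; field.
have trigM_base (b : bool) n (c : 'I_n -> R) t : (forall k, D (t k)) ->
  trig_closure G -> trig_closure (fun f =>
     (if b then @cos R else @sin R) (lincomb evaluation c t f) * G f).
  move=> Dt; set tr := if b then _ else _.
  elim=> [m c' t' Dt'|m c' t' Dt'|G1 G2 _ H1 _ H2|a G1 _ H1|G_ G1 M _ HG GM GG].
  - exact: (trigM_lin b true).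
  - exact: (trigM_lin b false).
  - by apply: trig_ext (trig_add H1 H2) _ => f; rewrite mulrDr.
  - by apply: trig_ext (trig_scale a H1) _ => f; rewrite mulrCA.
  - apply: (trig_lim (M := M) HG) => [k f|f]; last exact: cvg_mull.
    have ? : `|tr (lincomb evaluation c t f)| <= 1.
      rewrite /tr; case: (b); rewrite ler_norml ?cos_geN1 ?cos_le1//.
      by rewrite sin_geN1 sin_le1.
    by rewrite normrM (le_trans _ (GM k f))// ler_piMl.
move=> + tG; elim=> [n c t Dt|n c t Dt|F1 F2 _ H1 _ H2|a F1 _ H1|F_ F1 M _ HF FM FF].
- exact: (trigM_base true).
- exact: (trigM_base false).
- by apply: trig_ext (trig_add H1 H2) _ => f; rewrite mulrDl.
- by apply: trig_ext (trig_scale a H1) _ => f; rewrite mulrA.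
- have [N GN] := trig_bounded tG.
  apply: (trig_lim (M := M * N) HF) => [k f|f]; first by rewrite normrM ler_pM.
  by under eq_fun do rewrite mulrC; rewrite mulrC; exact: cvg_mull.
Qed.

Lemma trig_cst a : trig_closure (fun=> a).
Proof.
(* The cosine of the empty combination is 1; this works also when [D] is empty. *)
have D0 (k : 'I_0) : D ((fun k : 'I_0 => match k with Ordinal _ h => False_rect I (notF h) end) k).
  by case: k.
apply: trig_ext (trig_scale a (trig_cos (fun=> 0) D0)) _ => f.
by rewrite /lincomb big_ord0 cos0 mulr1.
Qed.

(* The square root is the limit of polynomials: if 0 <= p <= |x| <= 1 then
   p' = p + (x^2 - p^2)/2 satisfies the same and |x| - p' <= (|x| - p)(1 - |x|/2). *)
Fixpoint abs_poly n (x : R) : R :=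
  if n is n'.+1 then abs_poly n' x + (x ^+ 2 - abs_poly n' x ^+ 2) / 2 else 0.

Lemma abs_poly_itv n x : `|x| <= 1 -> 0 <= abs_poly n x <= `|x|.
Proof.
move=> x1; elim: n => [|n /andP[p0 px]] /=; first by rewrite lexx normr_ge0.
rewrite -(real_normK (num_real x)); move: (abs_poly n x) p0 px => p p0 px.
have ? := normr_ge0 x; apply/andP; split; nra.
Qed.

Lemma abs_poly_rate n x : `|x| <= 1 ->
  `|x| - abs_poly n x <= `|x| * (1 - `|x| / 2) ^+ n.
Proof.
move=> x1; elim: n => [|n IH] /=; first by rewrite subr0 expr0 mulr1.
have /andP[p0 px] := abs_poly_itv n x1.
have -> : x ^+ 2 = `|x| ^+ 2 by rewrite real_normK ?num_real.
rewrite [in leRHS]exprS.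
move: (abs_poly n x) (`|x|) (normr_ge0 x) IH x1 p0 px => p y y0 IH y1 p0 py.
have : (1 - y / 2) * (y - p) <= (1 - y / 2) * (y * (1 - y / 2) ^+ n).
  by rewrite ler_wpM2l//; lra.
have : (1 - y / 2) * (y - p) >= y - (p + (y ^+ 2 - p ^+ 2) / 2) by nra.
rewrite (mulrCA (1 - y / 2)); lra.
Qed.

Lemma abs_poly_cvg x : `|x| <= 1 -> abs_poly n x @[n --> \oo] --> `|x|.
Proof.
move=> x1; have [->|x0] := eqVneq x 0.
  rewrite normr0 (_ : (fun n => abs_poly n 0) = cst 0); first exact: cvg_cst.
  apply/funext => n; have := @abs_poly_itv n 0; rewrite normr0 ler01 => /(_ isT).
  by move=> h; apply/eqP; rewrite eq_le andbC.
have nx : 0 < `|x| by rewrite normr_gt0.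
have g0 : `|x| * (1 - `|x| / 2) ^+ n @[n --> \oo] --> 0.
  rewrite -(mulr0 `|x|); apply: cvg_mull; apply: cvg_expr.
  by rewrite ger0_norm; lra.
apply: (@squeeze_cvgr _ _ _ _ (fun n => `|x| - `|x| * (1 - `|x| / 2) ^+ n)
  (fun=> `|x|)).
- apply: nearW => n; have := abs_poly_rate n x1.
  by have /andP[_ ->] := abs_poly_itv n x1; rewrite andbT; lra.
- rewrite -[X in _ --> X]subr0; apply: cvgB => //; exact: cvg_cst.
- exact: cvg_cst.
Qed.

(** Scaling brings the values into [-1, 1], where polynomials converge to the absolute value. This
    gives positive parts, and through them the indicators of inequalities. *)
Lemma trig_abs F : trig_closure F -> trig_closure (fun f => `|F f|).
Proof.
move=> tF; have [M FM] := trig_bounded tF.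
pose K := Num.max M 1; have K0 : 0 < K by rewrite lt_max ltr01 orbT.
have GK f : `|K^-1 * F f| <= 1.
  rewrite normrM gtr0_norm ?invr_gt0// mulrC ler_pdivrMr// mul1r.
  by rewrite (le_trans (FM f))// le_max lexx.
have tp n : trig_closure (fun f => abs_poly n (K^-1 * F f)).
  elim: n => [|n IH]; first exact: trig_cst.
  have tG := trig_scale K^-1 tF.
  apply: trig_ext (trig_add IH (trig_scale 2^-1
    (trig_sub (trig_mul tG tG) (trig_mul IH IH)))) _ => f /=.
  by rewrite -!expr2 [2^-1 * _]mulrC.
have tl : trig_closure (fun f => `|K^-1 * F f|).
  apply: (trig_lim (M := 1) tp) => [n f|f]; last exact: abs_poly_cvg.
  have /andP[p0 p1] := abs_poly_itv n (GK f).
  by rewrite ger0_norm// (le_trans p1).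
apply: trig_ext (trig_scale K tl) _ => f.
by rewrite normrM gtr0_norm ?invr_gt0// mulrA divff ?gt_eqF// mul1r.
Qed.

Definition trig_set : set (set (I -> R)) := [set A | trig_closure \1_A].

Lemma trig_setI A B : trig_set A -> trig_set B -> trig_set (A `&` B).
Proof.
by move=> tA tB; apply: trig_ext (trig_mul tA tB) _ => f; rewrite !indicE in_setI; do 2 case: (_ \in _); rewrite ?mulr0 ?mulr1.
Qed.

Lemma trig_setC A : trig_set A -> trig_set (~` A).
Proof.
move=> tA; apply: trig_ext (trig_sub (trig_cst 1) tA) _ => f.
by rewrite !indicE in_setC; case: (_ \in _); rewrite ?subrr ?subr0.
Qed.

Lemma trig_set_le0 F : trig_closure F -> trig_set [set f | F f <= 0].
Proof.
move=> tF; have [M FM] := trig_bounded tF.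
pose K := Num.max M 1; have K0 : 0 < K by rewrite lt_max ltr01 orbT.
(* [G] is the positive part of [F] divided by [K]: it lies in [0, 1] and vanishes exactly where [F]
   is at most 0, so the powers of [1 - G] decrease to the indicator. *)
pose G f := (2 * K)^-1 * (F f + `|F f|).
have tG : trig_closure G by exact/trig_scale/trig_add/trig_abs.
have G01 f : 0 <= G f <= 1.
  have FN : 0 <= F f + `|F f| by have := ler_norm (- F f); rewrite normrN; lra.
  rewrite mulr_ge0 ?invr_ge0 ?mulr_ge0 1?(ltW K0)//= /G.
  rewrite mulrC ler_pdivrMr ?mulr_gt0// mul1r.
  have FK : `|F f| <= K by rewrite (le_trans (FM f))// le_max lexx.
  by have := ler_norm (F f); lra.
have tp n : trig_closure (fun f => (1 - G f) ^+ n).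
  elim: n => [|n IH]; first exact: trig_cst.
  apply: trig_ext (trig_mul (trig_sub (trig_cst 1) tG) IH) _ => f.
  by rewrite exprS.
apply: (trig_lim (M := 1) tp) => [n f|f].
  have /andP[g0 g1] := G01 f.
  by rewrite normrX exprn_ile1// ?ger0_norm//; lra.
rewrite indicE; have [F0|F0] := leP (F f) 0.
  rewrite mem_set//= /G ler0_norm// subrr mulr0 subr0.
  by under eq_fun do rewrite expr1n; exact: cvg_cst.
rewrite memNset/=; last by apply/negP; rewrite -ltNge.
apply: cvg_expr; have /andP[g0 g1] := G01 f.
rewrite ger0_norm; last lra.
suff : 0 < G f by lra.
by rewrite /G gtr0_norm// mulr_gt0 ?invr_gt0 ?mulr_gt0 ?addr_gt0.
Qed.

Lemma trig_set_bigcup (A : nat -> set (I -> R)) :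
  (forall n, trig_set (A n)) -> trig_set (\bigcup_n A n).
Proof.
move=> tA; rewrite -[X in trig_set X]setCK; apply: trig_setC.
rewrite setC_bigcup.
have tI n : trig_set (\bigcap_(i in `I_n) ~` A i).
  elim: n => [|n IH]; first by rewrite II0 bigcap_set0; apply: trig_ext (trig_cst 1) _ => f; rewrite indicT.
  rewrite IIS bigcap_setU bigcap_set1; apply: trig_setI => //.
  exact: trig_setC.
apply: (trig_lim (M := 1) tI) => [n f|f].
  by rewrite indicE ger0_norm// lern1 leq_b1.
have [Af|Af] := pselect ((\bigcap_i ~` A i) f).
  rewrite indicE mem_set//; apply: cvg_near_eq; apply: nearW => n.
  by rewrite indicE mem_set// => i _; exact: Af.
rewrite [\1_(\bigcap_i _) f]indicE memNset//.
have [k Akf] : exists k, A k f.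
  by apply: contrapT => h; apply: Af => k _ Akf; apply: h; exists k.
apply: cvg_near_eq; exists k.+1 => //= n /= kn.
by rewrite indicE memNset// => /(_ k); apply.
Qed.

Lemma trig_set_sigma_algebra : sigma_algebra setT trig_set.
Proof.
split.
- by apply: trig_ext (trig_cst 0) _ => f; rewrite indic0.
- by move=> A tA; rewrite setTD; exact: trig_setC.
- exact: trig_set_bigcup.
Qed.

(** A coordinate is unbounded, so its position relative to [a] is read through a sine: once [k.+1]
    exceeds |f i - a| / pi, the sine of (f i - a) / k.+1 has the sign of f i - a. *)
Lemma trig_set_ray i a : D i -> trig_set [set f | f i <= a].
Proof.
move=> Di.
have tS k : trig_set [set f | sin ((f i - a) / k.+1%:R) <= 0].
  apply: trig_set_le0.
  have Dt (j : 'I_1) : D ((fun=> i) j) by [].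
  have := trig_sub (trig_scale (cos (a / k.+1%:R)) (trig_sin (fun=> k.+1%:R^-1) Dt))
   (trig_scale (sin (a / k.+1%:R)) (trig_cos (fun=> k.+1%:R^-1) Dt)).
  move/trig_ext; apply => f; rewrite mulrBl sinB /lincomb !big_ord_recl !big_ord0 !addr0.
  by rewrite /evaluation [_^-1 * _]mulrC; ring.
apply: (trig_lim (M := 1) tS) => [n f|f].
  by rewrite indicE ger0_norm// lern1 leq_b1.
apply: cvg_near_eq.
have pi0 := @pi_gt0 R.
near=> k.
have kl : `|f i - a| / k.+1%:R < pi.
  rewrite ltr_pdivrMr// mulrC -ltr_pdivrMr//.
  near: k; apply: filterS (nbhs_infty_gtr (`|f i - a| / pi)) => k /lt_trans; apply.
  by rewrite ltr_nat.
rewrite !indicE; congr (_%:R); congr nat_of_bool.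
have kp : 0 < k.+1%:R^-1 :> R by rewrite invr_gt0.
apply/idP/idP; rewrite !inE/=; last first.
  move=> fa; rewrite -[X in sin X]opprK sinN oppr_le0 sin_ge0_pi//.
  rewrite -mulNr opprB; apply/andP; split; first by rewrite mulr_ge0 ?subr_ge0// ltW.
  by rewrite ltW// -(ger0_norm (x := a - f i)) ?subr_ge0// distrC.
apply: contraTT; rewrite -!ltNge => fa; apply: sin_gt0_pi.
rewrite mulr_gt0 ?subr_gt0//=.
by rewrite -(gtr0_norm (x := f i - a)) ?subr_gt0.
Unshelve. all: by end_near. Qed.

Lemma trig_set_preimage i (B : set R) : D i -> measurable B ->
  trig_set [set f | B (f i)].
Proof.
move=> Di mB.
suff : @measurable _ (measurableTypeR R) `<=` [set B | trig_set [set f | B (f i)]].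
  exact.
rewrite RGenOInfty.measurableE; apply: smallest_sub; last first.
  move=> _ [x ->]; rewrite /= (_ : [set f | _] = ~` [set f | f i <= x]).
    exact/trig_setC/trig_set_ray.
  by apply/seteqP; split => f /=; rewrite in_itv/= andbT ltNge => /negP.
have [t0 tC tU] := trig_set_sigma_algebra; split => //=.
- move=> A tA; rewrite (_ : [set f | _] = ~` [set f | A (f i)]); first exact: trig_setC.
  by apply/seteqP; split => f /=; [case|split].
- by move=> A /tU; rewrite /bigcup/=.
Qed.

Lemma trig_set_cylinder E : cylinder_algebra D E -> trig_set E.
Proof.
apply: smallest_sub; first exact: trig_set_sigma_algebra.
by move=> _ [i [B [Di mB ->]]]; exact: trig_set_preimage.
Qed.

End trigonometric_closure.

Section laws_from_linear_combinations.
Context {R : realType} (I : Type) (D : set I).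
Context d (T : measurableType d) (P : probability T R) (A : set T) (mA : measurable A).
Context (X : I -> T -> R).
Hypothesis mX : forall i, D i -> measurable_fun setT (X i).

Lemma measurable_lincomb n (c : 'I_n -> R) (t : 'I_n -> I) :
  (forall k, D (t k)) -> measurable_fun setT (lincomb X c t).
Proof.
by move=> Dt; apply: measurable_sum => k; apply: measurable_funM => //; exact: mX.
Qed.

Lemma measurable_trig F : trig_closure D F ->
  measurable_fun setT (fun w => F (X ^~ w)).
Proof.
elim=> [n c t Dt|n c t Dt|{}F G _ mF _ mG|a {}F _ mF|F_ {}F M _ mF FM FF].
- rewrite (_ : (fun w => _) = cos \o lincomb X c t)//; apply: measurableT_comp; last exact: measurable_lincomb.
  by apply: continuous_measurable_fun; exact: continuous_cos.
- rewrite (_ : (fun w => _) = sin \o lincomb X c t)//; apply: measurableT_comp; last exact: measurable_lincomb.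
  by apply: continuous_measurable_fun; exact: continuous_sin.
- exact: measurable_funD.
- exact: measurable_funM.
- by apply: (measurable_fun_cvg mF) => w _; exact: FF.
Qed.

Lemma measurable_path_event E : cylinder_algebra D E ->
  measurable (path_event X E).
Proof.
move=> /trig_set_cylinder/measurable_trig mE.
rewrite [X in measurable X](_ : _ =
  setT `&` (fun w => \1_E (X ^~ w) : R) @^-1` [set 1]); first exact: mE.
rewrite setTI; apply/seteqP; split => w /=; rewrite indicE.
  by move=> Ew; rewrite mem_set.
by case: (boolP (_ \in _)) => [/set_mem//|_ /eqP]; rewrite eq_sym oner_eq0.
Qed.

Lemma integrable_trig F : trig_closure D F ->
  P.-integrable A (fun w => (F (X ^~ w))%:E).
Proof.
move=> tF; have [M FM] := trig_bounded tF.
apply: measurable_bounded_integrable => //.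
- by rewrite (le_lt_trans (probability_le1 _ _))// ltry.
- exact/measurable_funTS/measurable_trig.
- exists M; split; first exact: num_real.
  by move=> x Mx w _ /=; rewrite (le_trans (FM _))// ltW.
Qed.

End laws_from_linear_combinations.

Section laws_from_linear_combinations2.
Context {R : realType} (I : Type) (D : set I).
Context d (T : measurableType d) (P : probability T R) (A : set T) (mA : measurable A).
Context d' (T' : measurableType d') (P' : probability T' R) (A' : set T')
  (mA' : measurable A').
Context (X : I -> T -> R) (X' : I -> T' -> R).
Hypothesis mX : forall i, D i -> measurable_fun setT (X i).
Hypothesis mX' : forall i, D i -> measurable_fun setT (X' i).

(** The events [A] and [A'] are carried along unnormalised, so that one statement compares laws ([A]
    the whole space) and conditional laws ([A] an event of the past). *)
Lemma law_from_trig :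
  (forall n (c : 'I_n -> R) t, (forall k, D (t k)) ->
    (\int[P]_(w in A) (cos (lincomb X c t w))%:E =
     \int[P']_(w in A') (cos (lincomb X' c t w))%:E)%E) ->
  (forall n (c : 'I_n -> R) t, (forall k, D (t k)) ->
    (\int[P]_(w in A) (sin (lincomb X c t w))%:E =
     \int[P']_(w in A') (sin (lincomb X' c t w))%:E)%E) ->
  forall E, cylinder_algebra D E ->
  P (A `&` path_event X E) = P' (A' `&` path_event X' E).
Proof.
move=> hcos hsin.
have H F : trig_closure D F -> (\int[P]_(w in A) (F (X ^~ w))%:E =
    \int[P']_(w in A') (F (X' ^~ w))%:E)%E.
  elim=> [n c t Dt|n c t Dt|{}F G tF IF tG IG|a {}F tF IF|F_ {}F M tF IF FM FF].
  - exact: hcos.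
  - exact: hsin.
  - under eq_integral do rewrite EFinD.
    under [in RHS]eq_integral do rewrite EFinD.
    rewrite integralD//; try exact: (integrable_trig P mA mX).
    rewrite integralD//; try exact: (integrable_trig P' mA' mX').
    by rewrite IF IG.
  - under eq_integral do rewrite EFinM.
    under [in RHS]eq_integral do rewrite EFinM.
    rewrite integralZl//; last exact: (integrable_trig P mA mX).
    rewrite integralZl//; last exact: (integrable_trig P' mA' mX').
    by rewrite IF.
  - have tG : trig_closure D F by exact: trig_lim FF.
    have L e (U : measurableType e) (Q : probability U R) (B : set U) (Y : I -> U -> R) :
        measurable B -> (forall i, D i -> measurable_fun setT (Y i)) ->
        (\int[Q]_(w in B) (F_ n (Y ^~ w))%:E @[n --> \oo] -->
         \int[Q]_(w in B) (F (Y ^~ w))%:E)%E.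
      move=> mB mY.
      have M0 : 0 <= M by rewrite (le_trans _ (FM 0%N (fun=> 0))).
      have := @dominated_convergence _ _ _ Q B mB (fun n w => (F_ n (Y ^~ w))%:E)
        (fun w => (F (Y ^~ w))%:E) (fun=> M%:E).
      case=> //.
      + by move=> n; apply/measurable_EFinP/measurable_funTS; exact: (measurable_trig mY (tF n)).
      + by apply/measurable_EFinP/measurable_funTS; exact: (measurable_trig mY tG).
      + by apply: aeW => w _; apply: cvg_EFin; [exact: nearW|exact: FF].
      + exact: finite_measure_integrable_cst.
      + by apply: aeW => w n' _; rewrite lee_fin.
    have L1 := L _ _ P A X mA mX; have L2 := L _ _ P' A' X' mA' mX'.
    rewrite -(cvg_lim _ L1)// -(cvg_lim _ L2)//.
    by congr (limn _); apply/funext => n; exact: IF.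
move=> E cE; have := H _ (trig_set_cylinder cE).
have S e (U : measurableType e) (Q : probability U R) (B : set U) (Y : I -> U -> R) :
  measurable B -> measurable (path_event Y E) ->
  (\int[Q]_(w in B) (\1_E (Y ^~ w) : R)%:E = Q (B `&` path_event Y E))%E.
  move=> mB mY; rewrite setIC -integral_indic//.
rewrite !S//.
- exact: (measurable_path_event mX' (E := E)).
- exact: (measurable_path_event mX (E := E)).
Qed.

(** Both sides become integrals of [f] against the image of a restricted measure, and the last
    hypothesis says that the two images agree. *)
Lemma integral_eq_law (f : R -> R) (Z : T -> R) (Z' : T' -> R) (M : R) :
  measurable_fun setT Z -> measurable_fun setT Z' ->
  measurable_fun setT f -> (forall x, `|f x| <= M) ->
  (forall B, measurable B -> P (A `&` Z @^-1` B) = P' (A' `&` Z' @^-1` B)) ->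
  (\int[P]_(w in A) (f (Z w))%:E = \int[P']_(w in A') (f (Z' w))%:E)%E.
Proof.
move=> mZ mZ' mf fM ZZ'.
have H e (U : measurableType e) (Q : probability U R) (B : set U) (mB : measurable B)
    (Y : U -> R) (mY : measurable_fun setT Y) :
    (\int[Q]_(w in B) (f (Y w))%:E =
     \int[pushforward (mrestr Q mB) Y]_y (f y)%:E)%E.
  have int : (mrestr Q mB).-integrable setT (fun w => (f (Y w))%:E).
    apply: (measurable_bounded_integrable (f := f \o Y)) => //.
    - rewrite -ge0_fin_numE//; exact: fin_num_measure.
    - exact: measurableT_comp.
    - by exists M; split; [exact: num_real|move=> x Mx w _ /=; rewrite (le_trans (fM _))// ltW].
  rewrite integral_pushforward//; last exact/measurable_EFinP.
  rewrite preimage_setT (@negligible_integral _ _ _ _ _ (~` B))//=; last 2 first.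
  - exact: measurableC.
  - by rewrite /mrestr setICl measure0.
  rewrite setTD setCK; apply: eq_measure_integral => C mC CB.
  by rewrite /= /mrestr (setIidl CB).
rewrite (H _ _ P A mA Z mZ) (H _ _ P' A' mA' Z' mZ').
apply: eq_measure_integral => B mB _.
rewrite /= /pushforward /mrestr /=.
by rewrite setIC ZZ'// setIC.
Qed.

(** The Cramer-Wold device on the events [A] and [A']: equal laws of linear combinations give equal
    integrals of their cosines and sines. *)
Theorem law_from_lincomb :
  (forall n (c : 'I_n -> R) t B, (forall k, D (t k)) -> measurable B ->
    P (A `&` lincomb X c t @^-1` B) = P' (A' `&` lincomb X' c t @^-1` B)) ->
  forall E, cylinder_algebra D E ->
  P (A `&` path_event X E) = P' (A' `&` path_event X' E).
Proof.
move=> XX'; apply: law_from_trig => n c t Dt; apply: (@integral_eq_law _ _ _ 1).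
all: try exact: (measurable_lincomb mX).
all: try exact: (measurable_lincomb mX').

all: try by move=> B mB; exact: XX'.
- by apply: continuous_measurable_fun; exact: continuous_cos.
- by move=> x; rewrite ler_norml cos_geN1 cos_le1.
- by apply: continuous_measurable_fun; exact: continuous_sin.
- by move=> x; rewrite ler_norml sin_geN1 sin_le1.
Qed.

End laws_from_linear_combinations2.

(** * Centered normal laws and product measures *)

Lemma preimage_measurable d d' (T : measurableType d) (T' : measurableType d')
    (f : T -> T') (B : set T') :
  measurable_fun setT f -> measurable B -> measurable (f @^-1` B).
Proof. by move=> mf mB; rewrite -[X in measurable X]setTI; exact: mf. Qed.

Section density.
Context d (T : measurableType d) {R : realType}.
Variables (mu nu : {measure set T -> \bar R}) (p : T -> R).
Hypotheses (mp : measurable_fun setT p) (p0 : forall x, 0 <= p x).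
Hypothesis nuE : forall A, measurable A -> nu A = (\int[mu]_(x in A) (p x)%:E)%E.

Import HBNNSimple.

Let integral_density_nnsfun (f : {nnsfun T >-> R}) :
  (\int[nu]_x (f x)%:E = \int[mu]_x ((f x)%:E * (p x)%:E))%E.
Proof.
under [LHS]eq_integral do rewrite fimfunE -fsumEFin//.
rewrite [LHS]ge0_integral_fsum//; last 2 first.
  - by move=> r; exact/measurable_EFinP/measurableT_comp.
  - by move=> n x _; rewrite EFinM nnfun_muleindic_ge0.
under [RHS]eq_integral.
  move=> x xD; rewrite fimfunE -fsumEFin// muleC ge0_mule_fsumr; last first.
    by move=> r; rewrite EFinM nnfun_muleindic_ge0.
  over.
rewrite [RHS]ge0_integral_fsum//; last 2 first.
  - move=> r; apply: emeasurable_funM; first exact/measurable_EFinP.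
    by apply/measurable_EFinP/measurableT_comp.
  - move=> n x _; rewrite mule_ge0//; first by rewrite lee_fin.
    by rewrite EFinM nnfun_muleindic_ge0.
apply: eq_fsbigr => r _.
rewrite integralZl_indic_nnsfun// integral_indic// setIT nuE//.
rewrite [X in (_ * X)%E]integral_mkcond/=.
have [r0|r0] := ltP r 0.
  have -> : f @^-1` [set r] = set0.
    by apply/seteqP; split => x //= fxr; have : 0 <= f x := fun_ge0 x; rewrite fxr leNgt r0.
  rewrite patch_set0 integral0_eq//= mule0 integral0_eq// => x _.
  by rewrite indic0 mulr0 mule0.
rewrite -ge0_integralZl//.
- apply: eq_integral => x _; rewrite patchE indicE; case: ifPn => _.
    by rewrite mulr1 muleC.
  by rewrite mulr0 !mule0.
- apply/measurable_restrict => //=; apply: measurable_funTS; exact/measurable_EFinP.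
- by move=> x _; rewrite patchE; case: ifPn => //; rewrite lee_fin.
Qed.

Lemma ge0_integral_density (f : T -> \bar R) :
  measurable_fun setT f -> (forall x, 0 <= f x)%E ->
  (\int[nu]_x f x = \int[mu]_x (f x * (p x)%:E))%E.
Proof.
move=> mf f0.
pose f_ := nnsfun_approx measurableT mf.
transitivity (lim (\int[nu]_x (f_ n x)%:E @[n --> \oo])%E).
  rewrite -monotone_convergence//=.
  - apply: eq_integral => ? /[!inE] xD; apply/esym/cvg_lim => //=.
    exact: cvg_nnsfun_approx.
  - by move=> n; exact/measurable_EFinP/measurable_funTS.
  - by move=> n ? _; rewrite lee_fin.
  - by move=> ? _ ? ? mn; rewrite lee_fin; exact/lefP/nd_nnsfun_approx.
rewrite [RHS](_ : _ = lim (\int[mu]_x ((f_ n x)%:E * (p x)%:E) @[n --> \oo])%E); last first.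
  rewrite -monotone_convergence//=.
  - apply: eq_integral => x _; apply/esym/cvg_lim => //; apply: cvgeZr => //.
    exact: cvg_nnsfun_approx.
  - by move=> n; apply: emeasurable_funM; exact/measurable_EFinP.
  - by move=> n x _; rewrite mule_ge0 ?lee_fin.
  - move=> x _ m n mn; rewrite lee_wpmul2r ?lee_fin//.
    exact/lefP/nd_nnsfun_approx.
by congr (limn _); apply/funext => n; exact: (integral_density_nnsfun (f_ n)).
Qed.

End density.

Section affine_change_of_variable.
Context {R : realType}.
Implicit Types (m s x : R).
Local Notation mu := (@lebesgue_measure R).

Lemma measurable_affine m s :
  measurable_fun setT (fun x : measurableTypeR R => m + s * x : measurableTypeR R).
Proof. by apply: measurable_funD => //; exact: measurable_funM. Qed.

Lemma lebesgue_measure_affine m s (A : set R) : 0 < s -> measurable A ->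
  mu A = (s%:E * mu ((fun x => (m + s * x)%R) @^-1` A))%E.
Proof.
move=> s0; pose S := NngNum (ltW s0).
pose f := fun x : measurableTypeR R => m + s * x : measurableTypeR R.
have mf : measurable_fun setT f := measurable_affine m s.
pose mf' := isMeasurableFun.Build _ _ _ _ _ mf.
pose F : {mfun _ >-> _} := HB.pack f mf'.
move: A; apply: (@lebesgue_measure_unique _ (mscale S (pushforward mu F))).
move=> _ [[a b] _ <-]/=.
rewrite /mscale/= /pushforward (_ : _ @^-1` _ = `](a - m) / s, (b - m) / s]%classic); last first.
  apply/seteqP; split => x /=; rewrite !in_itv/= ltr_pdivrMr// ler_pdivlMr// /f => /andP[? ?]; apply/andP; split; lra.
rewrite !lebesgue_measure_itv/= !lte_fin ltr_pM2r ?invr_gt0// ltrBlDr subrK.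
case: ifPn => _; last by rewrite mule0.
by rewrite -!EFinB -EFinM; congr EFin; field; rewrite gt_eqF.
Qed.

Lemma ge0_integral_affine m s (f : R -> \bar R) : 0 < s ->
  measurable_fun setT f -> (forall x, 0 <= f x)%E ->
  (\int[mu]_y f y = s%:E * \int[mu]_x f (m + s * x)%R)%E.
Proof.
move=> s0 mf f0; 
pose S := NngNum (ltW s0).
pose g := fun x : measurableTypeR R => m + s * x : measurableTypeR R.
have mg : measurable_fun setT g := measurable_affine m s.
have H A : measurable A -> mu A = mscale S (pushforward mu g : {measure set _ -> \bar R}) A.
  by move=> mA; rewrite (lebesgue_measure_affine m s0)//.
rewrite -[RHS](_ : (\int[mscale S (pushforward mu g : {measure set _ -> \bar R})]_y f y = _)%E).
  by apply: eq_measure_integral => A mA _; exact: H.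
by rewrite ge0_integral_mscale// ge0_integral_pushforward.
Qed.

End affine_change_of_variable.

Section sections_of_product_sets.
Context d1 d2 (T1 : measurableType d1) (T2 : measurableType d2) {R : realType}.
Variables (P1 : probability T1 R) (P2 : probability T2 R) (A : set (T1 * T2)).
Hypothesis mA : measurable A.

Lemma measurable_section1 x : measurable [set y | A (x, y)].
Proof.
by have := measurable_xsection x mA; rewrite xsectionE.
Qed.

Lemma measurable_section2 y : measurable [set x | A (x, y)].
Proof.
by have := measurable_ysection y mA; rewrite ysectionE.
Qed.

Lemma measurable_fun_section1 : measurable_fun setT (fun x => P2 [set y | A (x, y)]).
Proof.
have := measurable_fun_xsection P2 mA.
by apply: eq_measurable_fun => x _ /=; rewrite xsectionE.
Qed.

Lemma product_sections1 : ((P1 \x P2) A = \int[P1]_x P2 [set y | A (x, y)])%E.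
Proof.
rewrite -[in LHS](setIT A) -integral_indic// fubini_tonelli1//; last exact/measurable_EFinP/measurable_indic.
apply: eq_integral => x _; rewrite /fubini_F -[in RHS](setIT [set y | _]) -integral_indic//.
exact: measurable_section1.
Qed.

Lemma product_sections2 : ((P1 \x P2) A = \int[P2]_y P1 [set x | A (x, y)])%E.
Proof.
rewrite -[in LHS](setIT A) -integral_indic// fubini_tonelli2//; last exact/measurable_EFinP/measurable_indic.
apply: eq_integral => y _; rewrite /fubini_G -[in RHS](setIT [set x | _]) -integral_indic//.
exact: measurable_section2.
Qed.

End sections_of_product_sets.

Section normal_law.
Context {R : realType}.
Implicit Types (m s x r v lam : R) (B : set R).
Local Notation mu := (@lebesgue_measure R).
Local Notation N01 := (@normal_prob R 0 1).

Lemma normal_peakM s x : 0 < s -> 0 < x -> normal_peak (s * x) = s^-1 * normal_peak x.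
Proof.
move=> s0 x0; rewrite /normal_peak -invfM; congr (_^-1).
by rewrite exprMn -mulrA -mulrnAr sqrtrM ?sqr_ge0// sqrtr_sqr gtr0_norm.
Qed.

Lemma normal_pdf_affine m s x : 0 < s ->
  s * normal_pdf m s (m + s * x) = normal_pdf 0 1 x.
Proof.
move=> s0; have s1 := gt_eqF s0; rewrite !normal_pdfE ?s1 ?oner_eq0//.
rewrite -[X in normal_peak X]mulr1 normal_peakM// -(mulrA s^-1) mulVKf ?s1//.
congr (_ * expR _).
by field; rewrite s1.
Qed.

Lemma normal_prob_affine m s B : 0 < s -> measurable B ->
  normal_prob m s B = N01 ((fun x => m + s * x) @^-1` B).
Proof.
move=> s0 mB; have mA := measurable_affine m s.
rewrite /normal_prob integral_mkcond [RHS]integral_mkcond.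
rewrite (ge0_integral_affine m s0); last 2 first.
- apply/(measurable_restrictT _ mB)/measurable_funTS/measurable_EFinP.
  exact: measurable_normal_pdf.
- by move=> x; rewrite patchE; case: ifP => // _; rewrite lee_fin normal_pdf_ge0.
rewrite -ge0_integralZl//; last 3 first.
- apply: measurableT_comp mA.
  apply/(measurable_restrictT _ mB)/measurable_funTS/measurable_EFinP.
  exact: measurable_normal_pdf.
- by move=> x _; rewrite patchE; case: ifP => // _; rewrite lee_fin normal_pdf_ge0.
- by rewrite lee_fin ltW.
apply: eq_integral => x _; rewrite !patchE.
rewrite (_ : (x \in _ @^-1` _) = (m + s * x \in B)); last by apply/idP/idP; rewrite !inE.
by case: ifP => _; rewrite ?mule0// -EFinM normal_pdf_affine.
Qed.

Lemma normal_prob_opp B : measurable B -> N01 (-%R @^-1` B) = N01 B.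
Proof.
move=> mB; rewrite /normal_prob.
have mN : measurable_fun setT (-%R : measurableTypeR R -> measurableTypeR R).
  exact: oppr_measurable.
transitivity (\int[pushforward mu (-%R : measurableTypeR R -> measurableTypeR R)]_(x in B) (normal_pdf 0 1 x)%:E)%E; last first.
  by apply: eq_measure_integral => A mA _; exact: lebesgue_measureN.
rewrite (@ge0_integral_pushforward _ _ (measurableTypeR R) (measurableTypeR R) R -%R mN mu B); last 3 first.
- exact: mB.
- by apply/measurable_funTS/measurable_EFinP; exact: measurable_normal_pdf.
- by move=> x _; rewrite lee_fin normal_pdf_ge0.
apply: eq_integral => x _ /=; congr EFin.
rewrite !normal_pdfE ?oner_eq0//; congr (_ * expR _).
by rewrite !subr0 sqrrN.
Qed.

(** The root [s] may have either sign, and [s = 0] gives the Dirac law. Every centered normal law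
    becomes the image of one standard normal variable, which removes the case distinction of the
    definition. *)
Lemma centered_normalE v s B : s ^+ 2 = v -> measurable B ->
  centered_normal v B = N01 ((fun z => s * z) @^-1` B).
Proof.
move=> sv mB; rewrite /centered_normal -sv sqrf_eq0.
have [->|s0] := eqVneq s 0.
  rewrite diracE; have -> : (fun z : R => 0 * z) @^-1` B = [set _ | B 0].
    by apply/seteqP; split => z /=; rewrite mul0r.
  have [B0|B0] := pselect (B 0).
    rewrite mem_set// (_ : [set _ | _] = setT) ?probability_setT//.
    by apply/seteqP; split.
  rewrite memNset// (_ : [set _ | _] = set0) ?measure0//.
  by apply/seteqP; split.
rewrite sqrtr_sqr normal_prob_affine// ?normr_gt0//.
have [s_ge0|s_lt0] := leP 0 s.
  by congr N01; apply/seteqP; split => z /=; rewrite add0r ger0_norm.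
rewrite -normal_prob_opp; last first.
  by apply: preimage_measurable; first exact: measurable_affine.
congr N01; apply/seteqP; split => z /=.
  by rewrite add0r ltr0_norm// mulrNN.
by rewrite add0r ltr0_norm// mulrNN.
Qed.

(** Exponential tilting: the standard density at z is exp(1/2 - z) times the density of mean 1, and
    the first factor is at most exp(1/2 - x) for z > x. *)
Lemma normal_upper_tail x : (N01 [set z | (x < z)%R] <= (expR (2^-1 - x))%:E)%E.
Proof.
have mS : measurable [set z : R | x < z].
  rewrite (_ : [set z | _] = `]x, +oo[%classic)//.
  by apply/seteqP; split => z /=; rewrite in_itv/= andbT.
apply: (@le_trans _ _ (\int[mu]_(z in [set z | (x < z)%R])
   ((expR (2^-1 - x))%:E * (normal_pdf 1 1 z)%:E))%E).
  apply: ge0_le_integral => //.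
  - by move=> z _; rewrite lee_fin normal_pdf_ge0.
  - by apply/measurable_funTS/measurable_EFinP; exact: measurable_normal_pdf.
  - apply/measurable_funTS/measurable_EFinP; apply: measurable_funM => //; exact: measurable_normal_pdf.
  - move=> z /= xz; rewrite -EFinM lee_fin !normal_pdfE ?oner_eq0//.
    rewrite mulrCA ler_pM2l ?normal_peak_gt0 ?oner_eq0//.
    rewrite -expRD ler_expR; lra.
rewrite ge0_integralZl//; last 2 first.
- by apply/measurable_funTS/measurable_EFinP; exact: measurable_normal_pdf.
- by move=> z _; rewrite lee_fin normal_pdf_ge0.
rewrite -[leRHS]mule1 lee_pmul2l// ?lte_fin ?expR_gt0//.
exact: (@probability_le1 _ _ _ (normal_prob 1 1)).
Qed.

Lemma normal_tail (k : nat) : exists2 C : R, 0 <= C & forall x, 0 < x ->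
  (N01 [set z | (x < `|z|)%R] <= (C * x^-1 ^+ k)%:E)%E.
Proof.
(* The factor 2 exp(1/2) counts the two tails, and k^k comes from x^k <= k^k exp(x), the k-th power
   of x / k <= exp(x / k). *)
exists (2 * expR 2^-1 * k%:R ^+ k); first by rewrite !mulr_ge0 ?exprn_ge0.
move=> x x0.
have mS : measurable [set z : R | x < z].
  rewrite (_ : [set z | _] = `]x, +oo[%classic)//.
  by apply/seteqP; split => z /=; rewrite in_itv/= andbT.
have mN : measurable (-%R @^-1` [set z : R | x < z]).
  exact: preimage_measurable.
rewrite (_ : [set z | _] = [set z | x < z] `|` -%R @^-1` [set z | x < z]); last first.
  by apply/seteqP; split => z /=; rewrite lter_normr => /orP.
rewrite (le_trans (measureU2 N01 mS mN))//= normal_prob_opp//.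
rewrite (le_trans (leeD (normal_upper_tail x) (normal_upper_tail x)))//.
rewrite -EFinD lee_fin -mulr2n -[leLHS]mulr_natl -!mulrA ler_pM2l// expRD ler_pM2l ?expR_gt0//.
rewrite expRN exprVn ler_pdivlMr ?exprn_gt0// mulrC.
rewrite ler_pdivrMr ?expR_gt0//.
case: k => [|k]; first by rewrite !expr0 mul1r ltW// expR_gt1.
have {1}-> : x = k.+1%:R * (x / k.+1%:R) by rewrite mulrCA divff ?mulr1// pnatr_eq0.
rewrite exprMn ler_pM2l ?exprn_gt0//.
have -> : expR x = expR (x / k.+1%:R) ^+ k.+1.
  by rewrite -expRM_natl mulrCA divff ?mulr1// pnatr_eq0.
rewrite lerXn2r ?nnegrE ?expR_ge0//; first by rewrite divr_ge0// ltW.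
by rewrite (le_trans _ (expR_ge1Dx _))// lerDr.
Qed.

(** [C] depends on [k] only, so one constant serves all pairs of times, all scales and all values of
    a random variance. *)
Lemma centered_normal_tail (k : nat) : exists2 C : R, 0 <= C &
  forall v r lam, v <= r ^+ 2 -> 0 < r -> 0 < lam -> 0 <= v ->
  (centered_normal v [set z | (lam < `|z|)%R] <= (C * (r / lam) ^+ k)%:E)%E.
Proof.
have [C C0 CP] := normal_tail k; exists C => // v r lam vr r0 lam0 v0.
have mS (x : R) : measurable [set z : R | x < `|z|].
  rewrite (_ : [set z | _] = (@Num.norm _ R) @^-1` `]x, +oo[%classic); last first.
    by apply/seteqP; split => z /=; rewrite in_itv/= andbT.
  exact: preimage_measurable.
rewrite (@centered_normalE v (Num.sqrt v))//; last by rewrite sqr_sqrtr.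
apply: (@le_trans _ _ (N01 [set z | (lam / r < `|z|)%R])).
  apply: le_measure; rewrite ?inE//.
    by apply: preimage_measurable; first exact: measurable_funM.
    exact: mS.
  move=> z /=; rewrite normrM ger0_norm ?sqrtr_ge0// => lz.
  rewrite ltr_pdivrMr// (lt_le_trans lz)// mulrC ler_wpM2l//.
  by rewrite -(gtr0_norm r0) -sqrtr_sqr ler_wsqrtr.
by rewrite -[X in C * X ^+ _]invf_div; apply: CP; rewrite divr_gt0.
Qed.

End normal_law.

Section normal_convolution.
Context {R : realType}.
Implicit Types (m s x c z : R) (B : set R).
Local Notation mu := (@lebesgue_measure R).
Local Notation N01 := (@normal_prob R 0 1).

(** Completing the square: the joint density of x and z = s x + s' y factors into the density of z
    and the conditional density of x given z, of mean s z / c^2 and deviation s' / c. *)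
Lemma normal_pdf_mul s s' c x z : 0 < s -> 0 < s' -> 0 < c -> c ^+ 2 = s ^+ 2 + s' ^+ 2 ->
  normal_pdf (s * x) s' z * normal_pdf 0 1 x =
  normal_pdf 0 c z * normal_pdf (s * z / c ^+ 2) (s' / c) x.
Proof.
move=> s0 s'0 c0 cE.
have sc : 0 < s' / c by rewrite divr_gt0.
rewrite !normal_pdfE ?oner_eq0 ?gt_eqF//.
rewrite [LHS]mulrACA [RHS]mulrACA -!expRD; congr (_ * expR _).
  rewrite mulrC -[X in _ * normal_peak X](mulr1 s') normal_peakM//.
  rewrite -[X in _ = normal_peak X * _](mulr1 c) normal_peakM//.
  rewrite -(mulr1 (s' / c)) normal_peakM//.
  by field; rewrite !gt_eqF.
have : s ^+ 2 = c ^+ 2 - s' ^+ 2 by rewrite cE; ring.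
move=> sE.
have -> : - (z - s * x) ^+ 2 / (s' ^+ 2 *+ 2) + - (x - 0) ^+ 2 / (1 ^+ 2 *+ 2) =
   - (z ^+ 2 - z * s * x *+ 2 + (s ^+ 2 + s' ^+ 2) * x ^+ 2) / (s' ^+ 2 *+ 2).
  by field; rewrite gt_eqF.
rewrite -cE.
have -> : - (x - s * z / c ^+ 2) ^+ 2 / ((s' / c) ^+ 2 *+ 2) =
   - (x ^+ 2 * c ^+ 2 - x * s * z *+ 2 + s ^+ 2 * z ^+ 2 / c ^+ 2) / (s' ^+ 2 *+ 2).
  by field; rewrite !gt_eqF.
by rewrite sE; field; rewrite !gt_eqF.
Qed.

Lemma integral_normal_prob m s (f : R -> \bar R) :
  measurable_fun setT f -> (forall x, 0 <= f x)%E ->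
  (\int[normal_prob m s]_x f x = \int[mu]_x (f x * (normal_pdf m s x)%:E))%E.
Proof.
move=> mf f0.
apply: (@ge0_integral_density _ (measurableTypeR R) R mu (normal_prob m s) (normal_pdf m s)) => //.
- exact: measurable_normal_pdf.
- exact: normal_pdf_ge0.
Qed.

(** Tonelli puts x innermost, where the conditional density of [normal_pdf_mul] integrates to 1. *)
Lemma normal_convolution_pos s s' c B : 0 < s -> 0 < s' -> 0 < c ->
  c ^+ 2 = s ^+ 2 + s' ^+ 2 -> measurable B ->
  (\int[N01]_x N01 [set y | B (s * x + s' * y)%R] = normal_prob 0 c B)%E.
Proof.
move=> s0 s'0 c0 cE mB.
have mF : measurable_fun setT (fun z : R * R =>
    ((\1_B z.2 : R)%:E * (normal_pdf 0 c z.2 * normal_pdf (s * z.2 / c ^+ 2) (s' / c) z.1)%:E)%E).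
  apply: emeasurable_funM.
    by apply/measurable_EFinP; apply: measurableT_comp => //; exact: measurable_indic.
  apply/measurable_EFinP.
  under eq_fun do rewrite -normal_pdf_mul//.
  apply: measurable_funM; last by apply: measurableT_comp => //; exact: measurable_normal_pdf.
  rewrite (_ : (fun _ => _) = fun z : R * R => normal_pdf 0 s' (z.2 - s * z.1)).
    apply: measurableT_comp; first exact: measurable_normal_pdf.
    apply: measurable_funB => //; exact: measurable_funM.
  apply/funext => z; rewrite !normal_pdfE ?gt_eqF//; congr (_ * expR _).
  by rewrite subr0.
transitivity (\int[mu]_x \int[mu]_z ((\1_B z : R)%:E *
   (normal_pdf 0 c z * normal_pdf (s * z / c ^+ 2) (s' / c) x)%:E))%E.
  rewrite integral_normal_prob//; last first.
    have mS : measurable_fun setT (fun z : measurableTypeR R * measurableTypeR R =>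
        s * z.1 + s' * z.2 : measurableTypeR R).
      by apply: measurable_funD; apply: measurable_funM.
    exact: (measurable_fun_section1 N01 (preimage_measurable mS mB)).
  apply: eq_integral => x _.
  rewrite -(_ : normal_prob (s * x) s' B = N01 [set y | B (s * x + s' * y)]); last first.
    by rewrite normal_prob_affine.
  rewrite /normal_prob integral_mkcond/= -ge0_integralZr//; last 3 first.
  - apply/(measurable_restrictT _ mB)/measurable_funTS/measurable_EFinP.
    exact: measurable_normal_pdf.
  - by move=> z _; rewrite patchE; case: ifP => // _; rewrite lee_fin normal_pdf_ge0.
  - by rewrite lee_fin normal_pdf_ge0.
  apply: eq_integral => z _; rewrite patchE indicE; case: ifP => _.
    by rewrite mul1e -EFinM (normal_pdf_mul x z s0 s'0 c0 cE).
  by rewrite !mul0e.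
rewrite (fubini_tonelli (m1 := mu) (m2 := mu) (fun p => ((\1_B p.2 : R)%:E *
   (normal_pdf 0 c p.2 * normal_pdf (s * p.2 / c ^+ 2) (s' / c) p.1)%:E)%E))//=; last first.
  by move=> p; rewrite mule_ge0 ?lee_fin ?mulr_ge0 ?normal_pdf_ge0.
rewrite /normal_prob [RHS]integral_mkcond/=; apply: eq_integral => z _.
under eq_integral do rewrite EFinM muleA.
rewrite ge0_integralZl//; last 3 first.
- by apply/measurable_EFinP; exact: measurable_normal_pdf.
- by move=> x _; rewrite lee_fin normal_pdf_ge0.
- by rewrite mule_ge0 ?lee_fin ?normal_pdf_ge0.
rewrite integral_normal_pdf mule1 patchE indicE; case: ifP => _; first by rewrite mul1e.
by rewrite mul0e.
Qed.

Lemma product_normal d1 d2 (T1 : measurableType d1) (T2 : measurableType d2)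
    (P1 : probability T1 R) (P2 : probability T2 R) (U : T1 -> R) (V : T2 -> R)
    (u v : R) B : 0 <= u -> 0 <= v ->
  measurable_fun setT U -> measurable_fun setT V ->
  (forall B, measurable B -> P1 (U @^-1` B) = centered_normal u B) ->
  (forall B, measurable B -> P2 (V @^-1` B) = centered_normal v B) ->
  measurable B ->
  (P1 \x P2)%E [set w | B (U w.1 + V w.2)] = centered_normal (u + v) B.
Proof.
move=> u0 v0 mU mV lU lV mB.
have mUV : measurable [set w : T1 * T2 | B (U w.1 + V w.2)].
  apply: (@preimage_measurable _ _ _ _ (fun w : T1 * T2 => U w.1 + V w.2)) mB.
  by apply: measurable_funD; apply: measurableT_comp.
have mT (a : R) : measurable [set t | B (a + t)].
  by apply: preimage_measurable => //; exact: measurable_funD.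
have mT' (a : R) : measurable [set t | B (t + a)].
  by apply: preimage_measurable => //; exact: measurable_funD.
have centered0 (C : set R) : centered_normal 0 C = (\1_C 0)%:E.
  by rewrite /centered_normal eqxx diracE indicE.
(* A Dirac factor has no density, so zero variances are split off and treated by Fubini alone. *)
have [u00|un0] := eqVneq u 0.
  subst u.
  rewrite add0r -lV// product_sections2//=.
  rewrite -[in RHS](setIT (V @^-1` B)) -integral_indic//; last exact: preimage_measurable.
  apply: eq_integral => y _.
  transitivity (P1 (U @^-1` [set t | B (t + V y)])) => //.
  rewrite lU// centered0 !indicE; congr ((nat_of_bool _)%:R%:E); apply/idP/idP; by rewrite !inE/= add0r.
have [v00|vn0] := eqVneq v 0.
  subst v.
  rewrite addr0 -lU// product_sections1//=.
  rewrite -[in RHS](setIT (U @^-1` B)) -integral_indic//; last exact: preimage_measurable.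
  apply: eq_integral => x _.
  transitivity (P2 (V @^-1` [set t | B (U x + t)])) => //.
  rewrite lV// centered0 !indicE; congr ((nat_of_bool _)%:R%:E); apply/idP/idP; by rewrite !inE/= addr0.
set s := Num.sqrt u; set s' := Num.sqrt v; set c := Num.sqrt (u + v).
have s0 : 0 < s by rewrite sqrtr_gt0 lt_neqAle eq_sym un0.
have s'0 : 0 < s' by rewrite sqrtr_gt0 lt_neqAle eq_sym vn0.
have uv0 : 0 < u + v by rewrite ltr_wpDr// lt_neqAle eq_sym un0.
have c0 : 0 < c by rewrite sqrtr_gt0.
have cE : c ^+ 2 = s ^+ 2 + s' ^+ 2 by rewrite !sqr_sqrtr// ltW.
rewrite [RHS]/centered_normal gt_eqF// -/c -(normal_convolution_pos s0 s'0 c0 cE)//.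
have m2 : measurable [set w : T1 * R | B (U w.1 + s' * w.2)].
  apply: (@preimage_measurable _ _ _ _ (fun w : T1 * R => U w.1 + s' * w.2)) mB.
  by apply: measurable_funD; [exact: measurableT_comp|exact: measurable_funM].
have m3 : measurable [set w : R * R | B (s * w.1 + s' * w.2)].
  apply: (@preimage_measurable _ _ _ _ (fun w : R * R => s * w.1 + s' * w.2)) mB.
  by apply: measurable_funD; exact: measurable_funM.
rewrite product_sections1//=.
(* [V] and then [U] are replaced by multiples of a standard normal variable; each time the order of
   integration puts the replaced variable innermost. *)
transitivity ((P1 \x N01)%E [set w : T1 * measurableTypeR R | B (U w.1 + s' * w.2)]).
  rewrite product_sections1//=; apply: eq_integral => x _.
  transitivity (P2 (V @^-1` [set t | B (U x + t)])) => //.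
  by rewrite lV// (centered_normalE (s := s')) ?sqr_sqrtr.
rewrite product_sections2//=.
transitivity ((N01 \x N01)%E [set w : measurableTypeR R * measurableTypeR R | B (s * w.1 + s' * w.2)]); last first.
  by rewrite product_sections1.
rewrite product_sections2//=; apply: eq_integral => y _.
transitivity (P1 (U @^-1` [set t | B (t + s' * y)])) => //.
by rewrite lU// (centered_normalE (s := s)) ?sqr_sqrtr.
Qed.

End normal_convolution.

Section centered_normal_kernel.
Context {R : realType}.

(** By [centered_normalE] the map is the measure of a section of a product set, so it is measurable
    also across the change of formula at variance 0. *)
Lemma measurable_centered_normal d (T : measurableType d) (v : T -> R) (B : set R) :
  measurable_fun setT v -> (forall w, 0 <= v w) -> measurable B ->
  measurable_fun setT (fun w => centered_normal (v w) B).
Proof.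
move=> mv v0 mB.
have mS : measurable_fun setT (fun z : T * measurableTypeR R =>
   Num.sqrt (v z.1) * z.2 : measurableTypeR R).
  apply: measurable_funM => //; apply: measurableT_comp.
    by apply: continuous_measurable_fun; exact: sqrt_continuous.
  exact: measurableT_comp.
have := measurable_fun_section1 (@normal_prob R 0 1) (preimage_measurable mS mB).
apply: eq_measurable_fun => w _ /=.
by rewrite (centered_normalE (s := Num.sqrt (v w))) ?sqr_sqrtr.
Qed.

Lemma centered_normal_ge0 (v : R) (B : set R) : (0 <= centered_normal v B)%E.
Proof. by rewrite /centered_normal; case: ifP. Qed.

End centered_normal_kernel.

(** * A sequence of independent normal variables *)

Section truncation.
Context {R : realType}.

Lemma measurable_truncn : measurable_fun setT (@Num.truncn R).
Proof.
move=> _ B _; rewrite setTI.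
rewrite (_ : _ @^-1` B = \bigcup_(k in B) [set x : R | Num.truncn x = k]); last first.
  apply/seteqP; split => x /=; first by move=> Bx; exists (Num.truncn x).
  by case=> k Bk /= ->.
apply: bigcup_measurable => k _.
have mle n : measurable [set x : R | (Num.truncn x <= n)%N].
  rewrite (_ : [set x | _] = `]-oo, n.+1%:R[%classic)//.
  by apply/seteqP; split => x /=; rewrite in_itv/= truncn_le_nat.
case: k => [|k].
  rewrite (_ : [set x | _] = [set x : R | (Num.truncn x <= 0)%N])//.
  by apply/seteqP; split => x /=; rewrite leqn0 => /eqP.
rewrite (_ : [set x | _] = [set x : R | (Num.truncn x <= k.+1)%N] `\`
    [set x : R | (Num.truncn x <= k)%N]); first exact: measurableD.
apply/seteqP; split => x /=; first by move=> ->; split; lia.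
by case=> ? /negP; lia.
Qed.

Lemma truncn_double_half (x : R) : 0 <= x -> (Num.truncn (2 * x))./2 = Num.truncn x.
Proof.
move=> x0; have /andP[t1 t2] := truncn_itv x0.
have [h1 h2] : ((Num.truncn x).*2 <= Num.truncn (2 * x))%N /\
    (Num.truncn (2 * x) < (Num.truncn x).+1.*2)%N.
  rewrite truncn_ge_nat ?mulr_ge0// truncn_lt_nat ?mulr_ge0// -!muln2 !natrM.
  by split; lra.
lia.
Qed.

End truncation.

Definition prefix_set (e : nat -> bool) n : set (nat -> bool) :=
  [set f | forall i, (i < n)%N -> f i = e i].

(** The empty set makes the family stable under intersection: two prefixes are either nested or
    incompatible. *)
Definition prefix_sets : set (set (nat -> bool)) :=
  [set A | A = set0 \/ exists e n, A = prefix_set e n].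

Definition bit_sequence := g_sigma_algebraType prefix_sets.

Section bit_sequences.

Lemma prefix_setS e n : prefix_set e n.+1 = prefix_set e n `&` [set f | f n = e n].
Proof.
apply/seteqP; split => f /=; first by move=> fe; split; [move=> i ni; apply: fe; lia|exact: fe].
by case=> fe fn i; rewrite ltnS leq_eqVlt => /orP[/eqP->//|]; exact: fe.
Qed.

Lemma prefix_sets_setI : setI_closed prefix_sets.
Proof.
move=> A B [->|[e [n ->]]]; first by rewrite set0I; left.
move=> [->|[e' [n' ->]]]; first by rewrite setI0; left.
wlog nn : e n e' n' / (n <= n')%N.
  move=> H; have [nn|/ltnW nn] := leqP n n'; first exact: H.
  by rewrite setIC; exact: H.
have [ee|ee] := pselect (forall i, (i < n)%N -> e i = e' i).
  right; exists e', n'; apply/seteqP; split => f /=; first by case.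
  by move=> fe; split => // i ni; rewrite ee// fe//; lia.
left; apply/seteqP; split => f //= [fe fe']; apply: ee => i ni.
by rewrite -fe// fe'//; lia.
Qed.

Lemma measurable_bit n b : measurable [set f : bit_sequence | f n = b].
Proof.
pose e (t : n.+1.-tuple bool) := nth false t.
rewrite (_ : [set f | _] = \bigcup_(t in [set t | e t n = b]) prefix_set (e t) n.+1).
  apply: fin_bigcup_measurable; first exact: finite_finset.
  by move=> t _; apply: sub_sigma_algebra; right; exists (e t), n.+1.
apply/seteqP; split => f /=.
  move=> fn; exists [tuple f i | i < n.+1] => /=.
    by rewrite /e -[X in nth _ _ X]/(nat_of_ord (@ord_max n)) -tnth_nth tnth_mktuple.
  by move=> i ni /=; rewrite /e -[X in nth _ _ X]/(nat_of_ord (Ordinal ni)) -tnth_nth tnth_mktuple.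
by case=> t /= <-; apply.
Qed.

Lemma measurable_fun_bits d (T : measurableType d) (f : T -> nat -> bool) :
  (forall n, measurable_fun setT (f^~ n)) ->
  measurable_fun setT (f : T -> bit_sequence).
Proof.
move=> mf _ B; rewrite setTI; move: B.
have : sigma_algebra setT [set B | measurable (f @^-1` B)].
  split => /=; first by rewrite preimage_set0.
  - by move=> A mA; rewrite setTD preimage_setC; exact: measurableC.
  - by move=> A mA; rewrite preimage_bigcup; exact: bigcupT_measurable.
move=> /smallest_sub; apply=> _ [->|[e [n ->]]] /=; first by rewrite preimage_set0.
elim: n => [|n IH].
  by rewrite (_ : _ @^-1` _ = setT)//; apply/seteqP; split.
rewrite prefix_setS preimage_setI; apply: measurableI => //.
exact: (@preimage_measurable _ _ _ _ (f^~ n) [set e n]).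
Qed.

Definition even_bits (f : bit_sequence) : bit_sequence := fun n => f n.*2.
Definition odd_bits (f : bit_sequence) : bit_sequence := fun n => f n.*2.+1.
Definition interleave (p : bit_sequence * bit_sequence) : bit_sequence :=
  fun n => if odd n then p.2 n./2 else p.1 n./2.

Lemma measurable_nth_bit n : measurable_fun setT (fun f : bit_sequence => f n).
Proof. by apply: (@measurable_fun_bool _ _ _ _ true); rewrite setTI; exact: measurable_bit. Qed.

Lemma measurable_even_bits : measurable_fun setT even_bits.
Proof. by apply: measurable_fun_bits => n; exact: measurable_nth_bit. Qed.

Lemma measurable_odd_bits : measurable_fun setT odd_bits.
Proof. by apply: measurable_fun_bits => n; exact: measurable_nth_bit. Qed.

Lemma measurable_interleave : measurable_fun setT interleave.
Proof.
apply: measurable_fun_bits => n; rewrite /interleave; case: (odd n).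
  exact: (measurableT_comp (measurable_nth_bit n./2) measurable_snd).
exact: (measurableT_comp (measurable_nth_bit n./2) measurable_fst).
Qed.

Lemma interleaveK p : (even_bits (interleave p), odd_bits (interleave p)) = p.
Proof.
case: p => f g; congr pair; apply/funext => n; rewrite /even_bits /odd_bits /interleave/=.
  by rewrite odd_double doubleK.
by rewrite odd_double/= uphalf_double.
Qed.

(** Among the first n positions, [uphalf n] are even and [n./2] are odd. *)
Lemma interleave_prefix e n : interleave @^-1` prefix_set e n =
  prefix_set (even_bits e) (uphalf n) `*` prefix_set (odd_bits e) n./2.
Proof.
apply/seteqP; split => -[f g] /=.
  move=> H; split => i ni /=.
    by have := H i.*2; rewrite /interleave odd_double doubleK; apply; lia.
  by have := H i.*2.+1; rewrite /interleave/= odd_double/= uphalf_double; apply; lia.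
move=> [H1 H2] i ni; rewrite /interleave; case: ifPn => oi.
  by rewrite /= H2 /odd_bits; [congr e|]; lia.
by rewrite /= H1 /even_bits; [congr e|]; lia.
Qed.

End bit_sequences.

Section uniform_bits.
Context {R : realType}.
Local Notation U := (uniform_prob (@ltr01 R)).

Lemma uniform_probE (A : set R) : measurable A ->
  U A = lebesgue_measure (A `&` `[0, 1]%classic).
Proof.
move=> mA; rewrite -[in LHS](setIT A) -integral_indic// integral_uniform//.
  by rewrite subr0 invr1 mul1e integral_indic.
exact/measurable_EFinP/measurable_indic.
Qed.

Lemma uniform_prob_itv (a b : R) : 0 <= a -> a <= b -> b <= 1 ->
  U `[a, b[%classic = (b - a)%:E.
Proof.
move=> a0 ab b1; rewrite uniform_probE//.
rewrite (_ : _ `&` _ = `[a, b[%classic); last first.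
  apply/seteqP; split => x /=; rewrite !in_itv/=; first by case.
  by move=> /andP[? ?]; split; [apply/andP|apply/andP; split; lra].
rewrite lebesgue_measure_itv/= lte_fin; case: ltP => // ba.
by rewrite (_ : b = a) ?subrr//; apply/eqP; rewrite eq_le ba.
Qed.

Lemma uniform_prob_congr (A B : set R) : measurable A -> measurable B ->
  A `&` `]0, 1[%classic = B `&` `]0, 1[%classic -> U A = U B.
Proof.
move=> mA mB AB.
have H (C : set R) : measurable C -> U C = lebesgue_measure (C `&` `]0, 1[%classic).
  move=> mC; rewrite uniform_probE//.
  rewrite (measureDI lebesgue_measure (measurableI _ _ mC (measurable_itv `[0, 1])) (measurable_itv `]0, 1[)).
  rewrite [X in (X + _)%E](_ : _ = 0%E) ?add0e; last first.
    apply/eqP; rewrite eq_le measure_ge0 andbT.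
    apply: (@le_trans _ _ (lebesgue_measure ([set 0 : R] `|` [set 1]))).
      apply: le_measure; rewrite ?inE.
      - by apply: measurableD => //; exact: measurableI.
      - exact: measurableU.
      - move=> x /= []; rewrite !in_itv/= => -[_ /andP[x0 x1]].
        move=> /negP; rewrite negb_and -!leNgt => /orP[|] h; [left|right]; apply/eqP; rewrite eq_le.
          by rewrite h.
        by rewrite x1.
    rewrite (le_trans (measureU2 lebesgue_measure _ _))//.
    have h (a : R) : (@lebesgue_measure R [set a] <= 0)%E by rewrite (lebesgue_measure_set1 a).
    by rewrite -[leRHS]adde0; apply: leeD; exact: h.
  congr lebesgue_measure; apply/seteqP; split => x /=; rewrite !in_itv/=; first by case=> -[].
  by move=> [Cx /andP[x0 x1]]; split; [split => //; rewrite !ltW|apply/andP].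
by rewrite !H// AB.
Qed.

Lemma uniform_prob_cdf (c : R) : 0 <= c <= 1 -> U `]-oo, c]%classic = c%:E.
Proof.
move=> /andP[c0 c1]; rewrite uniform_probE//.
rewrite (_ : _ `&` _ = `[0, c]%classic); last first.
  apply/seteqP; split => x /=; rewrite !in_itv/=; first by move=> [? /andP[-> _]].
  by move=> /andP[x0 xc]; rewrite x0 xc (le_trans xc).
rewrite lebesgue_measure_itv/= lte_fin; case: ltP => [_|]; first by rewrite sube0.
by move=> c0'; congr EFin; apply/eqP; rewrite eq_le c0.
Qed.

Definition bits_of (x : measurableTypeR R) : bit_sequence := fun n => odd (Num.truncn (2 ^+ n.+1 * x)).

Lemma measurable_bits_of : measurable_fun setT bits_of.
Proof.
apply: measurable_fun_bits => n; rewrite /bits_of.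
apply: (measurableT_comp (f := odd)) => //.
by apply: (measurableT_comp measurable_truncn); exact: measurable_funM.
Qed.

(** The integer whose binary digits, most significant first, are the first n bits. *)
Definition prefix_value (e : nat -> bool) : nat -> nat :=
  fix F n := if n is n'.+1 then (F n').*2 + e n' else 0%N.

Lemma prefix_value_lt e n : (prefix_value e n < 2 ^ n)%N.
Proof. by elim: n => [//|n IH] /=; rewrite expnS; case: (e n); lia. Qed.

Lemma bits_of_prefix e n (x : R) : 0 <= x < 1 ->
  prefix_set e n (bits_of x) <-> Num.truncn (2 ^+ n * x) = prefix_value e n.
Proof.
move=> /andP[x0 x1]; elim: n => [|n IH] /=.
  rewrite expr0 mul1r; split => // _; apply/eqP.
  by rewrite -leqn0 truncn_le_nat.
rewrite prefix_setS /=; have := truncn_double_half (x := 2 ^+ n * x).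
rewrite mulrA -exprS => /(_ (mulr_ge0 (exprn_ge0 _ (ler0n R 2)) x0)) H.
have := odd_double_half (Num.truncn (2 ^+ n.+1 * x)); rewrite H => E.
split.
  by move=> [/IH tE be]; rewrite -[LHS]E -tE -be addnC.
move=> tE; split; last by rewrite /bits_of tE oddD odd_double; case: (e n).
by apply/IH; rewrite -H tE; case: (e n); lia.
Qed.

HB.instance Definition _ := @isMeasurableFun.Build _ _ _ _ bits_of measurable_bits_of.

(** The fair coin measure: a prefix of length n corresponds to a dyadic interval of length 2^-n. *)
Definition bit_measure : probability bit_sequence R := distribution U bits_of.

Lemma uniform_prob_setI (A : set R) : measurable A -> U A = U (A `&` `[0, 1[%classic).
Proof.
move=> mA; rewrite (measureDI U mA (measurable_itv `[0, 1[)).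
rewrite -[RHS]add0e; congr (_ + _)%E; apply/eqP.
rewrite eq_le measure_ge0 andbT.
apply: (@le_trans _ _ (U (~` `[0, 1[%classic))).
  by apply: le_measure; rewrite ?inE; [exact: measurableD|exact: measurableC|move=> x []].
rewrite probability_setC//= (uniform_prob_itv (lexx _) ler01 (lexx _)).
by rewrite subr0 subee.
Qed.

Lemma bit_measure_prefix e n : bit_measure (prefix_set e n) = (2^-1 ^+ n)%:E.
Proof.
have mp : measurable (bits_of @^-1` prefix_set e n).
  apply: preimage_measurable; first exact: measurable_bits_of.
  by apply: sub_sigma_algebra; right; exists e, n.
have n0 : 0 < 2 ^+ n :> R by rewrite exprn_gt0.
rewrite [LHS]uniform_prob_setI//.
have kn := prefix_value_lt e n.
have kn' : (prefix_value e n).+1%:R <= 2 ^+ n :> R by rewrite -natrX ler_nat.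
rewrite (_ : _ `&` _ = `[(prefix_value e n)%:R / 2 ^+ n, (prefix_value e n).+1%:R / 2 ^+ n[%classic).
  rewrite uniform_prob_itv ?divr_ge0 ?ler_pM2r ?invr_gt0 ?ler_nat ?ler_pdivrMr ?mul1r//.
  by congr EFin; rewrite exprVn -mulrBl -natrB// subSnn mul1r.
apply/seteqP; split => x /=.
  move=> [+ x01]; rewrite in_itv/= in x01 => /(bits_of_prefix e n x01) tE.
  have /andP[x0 x1] := x01.
  rewrite in_itv/= ler_pdivrMr// ltr_pdivlMr// -tE mulrC.
  by rewrite truncn_itv// mulr_ge0// ltW.
rewrite in_itv/= ler_pdivrMr// ltr_pdivlMr// => /andP[h1 h2].
have x01 : 0 <= x < 1.
  apply/andP; split.
    by rewrite -(pmulr_lge0 _ n0) (le_trans _ h1).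
  by rewrite -(ltr_pM2r n0) mul1r (lt_le_trans h2).
split; last by rewrite in_itv.
by apply/(bits_of_prefix e n x01)/truncn_def; rewrite mulrC h1 h2.
Qed.

(** Two independent fair sequences interleave to a fair one, as is checked on prefixes. The
    independence within the normal sequence comes from this isomorphism of the coin space with its
    square. *)
Lemma bit_measure_interleave (A : set bit_sequence) : measurable A ->
  (bit_measure \x bit_measure)%E (interleave @^-1` A) = bit_measure A.
Proof.
move=> mA; have mi := measurable_interleave.
have mP e n : measurable (prefix_set e n : set bit_sequence).
  by apply: sub_sigma_algebra; right; exists e, n.
pose m2 : {measure set bit_sequence -> \bar R} :=
  pushforward (bit_measure \x bit_measure)%E interleave.
change (m2 mi A = bit_measure A).
have H := @measure_unique _ R bit_sequence prefix_sets (fun=> setT) erefl prefix_sets_setI.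
apply: (H _ _ (m2 mi) bit_measure _ _ A mA).
- move=> _; right; exists (fun=> false), 0%N; by apply/seteqP; split.
- by rewrite bigcup_const//; exists 0%N.
- move=> _ [->|[e [n ->]]]; first by rewrite !measure0.
  rewrite /m2 /= /pushforward interleave_prefix product_measure1E//.
  rewrite [RHS]bit_measure_prefix.
  transitivity ((2^-1 ^+ uphalf n : R)%:E * (2^-1 ^+ n./2 : R)%:E)%E.
    by congr (_ * _)%E; exact: bit_measure_prefix.
  rewrite -EFinM -exprD; congr ((_ ^+ _)%:E); lia.
- move=> _; rewrite /m2 /= /pushforward preimage_setT.
  by rewrite (le_lt_trans (probability_le1 (bit_measure \x bit_measure)%E measurableT))// ltry.
Qed.

Lemma bit_measure_split (E : set (bit_sequence * bit_sequence)) : measurable E ->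
  bit_measure [set f | E (even_bits f, odd_bits f)] = (bit_measure \x bit_measure)%E E.
Proof.
move=> mE; have mS : measurable [set f | E (even_bits f, odd_bits f)]; last first.
  rewrite -(bit_measure_interleave mS).
  by congr ((_ \x _)%E _); apply/seteqP; split => p /=; rewrite interleaveK.
apply: (@preimage_measurable _ _ _ _ (fun f => (even_bits f, odd_bits f)) E) => //.
by apply: measurable_fun_pair; [exact: measurable_even_bits|exact: measurable_odd_bits].
Qed.

Definition bit_sum n (f : bit_sequence) : R := \sum_(i < n) (f i)%:R / 2 ^+ i.+1.

Lemma measurable_bit_sum n : measurable_fun setT (bit_sum n).
Proof.
apply: measurable_sum => i; apply: measurable_funM => //.
exact: (measurableT_comp (f := fun b : bool => b%:R : R) _ (measurable_nth_bit i)).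
Qed.

Lemma bit_sum_bits_of n (x : R) : 0 <= x < 1 ->
  bit_sum n (bits_of x) = (Num.truncn (2 ^+ n * x))%:R / 2 ^+ n.
Proof.
move=> x01; have /(bits_of_prefix (bits_of x) n x01) -> : prefix_set (bits_of x) n (bits_of x) by [].
elim: n => [|n IH]; first by rewrite /bit_sum big_ord0 mul0r.
rewrite /bit_sum big_ord_recr/= -/(bit_sum n (bits_of x)) IH -muln2 natrD natrM exprS.
by field; rewrite expf_neq0.
Qed.

Lemma is_cvg_bit_sum (f : bit_sequence) : cvg (bit_sum n f @[n --> \oo]).
Proof.
apply: nondecreasing_is_cvgn.
  apply/nondecreasing_seqP => n; rewrite /bit_sum big_ord_recr/= lerDl.
  by rewrite divr_ge0.
exists 1 => _ [n _ <-].
suff : bit_sum n f <= 1 - 2^-1 ^+ n.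
  by move=> /le_trans; apply; rewrite lerBlDr lerDl exprn_ge0.
elim: n => [|n IH]; first by rewrite /bit_sum big_ord0 expr0 subrr.
rewrite /bit_sum big_ord_recr/= -/(bit_sum n f).
have : (f n)%:R / 2 ^+ n.+1 <= 2^-1 ^+ n.+1 :> R.
  by rewrite exprVn ler_piMl ?invr_ge0 ?exprn_ge0// lern1 leq_b1.
have : 2^-1 ^+ n = 2 * 2^-1 ^+ n.+1 :> R by rewrite exprS; field.
lra.
Qed.

Definition uniform_of_bits (f : bit_sequence) : R := limn (bit_sum ^~ f).

Lemma measurable_uniform_of_bits : measurable_fun setT uniform_of_bits.
Proof.
apply: (measurable_fun_cvg measurable_bit_sum) => f _; exact: is_cvg_bit_sum.
Qed.

Lemma cvg_truncn_pow2 (x : R) : 0 <= x ->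
  (Num.truncn (2 ^+ n * x))%:R / 2 ^+ n @[n --> \oo] --> x.
Proof.
move=> x0.
apply: (@squeeze_cvgr _ _ _ _ (fun n => x - 2^-1 ^+ n) (fun=> x)).
- apply: nearW => n; have n0 : 0 < 2 ^+ n :> R by rewrite exprn_gt0.
  have /andP[t1 t2] := truncn_itv (mulr_ge0 (ltW n0) x0).
  rewrite ler_pdivrMr// (mulrC x) t1 andbT ler_pdivlMr// mulrBl exprVn mulVf ?gt_eqF// (mulrC x).
  by rewrite lerBlDr natr1 ltW.
- rewrite -[X in _ --> X]subr0; apply: cvgB; first exact: cvg_cst.
  by apply: cvg_expr; rewrite ger0_norm//; lra.
- exact: cvg_cst.
Qed.

Lemma uniform_of_bitsK (x : R) : 0 <= x < 1 -> uniform_of_bits (bits_of x) = x.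
Proof.
move=> x01; apply/cvg_lim => //.
under eq_fun do rewrite bit_sum_bits_of//.
by apply: cvg_truncn_pow2; case/andP: x01.
Qed.

Lemma uniform_of_bits_law (B : set R) : measurable B ->
  bit_measure (uniform_of_bits @^-1` B) = U B.
Proof.
move=> mB.
have mS : measurable (bits_of @^-1` (uniform_of_bits @^-1` B)).
  apply: preimage_measurable; first exact: measurable_bits_of.
  by apply: preimage_measurable => //; exact: measurable_uniform_of_bits.
(* The digits of 1 are all 0, so a number is recovered from its digits only on [0, 1[; the point 1
   is discarded as null. *)
rewrite [LHS]uniform_prob_setI// [RHS]uniform_prob_setI//; congr (U _).
apply/seteqP; split => x /= [Bx x01]; split => //; move: x01 Bx; rewrite in_itv/= => x01.
  by rewrite uniform_of_bitsK.
by rewrite uniform_of_bitsK.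
Qed.

End uniform_bits.

(** * The quantile transform *)

Section quantile.
Context {R : realType}.
Local Notation U := (uniform_prob (@ltr01 R)).
Variable mu : probability (measurableTypeR R) R.

Let F (r : R) : R := fine (mu `]-oo, r]%classic).

Let FE r : mu `]-oo, r]%classic = (F r)%:E.
Proof. by rewrite /F fineK// fin_num_measure. Qed.

Let F_mono : {homo F : x y / x <= y}.
Proof.
move=> x y xy; rewrite -lee_fin -!FE; apply: le_measure; rewrite ?inE//.
by move=> z /=; rewrite !in_itv/= => /le_trans; apply.
Qed.

Let F_ge0 r : 0 <= F r.
Proof. by rewrite -lee_fin -FE. Qed.

Let F_le1 r : F r <= 1.
Proof. by rewrite -lee_fin -FE; exact: probability_le1. Qed.

Let F_right (a y : R) : (forall n, y <= F (a + n.+1%:R^-1)) -> y <= F a.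
Proof.
move=> H.
have Fl : mu `]-oo, a + n.+1%:R^-1]%classic @[n --> \oo] --> mu `]-oo, a]%classic.
  rewrite (_ : `]-oo, a]%classic = \bigcap_n `]-oo, a + n.+1%:R^-1]%classic).
    apply: (@nonincreasing_cvg_mu _ _ _ mu (fun n => `]-oo, a + n.+1%:R^-1]%classic)) => //.
    - by rewrite (le_lt_trans (probability_le1 _ _))// ltry.
    - exact: bigcapT_measurable.
    - move=> n m nm; apply/subsetPset => z /=; rewrite !in_itv/= => /le_trans; apply.
      by rewrite lerD2l lef_pV2 ?posrE// ler_nat.
  apply/seteqP; split => z /=; rewrite !in_itv/=.
    by move=> za n _ /=; rewrite in_itv/= (le_trans za)// lerDl.
  move=> zn; apply/ler_addgt0Pr => e e0.
  have [n /ltW ne] := ltr_add_invr e0.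
  have := zn n Logic.I; rewrite /= in_itv/= => /le_trans; apply.
  by rewrite lerD2l; rewrite add0r in ne.
rewrite -lee_fin -FE -(cvg_lim _ Fl)//; apply: lime_ge.
  by apply/cvg_ex; eexists; exact: Fl.
by apply: nearW => n; rewrite FE lee_fin.
Qed.

Let F_small (e : R) : 0 < e -> exists r, F r < e.
Proof.
move=> e0; apply: contrapT => nF.
have eF r : e <= F r by rewrite leNgt; apply/negP => Fe; apply: nF; exists r.
pose A n := `]-oo, - n%:R : R]%classic.
have A0 : \bigcap_n A n = set0.
  apply/seteqP; split => z //= /(_ (Num.truncn (- z)).+1 Logic.I)/=.
  rewrite /A/= in_itv/= leNgt => /negP; apply.
  by rewrite ltrNl; exact: truncnS_gt.
have /cvg_lim Fl0 : mu (A n) @[n --> \oo] --> 0%E.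
  have -> : 0%E = mu (\bigcap_n A n) by rewrite A0; exact/esym/measure0.
  apply: nonincreasing_cvg_mu => //.
  - apply: (le_lt_trans (probability_le1 _ _)); [exact: measurable_itv|exact: ltry].
  - by move=> i; exact: measurable_itv.
  - by apply: bigcapT_measurable => i; exact: measurable_itv.
  - move=> n m nm; apply/subsetPset => z; rewrite /A/= !in_itv/= => /le_trans; apply.
    by rewrite lerN2 ler_nat.
have : (e%:E <= 0%E :> \bar R)%E; last by rewrite lee_fin leNgt e0.
rewrite -Fl0//; apply: lime_ge.
  apply: ereal_nonincreasing_is_cvgn; apply/nonincreasing_seqP => n.
  by rewrite !FE lee_fin F_mono// lerN2 ler_nat.
by apply: nearW => n; rewrite FE lee_fin.
Qed.

Let F_large (e : R) : e < 1 -> exists r, e < F r.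
Proof.
move=> e1; apply: contrapT => nF.
have eF r : F r <= e by rewrite leNgt; apply/negP => Fe; apply: nF; exists r.
pose A n := `]-oo, n%:R : R]%classic.
have AT : \bigcup_n A n = setT.
  apply/seteqP; split => z //= _; exists (Num.truncn z).+1 => //=.
  by rewrite /A/= in_itv/= ltW// truncnS_gt.
have /cvg_lim Fl1 : mu (A n) @[n --> \oo] --> 1%E.
  have -> : 1%E = mu (\bigcup_n A n) by rewrite AT; exact/esym/probability_setT.
  apply: nondecreasing_cvg_mu => //.
  - by move=> i; exact: measurable_itv.
  - by apply: bigcupT_measurable => i; exact: measurable_itv.
  move=> n m nm; apply/subsetPset => z; rewrite /A/= !in_itv/= => /le_trans; apply.
  by rewrite ler_nat.
have : (1%E <= e%:E :> \bar R)%E; last by rewrite lee_fin leNgt e1.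
rewrite -Fl1//; apply: lime_le.
  apply: ereal_nondecreasing_is_cvgn; apply/nondecreasing_seqP => n.
  by rewrite !FE lee_fin F_mono// ler_nat.
by apply: nearW => n; rewrite FE lee_fin.
Qed.

Definition quantile (y : R) : R :=
  if 0 < y < 1 then inf [set r | y <= F r] else 0.

(** Galois connection between the quantile and the distribution function. Right continuity of the
    latter puts the infimum itself into the set that defines it. *)
Lemma quantile_le (y r : R) : 0 < y < 1 -> (quantile y <= r) = (y <= F r).
Proof.
move=> /[dup] y01 /andP[y0 y1]; rewrite /quantile y01.
set S := [set r | y <= F r].
have S0 : S !=set0 by have [r0 /ltW yr] := F_large y1; exists r0.
have lS : has_lbound S.
  have [r0 r0y] := F_small y0; exists r0 => x Sx; rewrite leNgt; apply/negP => /ltW/F_mono.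
  by move=> /(le_trans Sx); rewrite leNgt r0y.
apply/idP/idP => [Sr|yr]; last exact: ge_inf.
apply: F_right => n.
have : inf S < r + n.+1%:R^-1 by rewrite (le_lt_trans Sr)// ltrDl.
by move=> /(inf_lt S0)[x Sx /ltW/F_mono]; exact: le_trans.
Qed.

Lemma quantile_preimage (r : R) :
  quantile @^-1` `]-oo, r]%classic `&` `]0, 1[%classic = `]-oo, F r]%classic `&` `]0, 1[%classic.
Proof.
by apply/seteqP; split => y /=; rewrite !in_itv/= => -[+ y01]; rewrite quantile_le.
Qed.

Lemma measurable_quantile : measurable_fun setT quantile.
Proof.
rewrite -(setvU (`]0, 1[%classic : set R)).
apply/measurable_funU => //; first exact: measurableC.
split.
  have : measurable_fun (~` `]0, 1[%classic : set R) (cst (0 : R)) by [].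
  apply: eq_measurable_fun => y.
  by rewrite inE/= in_itv/= /quantile => /negP/negbTE ->.
move=> _; apply: (measurability _ (RGenOInfty.measurableE R)) => // _ [_ [r ->] <-].
rewrite (_ : _ `&` _ = `]0, 1[%classic `\` (quantile @^-1` `]-oo, r]%classic `&` `]0, 1[%classic)).
  by rewrite quantile_preimage; apply: measurableD => //; exact: measurableI.
apply/seteqP; split => y /=; rewrite !in_itv/= andbT.
  by move=> [y01 ry]; split => // -[]; rewrite leNgt ry.
by move=> [y01 ry]; split => //; rewrite ltNge; apply/negP => yr; apply: ry.
Qed.

Lemma quantile_law (B : set R) : measurable B -> U (quantile @^-1` B) = mu B.
Proof.
move=> mB.
pose nu : {measure set (measurableTypeR R) -> \bar R} :=
  pushforward U (quantile : measurableTypeR R -> measurableTypeR R).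
have mq := measurable_quantile.
change (nu mq B = mu B).
pose G := [set A : set R | exists r, A = `]-oo, r]%classic].
have G_I : setI_closed G.
  move=> _ _ [r ->] [r' ->]; exists (Num.min r r').
  by apply/seteqP; split => x /=; rewrite !in_itv/= le_min => /andP.
have mG : @measurable _ (measurableTypeR R) = <<s G >>.
  apply/seteqP; split; last first.
    apply: smallest_sub; first exact: sigma_algebra_measurable.
    by move=> _ [r ->]; exact: measurable_itv.
  rewrite RGenOInfty.measurableE; apply: smallest_sub; first exact: smallest_sigma_algebra.
  move=> _ [r ->]; rewrite -setCitvl; apply: sigma_algebraC; apply: sub_sigma_algebra.
  by exists r.
have H := @measure_unique _ R (measurableTypeR R) G (fun n => `]-oo, n%:R]%classic) mG G_I.
apply: (H _ _ (nu mq) mu _ _ B mB).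
- by move=> n; exists n%:R.
- apply/seteqP; split => z //= _; exists (Num.truncn z).+1 => //=.
  by rewrite in_itv/= ltW// truncnS_gt.
- move=> _ [r ->].
  apply: (etrans _ (esym (FE r))); rewrite -uniform_prob_cdf ?F_ge0 ?F_le1//.
  apply: uniform_prob_congr => //; first exact: preimage_measurable.
  exact: quantile_preimage.
- by move=> n; rewrite (le_lt_trans (probability_le1 _ _)) ?ltry//; exact: preimage_measurable.
Qed.

End quantile.

Section gaussian_sequences.
Context {R : realType}.

Definition normal_of_bits (f : bit_sequence) : R :=
  quantile (normal_prob 0 1) (uniform_of_bits f).

Lemma measurable_normal_of_bits : measurable_fun setT normal_of_bits.
Proof. exact: measurableT_comp (measurable_quantile _) measurable_uniform_of_bits. Qed.

Lemma normal_of_bits_law (B : set R) : measurable B ->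
  bit_measure (normal_of_bits @^-1` B) = normal_prob 0 1 B.
Proof.
move=> mB; apply: etrans (quantile_law (normal_prob 0 1) mB).
apply: (uniform_of_bits_law (B := quantile (normal_prob 0 1) @^-1` B)).
by apply: preimage_measurable => //; exact: measurable_quantile.
Qed.

(** Variable n reads the even bits of what is left after n removals of even bits, so distinct
    variables read disjoint sets of bits. *)
Definition gaussian_seq (n : nat) (f : bit_sequence) : R :=
  normal_of_bits (even_bits (iter n odd_bits f)).

Lemma measurable_gaussian_seq n : measurable_fun setT (gaussian_seq n).
Proof.
apply: (measurableT_comp measurable_normal_of_bits).
apply: (measurableT_comp measurable_even_bits).
elim: n => [|n IH]; first exact: measurable_id.
exact: (measurableT_comp measurable_odd_bits IH).
Qed.

Lemma measurable_gaussian_sum n (c : nat -> R) :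
  measurable_fun setT (fun f => \sum_(k < n) c k * gaussian_seq k f).
Proof.
by apply: measurable_sum => k; apply: measurable_funM => //; exact: measurable_gaussian_seq.
Qed.

(** Induction by [bit_measure_split]: the even bits carry the first variable and the odd bits the
    others, so the sum lives on a product space and [product_normal] adds the variances. *)
Lemma gaussian_seq_law n (c : nat -> R) (B : set R) : measurable B ->
  bit_measure [set f | B (\sum_(k < n) c k * gaussian_seq k f)] =
  centered_normal (\sum_(k < n) c k ^+ 2) B.
Proof.
elim: n c B => [|n IH] c B mB.
  rewrite big_ord0 /centered_normal eqxx diracE.
  have [B0|B0] := boolP (0 \in B).
    rewrite (_ : [set f | _] = setT) ?probability_setT//.
    by apply/seteqP; split => // f _; rewrite /= big_ord0; exact: set_mem.
  rewrite (_ : [set f | _] = set0) ?measure0//.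
  by apply/seteqP; split => // f; rewrite /= big_ord0 => /mem_set; rewrite (negbTE B0).
rewrite big_ord_recl/=.
have mV := measurable_gaussian_sum n (fun k => c k.+1).
have mU : measurable_fun setT (fun f => c 0%N * normal_of_bits f).
  by apply: measurable_funM => //; exact: measurable_normal_of_bits.
rewrite -(product_normal (P1 := bit_measure) (P2 := bit_measure) (U := fun f => c 0%N * normal_of_bits f)
   (V := fun f => \sum_(k < n) c k.+1 * gaussian_seq k f))//.
- have mE : measurable [set w : bit_sequence * bit_sequence |
      B (c 0%N * normal_of_bits w.1 + \sum_(k < n) c k.+1 * gaussian_seq k w.2)].
    apply: (@preimage_measurable _ _ _ _ (fun w : bit_sequence * bit_sequence =>
      c 0%N * normal_of_bits w.1 + \sum_(k < n) c k.+1 * gaussian_seq k w.2)) => //.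
    apply: measurable_funD.
      exact: (measurableT_comp mU measurable_fst).
    exact: (measurableT_comp mV measurable_snd).
  rewrite -(bit_measure_split mE); congr (bit_measure _); apply/seteqP; split => f /=;
    rewrite big_ord_recl/= (_ : \sum_(i < n) c i.+1 * gaussian_seq i (odd_bits f) =
     \sum_(i < n) c (lift ord0 i) * gaussian_seq (lift ord0 i) f)//;
    by apply: eq_bigr => i _; rewrite /gaussian_seq/= -iterSr.
- exact: sqr_ge0.
- by apply: sumr_ge0 => k _; exact: sqr_ge0.
- move=> C mC; rewrite (centered_normalE (s := c 0%N))// -normal_of_bits_law//.
  by apply: preimage_measurable => //; exact: measurable_funM.
- by move=> C mC; exact: (IH (fun k => c k.+1)).
Qed.

End gaussian_sequences.

(** * Cholesky factors of positive semidefinite kernels *)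

Section psd_kernels.
Context {R : realType}.

Definition psd_kernel (I : Type) (K : I -> I -> R) : Prop :=
  (forall i j, K i j = K j i) /\
  forall n (c : 'I_n -> R) t, 0 <= lincomb_var K c t.

(** A point is adjoined to a quadratic form. With a suitable coefficient [a] this yields the Schur
    complement, and later the term in B_1 of the time inversion. *)
Lemma lincomb_var_cons (I : Type) (K : I -> I -> R) n (c : 'I_n -> R) t a r :
  (forall i j, K i j = K j i) ->
  lincomb_var K (fun k : 'I_n.+1 => oapp c a (unlift ord0 k))
    (fun k => oapp t r (unlift ord0 k)) =
  a ^+ 2 * K r r + a * (\sum_(k < n) c k * K (t k) r) *+ 2 + lincomb_var K c t.
Proof.
move=> sK; rewrite /lincomb_var big_ord_recl/= unlift_none/= big_ord_recl/= unlift_none/=.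
rewrite -!expr2 -!addrA; congr (_ + _).
under eq_bigr do rewrite liftK/=.
under [X in _ + X]eq_bigr => i _.
  rewrite big_ord_recl/= unlift_none/= !liftK/=.
  under eq_bigr do rewrite liftK/=.
  over.
rewrite big_split/= [LHS]addrA [RHS]addrA; congr (_ + _).
rewrite mulr_sumr -!big_split/=; apply: eq_bigr => i _.
by rewrite (sK r (t i)); ring.
Qed.

Lemma psd_diag (I : Type) (K : I -> I -> R) i : psd_kernel K -> 0 <= K i i.
Proof.
case=> _ /(_ 1%N (fun=> 1) (fun=> i)).
by rewrite /lincomb_var !big_ord_recl !big_ord0 !addr0 !mul1r.
Qed.

Lemma psd_diag0 (I : Type) (K : I -> I -> R) i r : psd_kernel K -> K r r = 0 -> K i r = 0.
Proof.
move=> [sK pK] Kr; apply/eqP; apply: contrapT => /negP Kir.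
(* Chosen so that the quadratic form with coefficients 1 at [i] and [a] at [r] takes the value
   -1. *)
pose a := - (K i i + 1) / (2 * K i r).
have := pK 2%N (fun k : 'I_2 => oapp (fun=> 1) a (unlift ord0 k))
  (fun k => oapp (fun=> i) r (unlift ord0 k)).
rewrite lincomb_var_cons// Kr mulr0 add0r /lincomb_var !big_ord_recl !big_ord0 !addr0 !mul1r.
have -> : a * K i r *+ 2 = - (K i i + 1) by rewrite /a; field.
by lra.
Qed.

(* At [K r r = 0] the division gives [0], and the column [r] of a psd kernel
   vanishes, so the Schur complement is [K] itself. *)
Definition schur (K : nat -> nat -> R) r i j := K i j - K i r * K j r / K r r.

(** For a nonzero pivot, the quadratic form of the complement is that of [K] with the point [r]
    adjoined, taken at the coefficient -B / K r r that minimises it. *)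
Lemma schur_psd K r : psd_kernel K -> psd_kernel (schur K r).
Proof.
move=> pK; have [sK qK] := pK.
split=> [i j|n c t]; first by rewrite /schur sK (mulrC (K i r)).
set B := \sum_(k < n) c k * K (t k) r.
have -> : lincomb_var (schur K r) c t = lincomb_var K c t - B ^+ 2 / K r r.
  rewrite /lincomb_var expr2 {1}/B mulr_suml mulr_suml -sumrB; apply: eq_bigr => k _.
  rewrite /B mulr_sumr mulr_suml -sumrB; apply: eq_bigr => m _.
  by rewrite /schur; ring.
have [Kr|Kr] := eqVneq (K r r) 0; first by rewrite Kr invr0 mulr0 subr0.
have := qK n.+1 (fun k : 'I_n.+1 => oapp c (- (B / K r r)) (unlift ord0 k))
  (fun k => oapp t r (unlift ord0 k)).
rewrite lincomb_var_cons// -/B.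
suff -> : (- (B / K r r)) ^+ 2 * K r r + - (B / K r r) * B *+ 2 = - (B ^+ 2 / K r r).
  by rewrite addrC.
by field.
Qed.

Fixpoint schur_iter (K : nat -> nat -> R) r : nat -> nat -> R :=
  if r is r'.+1 then schur (schur_iter K r') r' else K.

Lemma schur_iter_psd K r : psd_kernel K -> psd_kernel (schur_iter K r).
Proof. by move=> pK; elim: r => [//|r IH] /=; exact: schur_psd. Qed.

(** Step [r] clears row [r], through its pivot or because a zero pivot forces a zero row, and leaves
    the rows already cleared at zero. *)
Lemma schur_iter0 K r i j : psd_kernel K -> (i < r)%N -> schur_iter K r i j = 0.
Proof.
move=> pK; elim: r i j => [//|r IH] i j.
have pr := schur_iter_psd r pK; have sr := pr.1.
rewrite ltnS leq_eqVlt => /orP[/eqP ->|ir] /=; last first.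
  by rewrite /schur IH// (IH i)// !mul0r subr0.
rewrite /schur; have [Kr|Kr] := eqVneq (schur_iter K r r r) 0.
  by rewrite Kr invr0 mulr0 subr0 sr; exact: psd_diag0.
by rewrite mulrAC divff// mul1r sr subrr.
Qed.

(** Column [r] is the column eliminated at step [r], scaled by the root of its pivot. A zero pivot
    gives the zero column, so singular kernels are allowed. *)
Definition cholesky K i r := schur_iter K r i r / Num.sqrt (schur_iter K r r r).

(** The sum telescopes: each step removes the rank one term of its column, and after [N] steps the
    remainder vanishes in row [i]. *)
Lemma choleskyE K i j N : psd_kernel K -> (i < N)%N ->
  \sum_(r < N) cholesky K i r * cholesky K j r = K i j.
Proof.
move=> pK iN.
have -> : \sum_(r < N) cholesky K i r * cholesky K j r = K i j - schur_iter K N i j.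
  elim: N {iN} => [|N IH]; first by rewrite big_ord0 subrr.
  rewrite big_ord_recr/= IH /schur /cholesky.
  set w := schur_iter K N N N.
  have w2 : Num.sqrt w ^+ 2 = w by rewrite sqr_sqrtr//; exact/psd_diag/schur_iter_psd.
  have -> a b : a / Num.sqrt w * (b / Num.sqrt w) = a * b / w.
    by rewrite -[in RHS]w2 expr2 invfM; ring.
  by ring.
by rewrite schur_iter0// subr0.
Qed.

Lemma cholesky_lincomb K n (c : 'I_n -> R) t N : psd_kernel K ->
  (forall k, t k < N)%N ->
  \sum_(r < N) (\sum_(k < n) c k * cholesky K (t k) r) ^+ 2 = lincomb_var K c t.
Proof.
move=> pK tN; rewrite /lincomb_var.
under eq_bigr => r _.
  rewrite expr2 mulr_suml.
  under eq_bigr do rewrite mulr_sumr.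
  over.
rewrite exchange_big/=; apply: eq_bigr => k _.
rewrite exchange_big/=; apply: eq_bigr => m _.
rewrite -(choleskyE (t m) pK (tN k)) mulr_sumr; apply: eq_bigr => r _.
by ring.
Qed.

End psd_kernels.

Section ultrametric_kernels.
Context {R : realType}.

(** Each class contributes the square of its total coefficient. Summing over all k and dividing by
    the size [s k] of the class of k avoids representatives; a point not related to itself has
    [s k = 0] and contributes 0 on both sides. *)
Lemma partial_equivalence_psd n (e : rel 'I_n) (c : 'I_n -> R) :
  symmetric e -> transitive e ->
  0 <= \sum_(i < n) \sum_(j < n) c i * c j * (e i j)%:R.
Proof.
move=> se te; pose s k : R := \sum_(j < n) (e j k)%:R.
have -> : \sum_(i < n) \sum_(j < n) c i * c j * (e i j)%:R =
    \sum_(k < n) (\sum_(i < n) c i * (e i k)%:R) ^+ 2 / s k.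
  under [RHS]eq_bigr => k _.
    rewrite expr2 !mulr_suml.
    under eq_bigr do rewrite mulr_sumr mulr_suml.
    over.
  rewrite [RHS]exchange_big/=; apply: eq_bigr => i _.
  rewrite [RHS]exchange_big/=; apply: eq_bigr => j _.
  transitivity (\sum_(k < n) c i * c j * ((e i k)%:R * (e j k)%:R / s k)); last first.
    by apply: eq_bigr => k _; ring.
  rewrite -mulr_sumr; congr (_ * _).
  have [eij|neij] := boolP (e i j); last first.
    rewrite big1// => k _; case: (boolP (e i k)) => eik; last by rewrite !mul0r.
    case: (boolP (e j k)) => ejk; last by rewrite mulr0 mul0r.
    by case/negP: neij; apply: (te k) => //; rewrite se.
  have eii : e i i by apply: (te j) => //; rewrite se.
  have s0 : 0 < s i.
    rewrite /s (bigD1 i)//= eii ltr_wpDr// sumr_ge0// => ? _; exact: ler0n.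
  transitivity (\sum_(k < n) (e k i)%:R / s i); last first.
    apply: eq_bigr => k _; rewrite (se k i).
    case: (boolP (e i k)) => eik; last by rewrite !mul0r.
    have -> : e j k by apply: (te i) => //; rewrite se.
    rewrite !mul1r; congr (_^-1); apply: eq_bigr => m _.
    congr (nat_of_bool _)%:R; apply/idP/idP => H; first exact: te eik.
    by apply: te H _; rewrite se.
  by rewrite -mulr_suml divff ?gt_eqF.
apply: sumr_ge0 => k _; rewrite divr_ge0 ?sqr_ge0// sumr_ge0// => j _; exact: ler0n.
Qed.

(* Peeling off the smallest positive value m of M writes M as
   max(M - m, 0) + m 1_{M > 0}, where the indicator is a partial equivalence. *)
Lemma ultrametric_psd_fin n (M : 'I_n -> 'I_n -> R) (c : 'I_n -> R) :
  (forall i j, M i j = M j i) -> (forall i j, 0 <= M i j) ->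
  (forall i j k, Num.min (M i j) (M j k) <= M i k) ->
  0 <= \sum_(i < n) \sum_(j < n) c i * c j * M i j.
Proof.
have [p] := ubnP #|[pred q : 'I_n * 'I_n | 0 < M q.1 q.2]|.
elim: p M => [//|p IH] M.
have [/existsP[q0 q0P] Mp sM M0 uM|] := boolP [exists q : 'I_n * 'I_n, 0 < M q.1 q.2]; last first.
  rewrite negb_exists => /forallP Mle _ sM M0 _.
  rewrite big1// => i _; rewrite big1// => j _.
  have := Mle (i, j); rewrite /= -leNgt => Mij.
  by rewrite (_ : M i j = 0) ?mulr0//; apply/eqP; rewrite eq_le Mij M0.
have [q qP qmin] := @Order.TotalTheory.arg_minP _ R _ q0 (fun q : 'I_n * 'I_n => 0 < M q.1 q.2)
  (fun q => M q.1 q.2) q0P.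
set m := M q.1 q.2 in qP qmin.
pose M' i j := Num.max (M i j - m) 0.
have M'E i j : M i j = M' i j + m * (0 < M i j)%R%:R.
  rewrite /M'; have [Mij|Mij] := ltP 0 (M i j).
    by rewrite mulr1 max_l ?subrK// subr_ge0; exact: (qmin (i, j)).
  have -> : M i j = 0 by apply/eqP; rewrite eq_le Mij M0.
  by rewrite mulr0 addr0 max_r// sub0r oppr_le0 ltW.
under eq_bigr do under eq_bigr do rewrite M'E mulrDr mulrCA.
under eq_bigr do rewrite big_split/= -mulr_sumr.
rewrite big_split/= -mulr_sumr addr_ge0//.
  apply: IH.
  (* The count of positive entries falls because the minimising pair [q] itself is sent to 0. *)
  - move: Mp; rewrite ltnS; apply: leq_trans; apply: proper_card; apply/properP; split.
      apply/fintype.subsetP => r; rewrite !inE /M' lt_max ltxx orbF subr_gt0.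
      exact: lt_trans.
    by exists q; rewrite !inE// /M' -/m subrr maxxx ltxx.
  - by move=> i j; rewrite /M' sM.
  - by move=> i j; rewrite /M' le_max lexx orbT.
  - move=> i j k; rewrite /M' ge_min !ge_max !le_max !lexx !orbT !andbT.
    have := uM i j k; rewrite ge_min => /orP[] h; rewrite !lerD2r h ?orbT//.
apply: mulr_ge0; first exact: ltW.
apply: partial_equivalence_psd => [i j|j i k]; first by rewrite /= sM.
by move=> ij jk; rewrite (lt_le_trans _ (uM i j k))// lt_min ij.
Qed.

Lemma ultrametric_psd (I : Type) (K : I -> I -> R) :
  (forall i j, K i j = K j i) -> (forall i j, 0 <= K i j) ->
  (forall i j k, Num.min (K i j) (K j k) <= K i k) -> psd_kernel K.
Proof.
move=> sK K0 uK; split => // n c t.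
exact: (ultrametric_psd_fin (M := fun i j => K (t i) (t j))).
Qed.

End ultrametric_kernels.

Section tree_kernel.
Context {R : realType}.
Implicit Types (g : R -> R) (s t u x : R).

Lemma unit_segment s t x : unitI s -> unitI t ->
  Num.min s t <= x <= Num.max s t -> unitI x.
Proof.
rewrite /unitI /= !in_itv/= => /andP[s0 s1] /andP[t0 t1] /andP[h1 h2].
apply/andP; split; first by rewrite (le_trans _ h1)// le_min s0.
by rewrite (le_trans h2)// ge_max s1.
Qed.

Lemma minsegC g s t : minseg g s t = minseg g t s.
Proof. by rewrite /minseg minC maxC. Qed.

Lemma minsegxx g s : minseg g s s = g s.
Proof.
rewrite /minseg minxx maxxx (_ : [set _ | _ in _] = [set g s]) ?inf1//.
apply/seteqP; split => x /=; first by move=> [y]; rewrite in_itv/= -eq_le => /eqP ->.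
by move=> ->; exists s => //; rewrite in_itv/= lexx.
Qed.

Section nonnegative.
Variable g : R -> R.
Hypothesis g0 : forall x, unitI x -> 0 <= g x.

Lemma minseg_has_lbound s t : unitI s -> unitI t ->
  has_lbound [set g u | u in `[Num.min s t, Num.max s t]].
Proof.
move=> us ut; exists 0 => _ [u + <-]; rewrite /= in_itv/= => /(unit_segment us ut).
exact: g0.
Qed.

Lemma minseg_le s t x : unitI s -> unitI t ->
  Num.min s t <= x <= Num.max s t -> minseg g s t <= g x.
Proof.
move=> us ut sxt; apply: ge_inf; first exact: minseg_has_lbound.
by exists x => //=; rewrite in_itv.
Qed.

Lemma le_minseg s t a : (forall x, Num.min s t <= x <= Num.max s t -> a <= g x) ->
  a <= minseg g s t.
Proof.
move=> H; apply: lb_le_inf; last by move=> _ [x /= + <-]; rewrite in_itv; exact: H.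
exists (g s), s => //=; rewrite in_itv/= ge_min le_max !lexx//.
Qed.

Lemma minseg_ge0 s t : unitI s -> unitI t -> 0 <= minseg g s t.
Proof.
by move=> us ut; apply: le_minseg => x /(unit_segment us ut)/g0.
Qed.

Lemma minseg_lel s t : unitI s -> unitI t -> minseg g s t <= g s.
Proof. by move=> us ut; apply: minseg_le => //; rewrite ge_min le_max !lexx. Qed.

Lemma minseg_ler s t : unitI s -> unitI t -> minseg g s t <= g t.
Proof. by move=> us ut; rewrite minsegC; exact: minseg_lel. Qed.

(** Every point between s and u lies between s and t or between t and u. *)
Lemma minseg_ultra s t u : unitI s -> unitI t -> unitI u ->
  Num.min (minseg g s t) (minseg g t u) <= minseg g s u.
Proof.
move=> us ut uu; apply: le_minseg => x sxu; rewrite ge_min.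
have [xst|xst] := boolP (Num.min s t <= x <= Num.max s t).
  by rewrite minseg_le.
rewrite (@minseg_le t u x) ?orbT//.
move: sxu xst; rewrite !ge_min !le_max => /andP[/orP a /orP b].
rewrite negb_and !negb_or -!ltNge => /orP[/andP[xs xt]|/andP[sx tx]].
- by case: a => [|ux]; [rewrite leNgt xs|rewrite ux (ltW xt) orbT].
- by case: b => [|xu]; [rewrite leNgt sx|rewrite (ltW tx) xu orbT].
Qed.

Lemma psd_minseg (t : nat -> R) : (forall k, unitI (t k)) ->
  psd_kernel (fun i j => minseg g (t i) (t j)).
Proof.
move=> ut; apply: ultrametric_psd => [i j|i j|i j k]; first exact: minsegC.
- exact: minseg_ge0.
- exact: minseg_ultra.
Qed.

Lemma lincomb_var_minseg_ge0 n (c t : 'I_n -> R) : (forall k, unitI (t k)) ->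
  0 <= lincomb_var (minseg g) c t.
Proof.
move=> ut; apply: (ultrametric_psd_fin (M := fun i j => minseg g (t i) (t j))) => [i j|i j|i j k].
- exact: minsegC.
- exact: minseg_ge0.
- exact: minseg_ultra.
Qed.

End nonnegative.
End tree_kernel.

(** * Dyadic moduli of continuity *)

Section grid.
Context {R : realType}.
Implicit Types (s t x : R) (n i : nat) (f : R -> R).

Definition gridpoint n i : R := i%:R / 2 ^+ n.

Definition gridfloor n s : R := gridpoint n (Num.truncn (2 ^+ n * s)).

Lemma pow2_gt0 n : 0 < 2 ^+ n :> R. Proof. by rewrite exprn_gt0. Qed.

Lemma unitIP s : unitI s <-> 0 <= s <= 1.
Proof. by rewrite /unitI /= in_itv. Qed.

Lemma unitI_gridpoint n i : (i <= 2 ^ n)%N -> unitI (gridpoint n i).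
Proof.
move=> i2; apply/unitIP; rewrite /gridpoint divr_ge0 ?exprn_ge0//=.
by rewrite ler_pdivrMr ?pow2_gt0// mul1r -natrX ler_nat.
Qed.

Lemma truncn_pow2_le n s : unitI s -> (Num.truncn (2 ^+ n * s) <= 2 ^ n)%N.
Proof.
move=> /unitIP/andP[s0 s1]; rewrite -(ler_nat R) natrX.
have := mulr_ge0 (ltW (pow2_gt0 n)) s0; rewrite -truncn_le => /le_trans; apply.
by rewrite ler_piMr// ltW// pow2_gt0.
Qed.

Lemma unitI_gridfloor n s : unitI s -> unitI (gridfloor n s).
Proof. by move=> us; apply: unitI_gridpoint; exact: truncn_pow2_le. Qed.

Lemma gridfloor_itv n s : 0 <= s -> gridfloor n s <= s < gridfloor n s + 2^-1 ^+ n.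
Proof.
move=> s0; have n0 := pow2_gt0 n.
have /andP[t1 t2] := truncn_itv (mulr_ge0 (ltW n0) s0).
rewrite /gridfloor /gridpoint ler_pdivrMr// (mulrC s) t1/=.
rewrite -(ltr_pM2l n0) mulrDr (mulrCA (2 ^+ n)) divff ?gt_eqF// mulr1.
by rewrite exprVn divff ?gt_eqF// natr1.
Qed.

Lemma gridfloor_dist n s : 0 <= s -> `|s - gridfloor n s| <= 2^-1 ^+ n.
Proof.
move=> /(gridfloor_itv n)/andP[h1 h2]; rewrite ger0_norm ?subr_ge0//; lra.
Qed.

Lemma gridfloor_gridpoint n i m : (n <= m)%N -> gridfloor m (gridpoint n i) = gridpoint n i.
Proof.
move=> nm; rewrite /gridfloor /gridpoint.
have E : 2 ^+ m * (i%:R / 2 ^+ n) = (2 ^ (m - n) * i)%:R :> R.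
  rewrite natrM natrX -[in LHS](subnK nm) exprD; field.
  by rewrite gt_eqF// pow2_gt0.
rewrite E natrK -E; field; rewrite !gt_eqF ?pow2_gt0//.
Qed.

Lemma truncn_dist (x y : R) k : 0 <= x -> 0 <= y -> `|x - y| <= k%:R ->
  (Num.truncn x <= Num.truncn y + k)%N /\ (Num.truncn y <= Num.truncn x + k)%N.
Proof.
move=> x0 y0; rewrite ler_norml => /andP[xy yx].
have /andP[x1 x2] := truncn_itv x0; have /andP[y1 y2] := truncn_itv y0.
split; rewrite -ltnS -(ltr_nat R) -addSn natrD; lra.
Qed.

Lemma cvg_gridfloor s : 0 <= s -> gridfloor n s @[n --> \oo] --> s.
Proof. exact: cvg_truncn_pow2. Qed.

(** No constant appears: [geometric_absorb] hides it in a slightly larger rate. Only dyadic values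
    are read, so the condition is countable and the paths that satisfy it form a measurable set. *)
Definition grid_modulus (r : R) f := exists N, forall n, (N <= n)%N ->
  forall i, (i < 2 ^ n)%N -> `|f (gridpoint n i) - f (gridpoint n i.+1)| <= r ^+ n.

(** Up to the onset [N], for r < 1 this is Holder continuity with exponent -log_2 r. *)
Definition modulus (r : R) f := exists C N, forall n, (N <= n)%N ->
  forall s t, unitI s -> unitI t -> `|s - t| <= 2^-1 ^+ n ->
  `|f s - f t| <= C * r ^+ n.

Definition extension f s : R := limn (fun n => f (gridfloor n s)).

Section extension.
Variables (r : R) (f : R -> R) (N : nat).
Hypotheses (r0 : 0 < r) (r1 : r < 1).
Hypothesis gf : forall n, (N <= n)%N ->
  forall i, (i < 2 ^ n)%N -> `|f (gridpoint n i) - f (gridpoint n i.+1)| <= r ^+ n.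

Lemma grid_step n i j : (N <= n)%N -> (i <= 2 ^ n)%N -> (j <= 2 ^ n)%N ->
  (i <= j + 1)%N -> (j <= i + 1)%N ->
  `|f (gridpoint n i) - f (gridpoint n j)| <= r ^+ n.
Proof.
move=> Nn i2 j2 ij ji; have [->|[jE|iE]] : i = j \/ (j = i.+1 \/ i = j.+1) by lia.
- by rewrite subrr normr0 exprn_ge0// ltW.
- by rewrite jE; apply: gf => //; lia.
- by rewrite iE distrC; apply: gf => //; lia.
Qed.

(** The approximations of s at levels n and n + 1 are equal or neighbours on the finer grid. *)
Lemma gridfloor_step n s : (N <= n)%N -> unitI s ->
  `|f (gridfloor n.+1 s) - f (gridfloor n s)| <= r ^+ n.+1.
Proof.
move=> Nn us; have /unitIP/andP[s0 s1] := us.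
have E : gridfloor n s = gridpoint n.+1 (Num.truncn (2 ^+ n * s)).*2.
  rewrite /gridfloor /gridpoint -mul2n natrM exprS.
  by field; rewrite gt_eqF// pow2_gt0.
have H := truncn_double_half (mulr_ge0 (ltW (pow2_gt0 n)) s0).
rewrite E /gridfloor; have t2 := truncn_pow2_le n us.
have t2' := truncn_pow2_le n.+1 us.
rewrite mulrA -exprS in H.
apply: grid_step => //.
- exact: leqW.
- by rewrite expnS; lia.
- by rewrite -H; lia.
- by rewrite -H; lia.
Qed.

Lemma gridfloor_cauchy n k s : (N <= n)%N -> unitI s ->
  `|f (gridfloor (n + k) s) - f (gridfloor n s)| <= r ^+ n / (1 - r).
Proof.
move=> Nn us; have r1' : 0 < 1 - r by rewrite subr_gt0.
(* A partial geometric sum in place of the full one lets the induction on [k] close. *)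
suff : `|f (gridfloor (n + k) s) - f (gridfloor n s)| <= r ^+ n * (1 - r ^+ k) / (1 - r).
  move=> /le_trans; apply; rewrite ler_pM2r ?invr_gt0// ler_piMr ?exprn_ge0 ?ltW//.
  by rewrite ltrBlDr ltrDl exprn_gt0.
elim: k => [|k IH]; first by rewrite addn0 subrr normr0 expr0 subrr mulr0 mul0r.
rewrite addnS; have := @gridfloor_step (n + k) s (leq_trans Nn (leq_addr _ _)) us.
move=> H; rewrite -(subrK (f (gridfloor (n + k) s)) (f (gridfloor (n + k).+1 s))) -addrA.
rewrite (le_trans (ler_normD _ _))// (le_trans (lerD H IH))//.
rewrite -(ler_pM2r r1') mulrDl !divfK ?gt_eqF// exprS exprD exprS.
rewrite [leRHS]mulrBr mulrBr !mulr1.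
have : 0 <= r ^+ n * r ^+ k by rewrite mulr_ge0 ?exprn_ge0 ?ltW.
set a := r ^+ n * r ^+ k => a0.
have -> : r ^+ n * (r * r ^+ k) = r * a by rewrite /a; ring.
have : 0 <= (1 - r) ^+ 2 * a by rewrite mulr_ge0 ?sqr_ge0.
rewrite mulrBr mulr1 -/a; lra.
Qed.

Lemma geometric_small (c : R) (e : R) : 0 < e -> exists n, c * r ^+ n < e.
Proof.
move=> e0; have := cvg_geometric c (z := r); rewrite gtr0_norm// => /(_ r1).
move=> /cvgrPdist_lt/(_ e e0) [n _ /(_ n (leqnn n))].
rewrite sub0r normrN /geometric/= => H; exists n.
by rewrite (le_lt_trans (ler_norm _)).
Qed.

Lemma cvg_dist_le (u : nat -> R) (l a c : R) n : u k @[k --> \oo] --> l ->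
  (forall k, (n <= k)%N -> `|u k - a| <= c) -> `|l - a| <= c.
Proof.
move=> ul uc.
have /(@cvg_norm _ R^o) H : u k - a @[k --> \oo] --> l - a by apply: cvgB => //; exact: cvg_cst.
rewrite -(cvg_lim _ H)//; apply: limr_le; first by apply/cvg_ex; eexists; exact: H.
by exists n => // k; exact: uc.
Qed.

Lemma cvg_extension s : unitI s -> f (gridfloor n s) @[n --> \oo] --> extension f s.
Proof.
move=> us; apply/cauchy_cvgP/cauchy_exP => e e0.
have [n0 n0P] := geometric_small (1 - r)^-1 e0.
pose n := maxn N n0.
exists (f (gridfloor n s)); exists n => // m /= nm.
rewrite -ball_normE /= distrC -(subnKC nm).
apply: le_lt_trans (gridfloor_cauchy _ (leq_maxl _ _) us) _.
apply: le_lt_trans n0P; rewrite mulrC ler_pM2l ?invr_gt0 ?subr_gt0//.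
by rewrite ler_wiXn2l ?leq_maxr// ltW.
Qed.

Lemma extension_dist n s : (N <= n)%N -> unitI s ->
  `|extension f s - f (gridfloor n s)| <= r ^+ n / (1 - r).
Proof.
move=> Nn us; apply: (cvg_dist_le (n := n) (cvg_extension us)) => k nk.
by rewrite -(subnKC nk); exact: gridfloor_cauchy.
Qed.

(** One grid step between the two approximations, plus the tail r^n / (1 - r) at each end, gives the
    constant. *)
Lemma extension_modulus_ge n s t : (N <= n)%N -> unitI s -> unitI t ->
  `|s - t| <= 2^-1 ^+ n ->
  `|extension f s - extension f t| <= (1 + 2 / (1 - r)) * r ^+ n.
Proof.
move=> Nn us ut st.
have := extension_dist Nn us; have := extension_dist Nn ut.
set x := extension f s; set y := extension f t; set x' := f _; set y' := f _ => xx yy.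
have : `|x' - y'| <= r ^+ n.
  have /unitIP/andP[s0 s1] := us; have /unitIP/andP[t0 t1] := ut.
  have n0 := pow2_gt0 n.
  have : `|2 ^+ n * s - 2 ^+ n * t| <= 1%:R.
    rewrite -mulrBr normrM gtr0_norm// -(ler_pM2l n0) in st *.
    by rewrite (le_trans st)// exprVn divff// gt_eqF.
  move=> /(truncn_dist (mulr_ge0 (ltW n0) s0) (mulr_ge0 (ltW n0) t0))[h1 h2].
  by apply: grid_step => //; exact: truncn_pow2_le.
move=> xy.
have -> : (1 + 2 / (1 - r)) * r ^+ n = r ^+ n + 2 * (r ^+ n / (1 - r)) by ring.
rewrite ler_norml; move: xx yy xy; rewrite !ler_norml => /andP[? ?] /andP[? ?] /andP[? ?].
by apply/andP; split; lra.
Qed.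

End extension.

Lemma grid_modulus_extension r f : 0 < r -> r < 1 -> grid_modulus r f ->
  modulus r (extension f).
Proof.
move=> r0 r1 [N gf]; exists (1 + 2 / (1 - r)), N => n Nn s t us ut st.
exact: (extension_modulus_ge r0 r1 gf).
Qed.

Lemma extension_gridpoint f n i : extension f (gridpoint n i) = f (gridpoint n i).
Proof.
apply/cvg_lim => //; apply/cvgrPdist_le => e e0; exists n => // m /= nm.
by rewrite gridfloor_gridpoint// subrr normr0 ltW.
Qed.

Lemma continuous_unitIP f : {within unitI, continuous f} <->
  forall s, unitI s -> forall e, 0 < e -> exists2 d, 0 < d &
    forall t, unitI t -> `|s - t| < d -> `|f s - f t| < e.
Proof.
split.
  move=> /subspace_continuousP cf s us e e0.
  have /cvgrPdist_lt/(_ e e0) := cf s us.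
  rewrite near_withinE => /nbhs_ballP[d /= d0 H]; exists d => // t ut st.
  by apply: H => //; rewrite -ball_normE.
move=> H; apply/subspace_continuousP => s us; apply/cvgrPdist_lt => e e0.
have [d d0 {}H] := H s us e e0.
rewrite near_withinE; apply/nbhs_ballP; exists d => // t; rewrite -ball_normE /= => st ut.
exact: H.
Qed.

Lemma extension_continuous f s : {within unitI, continuous f} -> unitI s ->
  extension f s = f s.
Proof.
move=> /continuous_unitIP cf us; apply/cvg_lim => //; apply/cvgrPdist_lt => e e0.
have [d d0 H] := cf s us e e0.
have /unitIP/andP[s0 s1] := us.
have /cvgrPdist_lt/(_ d d0) [n _ nH] := cvg_gridfloor s0.
by exists n => // m /nH /= sm; apply: H => //; exact: unitI_gridfloor.
Qed.

Lemma modulus_continuous r f : 0 < r -> r < 1 -> modulus r f -> {within unitI, continuous f}.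
Proof.
move=> r0 r1 [C [N H]]; apply/continuous_unitIP => s us e e0.
have [n1 n1P] := geometric_small r0 r1 `|C| e0.
pose n := maxn N n1; exists (2^-1 ^+ n) => [|t ut /ltW st]; first by rewrite exprn_gt0.
apply: le_lt_trans (H n (leq_maxl _ _) s t us ut st) _.
apply: le_lt_trans n1P; apply: (@le_trans _ _ (`|C| * r ^+ n)).
  by rewrite ler_wpM2r ?ler_norm// exprn_ge0// ltW.
by rewrite ler_wpM2l// ler_wiXn2l ?leq_maxr// ltW.
Qed.

Lemma geometric_absorb (r r' C : R) : 0 < r -> r < r' ->
  exists N, forall n, (N <= n)%N -> C * r ^+ n <= r' ^+ n.
Proof.
move=> r0 rr; have r'0 := lt_trans r0 rr.
have q0 : 0 < r / r' by rewrite divr_gt0.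
have q1 : r / r' < 1 by rewrite ltr_pdivrMr// mul1r.
have [N NP] := geometric_small q0 q1 `|C| ltr01; exists N => n Nn.
rewrite -[leRHS]mul1r -ler_pdivrMr ?exprn_gt0// -mulrA -expr_div_n.
apply: (@le_trans _ _ (`|C| * (r / r') ^+ n)).
  by rewrite ler_wpM2r ?ler_norm// exprn_ge0// ltW.
apply: le_trans (ltW NP); rewrite ler_wpM2l// ler_wiXn2l//; exact: ltW.
Qed.

Lemma modulus_grid r r' f : 0 < r -> r < r' -> modulus r f -> grid_modulus r' f.
Proof.
move=> r0 rr [C [N H]]; have [N' N'P] := geometric_absorb C r0 rr.
exists (maxn N N') => n; rewrite geq_max => /andP[Nn N'n] i i2.
apply: le_trans (N'P n N'n); apply: H => //.
- by apply: unitI_gridpoint; lia.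
- by apply: unitI_gridpoint; lia.
rewrite /gridpoint -mulrBl -natr1 opprD addrA subrr sub0r mulN1r normrN exprVn.
by rewrite gtr0_norm ?invr_gt0 ?pow2_gt0.
Qed.

Lemma grid_modulus_continuous r f : 0 < r -> r < 1 -> {within unitI, continuous f} ->
  grid_modulus r f -> modulus r f.
Proof.
move=> r0 r1 cf /(grid_modulus_extension r0 r1)[C [N H]]; exists C, N => n Nn s t us ut st.
by rewrite -(extension_continuous cf us) -(extension_continuous cf ut) H.
Qed.

End grid.

(** * Tree distance and compatibility with the tree *)

Section tree_distance.
Context {R : realType}.
Implicit Types (g f : R -> R) (s t : R).

(** The distance in the tree with contour [g], and also the variance of the label increment between
    the two times. *)
Definition tree_dist g s t := g s + g t - minseg g s t *+ 2.

Lemma tree_equiv_refl g s : tree_equiv g s s.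
Proof. by split => //; rewrite minsegxx. Qed.

(** Equivalent times are at distance 0. Moving each of them by at most [e] raises each end value by
    at most [c] and lowers the minimum, which counts twice, by at most [c]: 4 c in all. *)
Lemma tree_dist_near g (c : R) s t s' t' (e : R) : (forall x, unitI x -> 0 <= g x) ->
  (forall x y, unitI x -> unitI y -> `|x - y| <= e -> `|g x - g y| <= c) ->
  unitI s -> unitI t -> unitI s' -> unitI t' -> tree_equiv g s t ->
  `|s - s'| <= e -> `|t - t'| <= e -> tree_dist g s' t' <= c *+ 4.
Proof.
move=> g0 gc us ut us' ut' [gst gm] ss tt.
have c0 : 0 <= c by rewrite (le_trans (normr_ge0 _) (gc s s' us us' ss)).
have : g s - c <= minseg g s' t'.
  apply: le_minseg => x sx; have ux := unit_segment us' ut' sx.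
  have [h|h] := boolP (Num.min s t <= x <= Num.max s t).
    by have := minseg_le g0 us ut h; rewrite -gm -gst; lra.
  have [xs|xt] : `|x - s| <= e \/ `|x - t| <= e.
    move: h sx ss tt; rewrite !ge_min !le_max negb_and !negb_or -!ltNge !ler_norml.
    move=> /orP[/andP[h1 h2]|/andP[h1 h2]] /andP[/orP h3 /orP h4] /andP[? ?] /andP[? ?].
      by case: h3 => h3; [left|right]; apply/andP; split; lra.
    by case: h4 => h4; [left|right]; apply/andP; split; lra.
  - by have := gc x s ux us xs; rewrite ler_norml => /andP[? ?]; lra.
  - by have := gc x t ux ut xt; rewrite ler_norml -gst => /andP[? ?]; lra.
have := gc s s' us us' ss; have := gc t t' ut ut' tt; rewrite !ler_norml -gst.
move=> /andP[? ?] /andP[? ?] ?; rewrite /tree_dist.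
rewrite !mulrSr !mulr0n; lra.
Qed.

(** The threshold is a square because [tree_dist] is a variance: [sigma ^+ n] bounds the standard
    deviation, and [theta ^+ n] the increment itself. *)
Definition pairs_modulus (sigma theta : R) g f := exists N, forall n, (N <= n)%N ->
  forall i j, (i <= 2 ^ n)%N -> (j <= 2 ^ n)%N ->
  tree_dist g (gridpoint n i) (gridpoint n j) <= (sigma ^+ n) ^+ 2 ->
  `|f (gridpoint n i) - f (gridpoint n j)| <= theta ^+ n.

Section pairs_modulus.
Variables (rho sigma theta : R) (g f : R -> R).
Hypotheses (rho0 : 0 < rho) (rs : rho < sigma ^+ 2).
Hypotheses (theta0 : 0 < theta) (theta1 : theta < 1).
Hypothesis g0 : forall x, unitI x -> 0 <= g x.
Hypothesis mg : modulus rho g.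
Hypothesis pm : pairs_modulus sigma theta g f.

(** Here rho < sigma^2 is spent: from some level on it absorbs the factor 4 C that comes from
    [tree_dist_near]. *)
Lemma tree_dist_small : exists N, forall n, (N <= n)%N -> forall s t s' t',
  unitI s -> unitI t -> unitI s' -> unitI t' -> tree_equiv g s t ->
  `|s - s'| <= 2^-1 ^+ n -> `|t - t'| <= 2^-1 ^+ n ->
  tree_dist g s' t' <= (sigma ^+ n) ^+ 2.
Proof.
have [C [N H]] := mg; have [N' N'P] := geometric_absorb (C *+ 4) rho0 rs.
exists (maxn N N') => n; rewrite geq_max => /andP[Nn N'n] s t s' t' us ut us' ut' st ss tt.
rewrite exprAC; apply: le_trans (N'P n N'n); rewrite mulrnAl.
exact: (tree_dist_near (e := 2^-1 ^+ n) g0 (H n Nn) us ut us' ut').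
Qed.

(** A pair of neighbours approximates the pair of a time with itself, which is trivially equivalent,
    so continuity is a special case of the bound over pairs. *)
Lemma pairs_grid_modulus : grid_modulus theta f.
Proof.
have [N H] := tree_dist_small; have [N' H'] := pm.
exists (maxn N N') => n; rewrite geq_max => /andP[Nn N'n] i i2.
have ui : unitI (gridpoint n i : R) by apply: unitI_gridpoint; lia.
apply: H' => //; first by lia.
apply: (H n Nn (gridpoint n i) (gridpoint n i)) => //.
- by apply: unitI_gridpoint; lia.
- exact: tree_equiv_refl.
- by rewrite subrr normr0 exprn_ge0.
- rewrite /gridpoint -mulrBl -natr1 opprD addrA subrr sub0r mulN1r normrN exprVn.
  by rewrite gtr0_norm ?invr_gt0 ?pow2_gt0.
Qed.

Lemma pairs_tree_equiv s t : unitI s -> unitI t -> tree_equiv g s t ->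
  extension f s = extension f t.
Proof.
move=> us ut st; have [N H] := tree_dist_small; have [N' H'] := pm.
have [N'' gm] := pairs_grid_modulus.
apply/eqP; rewrite -subr_eq0 -normr_le0; apply/ler_addgt0Pr => e e0; rewrite add0r.
have [n0 n0P] := geometric_small theta0 theta1 (1 + 2 / (1 - theta)) e0.
pose n := maxn n0 (maxn N (maxn N' N'')).
have Nn : (N <= n)%N by lia.
have N'n : (N' <= n)%N by lia.
have N''n : (N'' <= n)%N by lia.
have n0n : (n0 <= n)%N by lia.
have d1 := extension_dist theta0 theta1 gm N''n us.
have d2 := extension_dist theta0 theta1 gm N''n ut.
have /unitIP/andP[s0 _] := us; have /unitIP/andP[t0 _] := ut.
have d3 : `|f (gridfloor n s) - f (gridfloor n t)| <= theta ^+ n.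
  apply: H' => //; try exact: truncn_pow2_le.
  apply: (H n Nn s t) => //; try exact: unitI_gridfloor; exact: gridfloor_dist.
have : (1 + 2 / (1 - theta)) * theta ^+ n < e.
  apply: le_lt_trans n0P; rewrite ler_wpM2l//.
    by rewrite addr_ge0 ?divr_ge0// subr_ge0 ltW.
  by rewrite ler_wiXn2l ?ltW.
move: d1 d2 d3.
have -> : (1 + 2 / (1 - theta)) * theta ^+ n = theta ^+ n + 2 * (theta ^+ n / (1 - theta)) by ring.
rewrite !ler_norml => /andP[? ?] /andP[? ?] /andP[? ?] ?.
by apply/andP; split; lra.
Qed.

End pairs_modulus.
End tree_distance.

(** * Cyclic shift of a path at its minimum *)

Section clamping.
Context {R : realType}.
Implicit Types (f : R -> R) (s t x : R).

(** Composing with the projection to [0, 1] turns continuity within the interval into continuity on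
    the line and keeps the values in use; as it is 1-Lipschitz, it also keeps moduli. *)
Definition clamp x : R := Num.min 1 (Num.max 0 x).

Lemma unitI_clamp x : unitI (clamp x).
Proof. by apply/unitIP; rewrite /clamp le_min ler01 le_max lexx/= ge_min lexx. Qed.

Lemma clamp_id x : unitI x -> clamp x = x.
Proof. by move=> /unitIP/andP[x0 x1]; rewrite /clamp max_r// min_r. Qed.

Lemma clamp_dist x y : `|clamp x - clamp y| <= `|x - y|.
Proof.
rewrite /clamp.
have h1 := ler_norm (x - y); have := ler_norm (y - x); rewrite distrC => h2.
have c0 : Num.min 1 (0 : R) = 0 by rewrite min_r.
case: (leP 0 x) => ?; case: (leP 0 y) => ?; rewrite ?c0 ?subr0 ?sub0r ?normrN.
- case: (leP 1 x) => ?; case: (leP 1 y) => ?; rewrite ler_norml; apply/andP; split; lra.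
- case: (leP 1 x) => ?; rewrite ler_norml; apply/andP; split; lra.
- case: (leP 1 y) => ?; rewrite ler_norml; apply/andP; split; lra.
- by rewrite normr0.
Qed.

Lemma clamp_continuous f : {within unitI, continuous f} -> continuous (f \o clamp).
Proof.
move=> /continuous_unitIP cf x; apply/cvgrPdist_lt => e e0.
have [d d0 H] := cf _ (unitI_clamp x) e e0.
apply/nbhs_ballP; exists d => // y /= xy.
by apply: H; [exact: unitI_clamp|exact: le_lt_trans (clamp_dist _ _) xy].
Qed.

Lemma continuous_within_unit f : continuous f -> {within unitI, continuous f}.
Proof. exact: continuous_subspaceT. Qed.

Lemma eq_within_unit f g : (forall x, unitI x -> f x = g x) ->
  {within unitI, continuous f} -> {within unitI, continuous g}.
Proof.
move=> fg /continuous_unitIP cf; apply/continuous_unitIP => s us e e0.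
have [d d0 H] := cf s us e e0; exists d => // t ut st.
by rewrite -!fg//; exact: H.
Qed.

End clamping.

Section conjugation.
Context {R : realType}.
Implicit Types (f : R -> R) (s t x : R).

Section fixed.
Variable f : R -> R.
Hypothesis f0 : C0 f.

Let cf : {within unitI, continuous f}. Proof. by case: f0. Qed.

Lemma minval_attained : exists2 c, unitI c & f c = minval f /\ forall t, unitI t -> f c <= f t.
Proof.
have [c uc H] := EVT_min ler01 cf; exists c => //; split => //.
apply/eqP; rewrite eq_le; apply/andP; split.
  by apply: lb_le_inf; [exists (f c), c|move=> _ [x ux <-]; exact: H].
by apply: ge_inf; [exists (f c) => _ [x ux <-]; exact: H|exists c].
Qed.

Lemma minval_le t : unitI t -> minval f <= f t.
Proof. by have [c uc [<- H]] := minval_attained; exact: H. Qed.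

Let S := [set x | unitI x /\ f x = minval f].

Let S0 : S !=set0.
Proof. by have [c uc [fc _]] := minval_attained; exists c. Qed.

Let lS : has_lbound S.
Proof. by exists 0 => x [/unitIP/andP[]]. Qed.

Lemma argminval_le x : unitI x -> f x = minval f -> argminval f <= x.
Proof. by move=> ux fx; apply: ge_inf. Qed.

Lemma argminval_unit : unitI (argminval f).
Proof.
apply/unitIP; apply/andP; split.
  by apply: lb_le_inf => // x [/unitIP/andP[]].
have [c uc [fc _]] := minval_attained.
by rewrite (le_trans (argminval_le uc fc))//; have /unitIP/andP[] := uc.
Qed.

Lemma argminvalE : f (argminval f) = minval f.
Proof.
apply/eqP; rewrite eq_le (minval_le argminval_unit) andbT.
apply/ler_addgt0Pr => e e0.
have [d d0 H] := (continuous_unitIP f).1 cf _ argminval_unit e e0.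
have : inf S < argminval f + d by rewrite ltrDl.
move=> /(inf_lt S0)[x [ux fx] xd].
have := argminval_le ux fx => ax.
have := H x ux; rewrite distrC ger0_norm ?subr_ge0// ltrBlDl => /(_ xd).
by rewrite fx ltr_norml => /andP[_]; rewrite ltrBlDl => /ltW.
Qed.

(** The end values are equal, so a minimum at 1 is also one at 0, and the leftmost is taken. *)
Lemma argminval_lt1 : argminval f < 1.
Proof.
have /unitIP/andP[_ a1] := argminval_unit.
rewrite lt_neqAle a1 andbT; apply/eqP => a_1.
have [_ f00 f01] := f0.
have u0 : unitI (0 : R) by apply/unitIP; rewrite lexx ler01.
have := argminval_le u0; rewrite f00 -argminvalE a_1 f01 => /(_ erefl).
by rewrite ler10.
Qed.

Lemma argminval_ge0 : 0 <= argminval f.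
Proof. by have /unitIP/andP[] := argminval_unit. Qed.

(* As f(0) = f(1) = 0, shifting the argument modulo 1 is a sum of two clamped
   shifts, one of which always reads off an end value 0. *)
Lemma ConjE x : unitI x -> Conj f x =
  f (clamp (argminval f + x)) + f (clamp (argminval f + x - 1)) - minval f.
Proof.
move=> /unitIP/andP[x0 x1]; rewrite /Conj; congr (_ - _).
have a0 := argminval_ge0; have a1 := argminval_lt1.
have [_ f00 f01] := f0.
set y := argminval f + x.
have y0 : 0 <= y by rewrite addr_ge0.
have y2 : y < 2 by rewrite /y; lra.
have [y1|y1] := ltP y 1.
  rewrite (clamp_id (x := y)); last by apply/unitIP; rewrite y0 ltW.
  have -> : clamp (y - 1) = 0 by rewrite /clamp max_l ?min_r//; lra.
  rewrite f00 addr0 /mod1 (@floor_def _ y 0) ?subr0//.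
  by rewrite y0 add0r.
have -> : clamp y = 1 by rewrite /clamp max_r// min_l.
rewrite f01 add0r clamp_id; last by apply/unitIP; rewrite subr_ge0 y1; lra.
rewrite /mod1 (@floor_def _ y 1)//.
by rewrite y1.
Qed.

Lemma mod1_unit x : unitI (mod1 x).
Proof.
apply/unitIP; rewrite /mod1 subr_ge0 floor_le/=.
by rewrite lerBlDl ltW//; have := floorD1_gt x; rewrite intrD.
Qed.

Lemma Conj_Cplus : Cplus (Conj f).
Proof.
have a0 := argminval_ge0; have a1 := argminval_lt1.
split; last by move=> x ux; rewrite subr_ge0 minval_le//; exact: mod1_unit.
split.
- apply: (@eq_within_unit _ (fun x => (f \o clamp) (argminval f + x) +
     (f \o clamp) (argminval f + x - 1) - minval f)).
    by move=> x ux; rewrite ConjE.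
  have cc := clamp_continuous cf.
  have ca (b : R) : continuous (fun x => (f \o clamp) (b + x)).
    move=> y; apply: (@continuous_comp _ _ _ (fun x => b + x) (f \o clamp)); last exact: cc.
    by apply: (@cvgD _ R^o); [exact: cvg_cst|exact: cvg_id].
  have ca' : continuous (fun x => (f \o clamp) (argminval f + x - 1)).
    by under eq_fun do rewrite addrAC; exact: ca.
  apply: continuous_within_unit => x.
  by apply: (@cvgB _ R^o); [apply: (@cvgD _ R^o); [exact: ca|exact: ca']|exact: cvg_cst].
- rewrite /Conj addr0 /mod1 (@floor_def _ _ 0) ?subr0 ?argminvalE ?subrr//.
  by rewrite a0.
- rewrite /Conj /mod1 (@floor_def _ _ 1) ?addrK ?argminvalE ?subrr//.
  by rewrite lerDr a0/= intrD ltrD2r.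
Qed.

(** The constant doubles because [ConjE] writes the conjugate with two clamped shifts; the rate is
    unchanged. *)
Lemma Conj_modulus r : modulus r f -> modulus r (Conj f).
Proof.
move=> [C [N H]]; exists (C *+ 2), N => n Nn s t us ut st.
have cl u v : `|u - v| <= 2^-1 ^+ n -> `|f (clamp u) - f (clamp v)| <= C * r ^+ n.
  by move=> uv; apply: H => //; [exact: unitI_clamp|exact: unitI_clamp|exact: le_trans (clamp_dist _ _) uv].
rewrite !ConjE// opprB addrA subrK.
have h1 := cl (argminval f + s) (argminval f + t).
have h2 := cl (argminval f + s - 1) (argminval f + t - 1).
rewrite (_ : _ + s - (_ + t) = s - t) in h1; last by ring.
rewrite (_ : _ - _ - (_ - _) = s - t) in h2; last by ring.
move: (h1 st) (h2 st); rewrite !ler_norml mulr2n mulrDl => /andP[? ?] /andP[? ?].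
by apply/andP; split; lra.
Qed.

End fixed.
End conjugation.

(** * Regularity of conditionally Gaussian processes *)

Section borel_cantelli.
Context {R : realType} d (T : measurableType d) (P : probability T R).

Lemma borel_cantelli_geometric (B : nat -> set T) (K q : R) :
  (forall n, measurable (B n)) -> 0 <= q < 1 ->
  (forall n, (P (B n) <= (K * q ^+ n)%:E)%E) ->
  {ae P, forall w, exists N, forall n, (N <= n)%N -> ~ B n w}.
Proof.
move=> mB /andP[q0 q1] PB.
have K0 n : 0 <= K * q ^+ n by rewrite -lee_fin; exact: le_trans (PB n).
have S : (\sum_(n <oo) P (B n) < +oo)%E.
  apply: (@le_lt_trans _ _ (\sum_(n <oo) (K * q ^+ n)%:E)%E).
    by apply: lee_nneseries => // n _.
  have /cvg_lim H : (\sum_(0 <= n < k) (K * q ^+ n)%:E)%E @[k --> \oo] --> (K * (1 - q)^-1)%:E.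
    under eq_fun do rewrite sumEFin.
    apply: cvg_EFin; first exact: nearW.
    by have := @cvg_geometric_series R K q; rewrite ger0_norm//; apply.
  by rewrite H// ltry.
have L0 := lim_sup_set_cvg0 mB S.
exists (lim_sup_set B); split => //.
  by apply: bigcapT_measurable => n; apply: bigcup_measurable => k _.
move=> w /= H N _; apply: contrapT => HN; apply: H; exists N => n Nn Bw.
by apply: HN; exists n.
Qed.

Lemma measure_bigU_seq (I : Type) (s : seq I) (F : I -> set T) (b : R) : 0 <= b ->
  (forall i, measurable (F i)) -> (forall i, (P (F i) <= b%:E)%E) ->
  (P (\big[setU/set0]_(i <- s) F i) <= ((size s)%:R * b)%:E)%E.
Proof.
move=> b0 mF Fb; elim: s => [|i s IH]; first by rewrite big_nil measure0 mul0r.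
rewrite big_cons /= -natr1 mulrDl mul1r addrC EFinD.
apply: le_trans (leeD (Fb i) IH).
by apply: measureU2 => //; exact: bigsetU_measurable.
Qed.

End borel_cantelli.

Section conditionally_gaussian.
Context {R : realType} d (T : measurableType d) (P : probability T R).

(** The conditioning is given by a bare class [G] of events, so that one regularity argument serves
    for the past of the recursion, for a product with fresh bits, and for the trivial class in the
    case of Brownian motion. *)
Definition cond_gaussian_on (G : set (set T)) (I : Type) (D : set I)
    (X : I -> T -> R) (K : T -> I -> I -> R) :=
  (forall i, D i -> measurable_fun setT (X i)) /\
  forall n (c : 'I_n -> R) (t : 'I_n -> I) (B : set R) (A : set T),
    (forall k, D (t k)) -> measurable B -> G A ->
    P (A `&` lincomb X c t @^-1` B) =
    (\int[P]_(w in A) centered_normal (lincomb_var (K w) c t) B)%E.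

Definition pair2 (A : Type) (a b : A) (k : 'I_2) : A := if k == ord0 then a else b.

Lemma lincomb_pair2 (I : Type) (X : I -> T -> R) s t w :
  lincomb X (pair2 1 (-1)) (pair2 s t) w = X s w - X t w.
Proof. by rewrite /lincomb !big_ord_recl big_ord0 /pair2/= mul1r mulN1r addr0. Qed.

Lemma lincomb_var_pair2 (g : R -> R) s t :
  lincomb_var (minseg g) (pair2 1 (-1)) (pair2 s t) = tree_dist g s t.
Proof.
rewrite /lincomb_var !big_ord_recl !big_ord0 /pair2/= !minsegxx (minsegC g t s) /tree_dist.
by ring.
Qed.

Variables (G : set (set T)) (D : set R) (X g : R -> T -> R).
Hypothesis GM : G `<=` measurable.
Hypothesis DU : D `<=` unitI.
Hypothesis g0 : forall w x, unitI x -> 0 <= g x w.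
Hypothesis mg : forall s t, D s -> D t ->
  measurable_fun setT (fun w => tree_dist (g^~ w) s t).
Hypothesis Gg : forall (s t r : R), D s -> D t -> G [set w | tree_dist (g^~ w) s t <= r].
Hypothesis GX : cond_gaussian_on G D X (fun w => minseg (g^~ w)).

Definition bad_event (r lam : R) (p : R * R) : set T :=
  [set w | tree_dist (g^~ w) p.1 p.2 <= r ^+ 2 /\ lam < `|X p.1 w - X p.2 w|].

Lemma measurable_increment s t : D s -> D t -> measurable_fun setT (fun w => X s w - X t w).
Proof. by move=> Ds Dt; apply: measurable_funB; exact: GX.1. Qed.

Lemma measurable_abs_gt (lam : R) : measurable [set x : R | lam < `|x|].
Proof.
rewrite (_ : [set x | _] = (@Num.norm _ R) @^-1` `]lam, +oo[%classic); last first.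
  by apply/seteqP; split => z /=; rewrite in_itv/= andbT.
exact: preimage_measurable.
Qed.

Lemma measurable_bad_event r lam p : D p.1 -> D p.2 -> measurable (bad_event r lam p).
Proof.
move=> D1 D2; apply: measurableI; first exact/GM/Gg.
exact: (preimage_measurable (measurable_increment D1 D2) (measurable_abs_gt lam)).
Qed.

Lemma tree_dist_ge0 w s t : D s -> D t -> 0 <= tree_dist (g^~ w) s t.
Proof.
move=> /DU us /DU ut; rewrite /tree_dist mulr2n opprD addrACA.
rewrite addr_ge0// subr_ge0; first by apply: minseg_lel => // x; exact: g0.
by apply: minseg_ler => // x; exact: g0.
Qed.

(** Smallness of the tree distance is an event of [G], so the conditional law may be integrated over
    it; there the variance is at most r^2 and the normal tail applies pointwise. *)
Lemma bad_event_le (m : nat) : exists2 C : R, 0 <= C & forall (p : R * R) (r lam : R),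
  D p.1 -> D p.2 -> 0 < r -> 0 < lam ->
  (P (bad_event r lam p) <= (C * (r / lam) ^+ m)%:E)%E.
Proof.
have [C C0 CP] := @centered_normal_tail R m; exists C => // -[s t] r lam /= Ds Dt r0 lam0.
pose A := [set w | tree_dist (g^~ w) s t <= r ^+ 2].
have GA : G A by exact: Gg.
have mA : measurable A by exact: GM.
have Cr0 : 0 <= C * (r / lam) ^+ m by rewrite mulr_ge0// exprn_ge0// divr_ge0// ltW.
have mlam := measurable_abs_gt lam.
have [_ /(_ 2 (pair2 1 (-1)) (pair2 s t) [set x : R | lam < `|x|] A)] := GX.
have -> : A `&`
   lincomb X (pair2 1 (-1)) (pair2 s t) @^-1` [set x : R | lam < `|x|] = bad_event r lam (s, t).
  by apply/seteqP; split => w /=; rewrite lincomb_pair2.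
move=> ->//; last by move=> k; rewrite /pair2; case: ifP.
apply: (@le_trans _ _ (\int[P]_(w in A) (C * (r / lam) ^+ m)%:E)%E).
  apply: ge0_le_integral => //.
  - by move=> w _; exact: centered_normal_ge0.
  - apply: measurable_funTS; apply: measurable_centered_normal => //.
      by under eq_fun do rewrite lincomb_var_pair2; exact: mg.
    by move=> w; rewrite lincomb_var_pair2; exact: tree_dist_ge0.
  - move=> w /= wr; rewrite lincomb_var_pair2; apply: CP => //.
    exact: tree_dist_ge0.
rewrite integral_cst// -[leRHS]mule1 lee_wpmul2l ?lee_fin//.
exact: probability_le1.
Qed.

(** The allowance of four times 4^n covers the (2^n + 1)^2 pairs of grid points of level n. *)
Lemma increments_eventually (p : nat -> seq (R * R)) (sigma theta : R) :
  0 < sigma -> sigma < theta ->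
  (forall n, (size (p n) <= 4 * 4 ^ n)%N) ->
  (forall n q, q \in p n -> D q.1 /\ D q.2) ->
  {ae P, forall w, exists N, forall n, (N <= n)%N -> forall q, q \in p n ->
    tree_dist (g^~ w) q.1 q.2 <= (sigma ^+ n) ^+ 2 ->
    `|X q.1 w - X q.2 w| <= theta ^+ n}.
Proof.
move=> s0 st sp Dp; have t0 := lt_trans s0 st.
(* The order of the tail is chosen to beat the number of pairs. *)
have [m mP] : exists m, 4 * (sigma / theta) ^+ m < 1.
  by apply: geometric_small; rewrite ?divr_gt0// ltr_pdivrMr// mul1r.
have [C C0 CP] := bad_event_le m.
have st0 : 0 < sigma / theta by rewrite divr_gt0.
pose B n : set T := \big[setU/set0]_(q <- p n)
  (if `[< D q.1 /\ D q.2 >] then bad_event (sigma ^+ n) (theta ^+ n) q else set0).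
have : {ae P, forall w, exists N, forall n, (N <= n)%N -> ~ B n w}.
  apply: (@borel_cantelli_geometric _ _ _ _ _ (4 * C) (4 * (sigma / theta) ^+ m)).
  - move=> n; apply: bigsetU_measurable => q _; case: ifPn => // /asboolP[D1 D2].
    exact: measurable_bad_event.
  - by rewrite mP andbT mulr_ge0// exprn_ge0// ltW.
  - move=> n; have b0 : 0 <= C * ((sigma / theta) ^+ m) ^+ n.
      by rewrite mulr_ge0// !exprn_ge0// ltW.
    apply: (le_trans (@measure_bigU_seq _ _ _ P _ (p n) _ (C * ((sigma / theta) ^+ m) ^+ n) b0 _ _)).
    + by move=> q; case: ifPn => // /asboolP[D1 D2]; exact: measurable_bad_event.
    + move=> q; case: ifPn => [/asboolP[D1 D2]|_]; last by rewrite measure0.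
      by rewrite exprAC expr_div_n; apply: CP; rewrite ?exprn_gt0.
    + rewrite lee_fin.
      have -> : 4 * C * (4 * (sigma / theta) ^+ m) ^+ n =
          (4 * 4 ^ n)%:R * (C * ((sigma / theta) ^+ m) ^+ n).
        by rewrite exprMn natrM natrX; ring.
      by rewrite ler_wpM2r// ler_nat.
apply: filterS => w [N NP]; exists N => n Nn q qp qs.
rewrite leNgt; apply/negP => qt; apply: (NP n Nn).
rewrite /B -bigcup_seq; exists q => //=.
by rewrite asboolT//; exact: Dp qp.
Qed.

Lemma pairs_modulus_ae (sigma theta : R) : 0 < sigma -> sigma < theta ->
  (forall n i, (i <= 2 ^ n)%N -> D (gridpoint n i)) ->
  {ae P, forall w, pairs_modulus sigma theta (g^~ w) (X^~ w)}.
Proof.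
move=> s0 st Dg.
pose p n : seq (R * R) := [seq (gridpoint n i, gridpoint n j) | i <- iota 0 (2 ^ n).+1, j <- iota 0 (2 ^ n).+1].
have := @increments_eventually p sigma theta s0 st.
have -> : (forall n, (size (p n) <= 4 * 4 ^ n)%N) <-> True.
  split=> // _ n; rewrite size_allpairs !size_iota.
  have : (0 < 2 ^ n)%N by rewrite expn_gt0.
  rewrite (_ : 4 = 2 * 2)%N// expnMn; set k := (2 ^ n)%N; nia.
have -> : (forall n q, q \in p n -> D q.1 /\ D q.2) <-> True.
  split=> // _ n q /allpairsP[[i j] []]; rewrite !mem_iota !add0n !ltnS => /= hi hj ->.
  by split; apply: Dg.
move=> /(_ Logic.I Logic.I); apply: filterS => w [N NP]; exists N => n Nn i j hi hj.
apply: (NP n Nn (gridpoint n i, gridpoint n j)).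
by apply/allpairsP; exists (i, j); rewrite !mem_iota !add0n !ltnS.
Qed.

(** Ties the value at a single time, dyadic or not, to the grid; this is how the extension is
    recognised as a version. *)
Lemma gridfloor_increment_ae (s sigma theta : R) : 0 < sigma -> sigma < theta ->
  D s -> (forall n i, (i <= 2 ^ n)%N -> D (gridpoint n i)) ->
  {ae P, forall w, exists N, forall n, (N <= n)%N ->
    tree_dist (g^~ w) s (gridfloor n s) <= (sigma ^+ n) ^+ 2 ->
    `|X s w - X (gridfloor n s) w| <= theta ^+ n}.
Proof.
move=> s0 st Ds Dg.
pose p n : seq (R * R) := [:: (s, gridfloor n s)].
have := @increments_eventually p sigma theta s0 st.
have -> : (forall n, (size (p n) <= 4 * 4 ^ n)%N) <-> True.
  by split=> // _ n; rewrite /= muln_gt0 expn_gt0.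
have -> : (forall n q, q \in p n -> D q.1 /\ D q.2) <-> True.
  split=> // _ n q; rewrite inE => /eqP -> /=; split => //.
  by apply: Dg; apply: truncn_pow2_le; exact: DU.
move=> /(_ Logic.I Logic.I); apply: filterS => w [N NP]; exists N => n Nn.
by apply: (NP n Nn (s, gridfloor n s)); rewrite mem_head.
Qed.

End conditionally_gaussian.

Section measurable_predicates.
Context d (T : measurableType d) {R : realType}.
Implicit Types (Q : T -> Prop) (f g : T -> R).

Lemma measurable_imply Q Q' : measurable [set w | Q w] -> measurable [set w | Q' w] ->
  measurable [set w | Q w -> Q' w].
Proof.
move=> mQ mQ'; rewrite (_ : [set w | _ -> _] = ~` [set w | Q w] `|` [set w | Q' w]).
  by apply: measurableU => //; exact: measurableC.
apply/seteqP; split => w /=; last by move=> [nq|].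
by move=> QQ'; have [/QQ'|] := pselect (Q w); [right|left].
Qed.

Lemma measurable_forall (F : nat -> T -> Prop) : (forall n, measurable [set w | F n w]) ->
  measurable [set w | forall n, F n w].
Proof.
move=> mF; rewrite (_ : [set w | _] = \bigcap_n [set w | F n w]).
  exact: bigcapT_measurable.
by apply/seteqP; split => w /= H; [move=> n _|move=> n]; exact: H.
Qed.

Lemma measurable_exists (F : nat -> T -> Prop) : (forall n, measurable [set w | F n w]) ->
  measurable [set w | exists n, F n w].
Proof.
move=> mF; rewrite (_ : [set w | _] = \bigcup_n [set w | F n w]).
  exact: bigcupT_measurable.
by apply/seteqP; split => w /= [n]; [move=> Fn; exists n|move=> _ Fn; exists n].
Qed.

Lemma measurable_premise (p : Prop) Q : (p -> measurable [set w | Q w]) ->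
  measurable [set w | p -> Q w].
Proof.
move=> mQ; have [hp|hp] := pselect p.
  rewrite (_ : [set w | _] = [set w | Q w]); first exact: mQ.
  by apply/seteqP; split => w //=; exact.
by rewrite (_ : [set w | _] = setT)//; apply/seteqP; split => w //= _ /hp.
Qed.

Lemma measurable_le_fun f g : measurable_fun setT f -> measurable_fun setT g ->
  measurable [set w | f w <= g w].
Proof. by move=> mf mg; rewrite -[X in measurable X]setTI; exact: measurable_fun_le. Qed.

Lemma measurable_eq_cst f (r : R) : measurable_fun setT f -> measurable [set w | f w = r].
Proof. by move=> mf; apply: (preimage_measurable mf (measurable_set1 r)). Qed.

End measurable_predicates.

Section continuous_extension.
Context {R : realType} d (T : measurableType d).
Variables (X g : R -> T -> R) (D : set R).
Hypothesis DU : D `<=` unitI.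
Hypothesis Dg : forall n i, (i <= 2 ^ n)%N -> D (gridpoint n i).
Hypothesis mX : forall s, D s -> measurable_fun setT (X s).

Lemma measurable_abs_increment s t : D s -> D t ->
  measurable_fun setT (fun w => `|X s w - X t w|).
Proof.
move=> Ds Dt; apply: (@measurableT_comp _ _ _ _ _ _ (@Num.norm _ R)) => //.
by apply: measurable_funB; exact: mX.
Qed.

Lemma measurable_grid_modulus r : measurable [set w | grid_modulus r (X^~ w)].
Proof.
apply: measurable_exists => N; apply: measurable_forall => n; apply: measurable_premise => _.
apply: measurable_forall => i; apply: measurable_premise => i2.
apply: measurable_le_fun; last exact: measurable_cst.
by apply: measurable_abs_increment; apply: Dg => //; exact: ltnW.
Qed.

Variables (rho : R).

(** The arithmetic mean of 1 and rho: its square exceeds rho by ((1 - rho) / 2)^2. The rate theta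
    then lies halfway between sigma and 1. *)
Definition sigma_of := (1 + rho) / 2.
Definition theta_of := (1 + sigma_of) / 2.

Hypotheses (rho0 : 0 < rho) (rho1 : rho < 1).

Lemma sigma_theta : [/\ 0 < sigma_of, rho < sigma_of ^+ 2, sigma_of < theta_of,
  0 < theta_of & theta_of < 1].
Proof.
have h0 := rho0; have h1 := rho1.
rewrite /theta_of /sigma_of; split; try lra.
have -> : ((1 + rho) / 2) ^+ 2 = rho + ((1 - rho) / 2) ^+ 2 by field.
by rewrite ltrDl exprn_gt0// divr_gt0// subr_gt0.
Qed.

(** Only dyadic times occur, so the set is measurable. The two end values are prescribed separately
    because moduli do not see them and the extension has to lie in [C0]. *)
Definition good_path : set T := [set w | [/\ grid_modulus rho (g^~ w),
  pairs_modulus sigma_of theta_of (g^~ w) (X^~ w), X 0 w = 0 & X 1 w = 0]].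

(** Zero off the good paths, so that the snake property holds for every [w]. *)
Definition label_extension s w := \1_good_path w * extension (X^~ w) s.

Hypothesis mg : forall s, D s -> measurable_fun setT (g s).
Hypothesis mtd : forall s t, D s -> D t ->
  measurable_fun setT (fun w => tree_dist (g^~ w) s t).
Hypothesis gC : forall w, Cplus (g^~ w).

Lemma gridpoint00 : gridpoint 0 0 = 0 :> R.
Proof. by rewrite /gridpoint mul0r. Qed.

Lemma gridpoint01 : gridpoint 0 1 = 1 :> R.
Proof. by rewrite /gridpoint expr0 divr1. Qed.

Lemma grid0 : D 0. Proof. by rewrite -gridpoint00; exact: Dg. Qed.

Lemma grid1 : D 1. Proof. by rewrite -gridpoint01; exact: Dg. Qed.

Lemma good_modulus w : good_path w -> modulus rho (g^~ w).
Proof. by case=> gm _ _ _; apply: grid_modulus_continuous => //; have [[]] := gC w. Qed.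

Lemma good_grid_modulus w : good_path w -> grid_modulus theta_of (X^~ w).
Proof.
move=> gw; have [s0 rs st t0 t1] := sigma_theta; have [_ pm _ _] := gw.
by apply: (pairs_grid_modulus rho0 rs t0 t1 _ (good_modulus gw) pm); have [] := gC w.
Qed.

Lemma cvg_label_extension w s : good_path w -> unitI s ->
  X (gridfloor n s) w @[n --> \oo] --> label_extension s w.
Proof.
move=> gw us; have [s0 rs st t0 t1] := sigma_theta.
rewrite /label_extension indicE mem_set// mul1r.
by have [N H] := good_grid_modulus gw; exact: (cvg_extension t0 t1 H us).
Qed.

Lemma label_extension_snake w : snake (g^~ w) (label_extension^~ w).
Proof.
have [s0 rs st t0 t1] := sigma_theta.
have [gw|gw] := pselect (good_path w); last first.
  have -> : label_extension^~ w = cst 0.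
    by apply/funext => s; rewrite /label_extension indicE memNset// mul0r.
  by split => //; split => //; apply: continuous_within_unit => x; exact: cvg_cst.
have -> : label_extension^~ w = extension (X^~ w).
  by apply/funext => s; rewrite /label_extension indicE mem_set// mul1r.
have [_ pm X0 X1] := gw; split => //; last first.
  move=> x y ux uy xy.
  by apply: (pairs_tree_equiv rho0 rs t0 t1 _ (good_modulus gw) pm) => //; have [] := gC w.
split; rewrite -?gridpoint00 -?gridpoint01 ?extension_gridpoint ?gridpoint00 ?gridpoint01//.
apply: (modulus_continuous (r := theta_of)) => //.
by apply: grid_modulus_extension => //; exact: good_grid_modulus.
Qed.

Lemma measurable_good_path : measurable good_path.
Proof.
rewrite (_ : good_path = [set w | grid_modulus rho (g^~ w)] `&`
  [set w | pairs_modulus sigma_of theta_of (g^~ w) (X^~ w)] `&`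
  [set w | X 0 w = 0] `&` [set w | X 1 w = 0]); last first.
  by apply/seteqP; split => w /=; [case|move=> [[[]]]].
have m0 := measurable_eq_cst 0 (mX grid0); have m1 := measurable_eq_cst 0 (mX grid1).
apply: measurableI => //; apply: measurableI => //; apply: measurableI.
  apply: measurable_exists => N; apply: measurable_forall => n; apply: measurable_premise => _.
  apply: measurable_forall => i; apply: measurable_premise => i2.
  apply: measurable_le_fun; last exact: measurable_cst.
  apply: (@measurableT_comp _ _ _ _ _ _ (@Num.norm _ R)) => //.
  by apply: measurable_funB; apply: mg; apply: Dg => //; exact: ltnW.
apply: measurable_exists => N; apply: measurable_forall => n; apply: measurable_premise => _.
apply: measurable_forall => i; apply: measurable_forall => j.
apply: measurable_premise => i2; apply: measurable_premise => j2.
apply: measurable_imply; apply: measurable_le_fun; try exact: measurable_cst.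
  by apply: mtd; exact: Dg.
by apply: measurable_abs_increment; exact: Dg.
Qed.

Lemma measurable_label_extension s : unitI s -> measurable_fun setT (label_extension s).
Proof.
move=> us; apply: (@measurable_fun_cvg _ _ _ _ (fun n w => \1_good_path w * X (gridfloor n s) w)).
  move=> n; apply: measurable_funM; first exact: measurable_indic measurable_good_path.
  by apply: mX; apply: Dg; exact: truncn_pow2_le.
move=> w _; rewrite indicE; have [gw|gw] := pselect (good_path w).
  by rewrite mem_set//; under eq_fun do rewrite mul1r; exact: cvg_label_extension.
rewrite /label_extension indicE !memNset// mul0r.
by under eq_fun do rewrite mul0r; exact: cvg_cst.
Qed.

Variables (P : probability T R) (G : set (set T)).
Hypothesis GM : G `<=` measurable.
Hypothesis GT : G setT.
Hypothesis Gg : forall (s t r : R), D s -> D t -> G [set w | tree_dist (g^~ w) s t <= r].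
Hypothesis GX : cond_gaussian_on P G D X (fun w => minseg (g^~ w)).
Hypothesis gm : {ae P, forall w, grid_modulus rho (g^~ w)}.

(** Where the lifetime vanishes the conditional variance is 0 and the law is Dirac; this pins the
    label at both ends. *)
Lemma cond_gaussian_null s : D s -> (forall w, g s w = 0) -> {ae P, forall w, X s w = 0}.
Proof.
move=> Ds gs0; exists [set w | X s w <> 0]; split => //.
  by apply: measurableC; apply: measurable_eq_cst; exact: mX.
have [_ /(_ 1%N (fun=> 1) (fun=> s) (~` [set 0]) setT)] := GX.
rewrite setTI (_ : _ @^-1` _ = [set w | X s w <> 0]); last first.
  by apply/seteqP; split => w /=; rewrite /lincomb big_ord1 mul1r.
move=> -> //; last by apply: measurableC; exact: measurable_set1.
apply: integral0_eq => w _; rewrite /lincomb_var !big_ord1 minsegxx gs0 mulr0.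
by rewrite /centered_normal eqxx diracE memNset//=; exact.
Qed.

Lemma good_path_ae : {ae P, forall w, good_path w}.
Proof.
have [s0 rs st t0 t1] := sigma_theta.
have X0 : {ae P, forall w, X 0 w = 0}.
  by apply: cond_gaussian_null; [exact: grid0|move=> w; have [[]] := gC w].
have X1 : {ae P, forall w, X 1 w = 0}.
  by apply: cond_gaussian_null; [exact: grid1|move=> w; have [[]] := gC w].
have g0 w x : unitI x -> 0 <= g x w by have [_] := gC w; exact.
have pm := pairs_modulus_ae GM DU g0 mtd Gg GX s0 st Dg.
by near=> w; split; near: w.
Unshelve. all: by end_near. Qed.

(** The values of [X] at the grid approximations of [s] converge to the extension on good paths, and
    almost surely to [X s] because the tree distance from these approximations to [s] decreases
    geometrically. *)
Lemma label_extension_version s : D s -> {ae P, forall w, label_extension s w = X s w}.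
Proof.
move=> Ds; have us := DU Ds; have [s0 rs st t0 t1] := sigma_theta.
have g0 w x : unitI x -> 0 <= g x w by have [_] := gC w; exact.
have inc := gridfloor_increment_ae GM DU g0 mtd Gg GX s0 st Ds Dg.
have gp := good_path_ae.
near=> w; have gw : good_path w by near: w.
have [N NP] : exists N, forall n, (N <= n)%N ->
    tree_dist (g^~ w) s (gridfloor n s) <= (sigma_of ^+ n) ^+ 2 ->
    `|X s w - X (gridfloor n s) w| <= theta_of ^+ n by near: w.
have [N' N'P] := tree_dist_small rho0 rs (g0 w) (good_modulus gw).
apply: (cvg_unique _ (cvg_label_extension gw us)) => //.
apply/cvgrPdist_le => e e0.
have [n0 n0P] := geometric_small t0 t1 1 e0.
exists (maxn n0 (maxn N N')) => // n /=; rewrite !geq_max => /and3P[n0n Nn N'n].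
apply: le_trans (NP n Nn _) _.
  apply: (N'P n N'n s s) => //.
  - exact: unitI_gridfloor.
  - exact: tree_equiv_refl.
  - by rewrite subrr normr0 exprn_ge0.
  - by apply: gridfloor_dist; have /unitIP/andP[] := us.
apply: le_trans (ltW n0P); rewrite mul1r ler_wiXn2l//; exact: ltW.
Unshelve. all: by end_near. Qed.

End continuous_extension.

(** * Measurability of path functionals *)

Section measurable_levels.
Context d (T : measurableType d) {R : realType}.
Implicit Types (f : T -> R).

Lemma measurable_fun_ge_level f : (forall r, measurable [set z | r <= f z]) ->
  measurable_fun setT f.
Proof.
move=> mf; apply: (measurability _ (RGenCInfty.measurableE R)) => _ [_ [r ->] <-].
rewrite setTI (_ : _ @^-1` _ = [set z | r <= f z])//.
by apply/seteqP; split => z /=; rewrite in_itv/= andbT.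
Qed.

Lemma measurable_fun_le_level f : (forall r, measurable [set z | f z <= r]) ->
  measurable_fun setT f.
Proof.
move=> mf; apply: (measurability _ (RGenOInfty.measurableE R)) => _ [_ [r ->] <-].
rewrite setTI (_ : _ @^-1` _ = ~` [set z | f z <= r]); first exact: measurableC.
by apply/seteqP; split => z /=; rewrite in_itv/= andbT ltNge => /negP.
Qed.

Lemma measurable_countable_index (F : nat -> T -> R) (k : T -> nat) :
  (forall i, measurable_fun setT (F i)) -> measurable_fun setT k ->
  measurable_fun setT (fun z => F (k z) z).
Proof.
move=> mF mk _ B mB; rewrite setTI.
rewrite (_ : _ @^-1` B = [set z | exists i, k z = i /\ F i z \in B]); last first.
  apply/seteqP; split => z /=; first by move=> /mem_set Fz; exists (k z).
  by move=> [i [<-]]; rewrite inE.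
apply: measurable_exists => i.
rewrite (_ : [set z | _] = k @^-1` [set i] `&` F i @^-1` B); last first.
  by apply/seteqP; split => z /= -[-> h]; split => //; move: h; rewrite inE.
by apply: measurableI; [exact: (preimage_measurable mk)|exact: (preimage_measurable (mF i) mB)].
Qed.

(** The inverse is the pointwise limit of the continuous functions x / (x^2 + 1/(n+1)), which at 0
    agree with the convention 0^-1 = 0. *)
Lemma measurable_invr f : measurable_fun setT f -> measurable_fun setT (fun z => (f z)^-1).
Proof.
move=> mf; apply: (measurableT_comp _ mf).
apply: (@measurable_fun_cvg _ _ R setT (fun n (x : R) => x / (x ^+ 2 + n.+1%:R^-1)) (fun x => x^-1)).
  move=> n; apply: continuous_measurable_fun => x.
  have x0 : x ^+ 2 + n.+1%:R^-1 != 0 :> R by rewrite gt_eqF// ltr_wpDl// sqr_ge0.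
  apply: cvgM; first exact: cvg_id.
  apply: cvgV => //; apply: cvgD; last exact: cvg_cst.
  exact: exprn_continuous.
move=> x _; have [->|x0] := eqVneq x 0.
  by rewrite invr0; under eq_fun do rewrite mul0r; exact: cvg_cst.
rewrite [X in _ --> X](_ : _ = x / (x ^+ 2 + 0)); last first.
  by rewrite addr0 expr2 invfM mulrA divff// mul1r.
apply: cvgM; first exact: cvg_cst.
apply: cvgV; first by rewrite addr0 sqrf_eq0.
apply: cvgD; first exact: cvg_cst.
exact: cvg_harmonic.
Qed.

Lemma measurable_sqrtr f : measurable_fun setT f -> measurable_fun setT (fun z => Num.sqrt (f z)).
Proof.
move=> mf; apply: (measurableT_comp _ mf).
by apply: continuous_measurable_fun => x; exact: sqrt_continuous.
Qed.

Lemma measurable_normr_fun f : measurable_fun setT f -> measurable_fun setT (fun z => `|f z|).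
Proof. by move=> mf; apply: (measurableT_comp _ mf). Qed.

End measurable_levels.

Section continuous_segment.
Context {R : realType}.
Implicit Types (g f : R -> R).

Lemma minseg_attained g (s t : R) : continuous g -> s <= t ->
  exists2 c, s <= c <= t & g c = minseg g s t /\ forall u, s <= u <= t -> g c <= g u.
Proof.
move=> cg st; have [|c] := @EVT_min _ g s t st; first exact: continuous_subspaceT.
rewrite in_itv/= => sct H; exists c => //.
have H' u : s <= u <= t -> g c <= g u by move=> ?; apply: H; rewrite in_itv.
split=> //; rewrite /minseg min_l// max_r//; apply/eqP; rewrite eq_le; apply/andP; split.
  by apply: lb_le_inf => [|_ [u + <-]]; [exists (g c), c => //=; rewrite in_itv|rewrite /= in_itv; exact: H'].
apply: ge_inf; last by exists c => //=; rewrite in_itv.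
by exists (g c) => _ [u + <-]; rewrite /= in_itv; exact: H'.
Qed.

Lemma minseg_eq g f s t : (forall u, Num.min s t <= u <= Num.max s t -> g u = f u) ->
  minseg g s t = minseg f s t.
Proof.
move=> gf; rewrite /minseg; congr inf; apply/seteqP; split => x [u + <-];
rewrite /= in_itv => /= ust.
  by exists u; rewrite /= ?in_itv ?gf.
by exists u; rewrite /= ?in_itv -?gf.
Qed.

(** By continuity the bound may be tested at the dyadic points of the segment, which makes the
    minimum measurable in the path. *)
Lemma ge_minseg_grid g (s t r : R) : continuous g -> s <= t ->
  (r <= minseg g s t) <->
  (forall n i, (i <= 2 ^ n)%N -> r <= g (s + (t - s) * gridpoint n i)).
Proof.
move=> cg st; have [c sct [<- H]] := minseg_attained cg st.
have ts0 : 0 <= t - s by rewrite subr_ge0.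
split=> [rc n i i2|rg].
  have /unitIP/andP[g0 g1] : unitI (gridpoint n i : R) by exact: unitI_gridpoint.
  apply: le_trans rc _; apply: H; rewrite lerDl mulr_ge0//= -lerBrDl.
  by rewrite ler_piMr.
have [u uu ->] : exists2 u, unitI u & c = s + (t - s) * u.
  have [e|ne] := eqVneq s t.
    exists 0; first by apply/unitIP; rewrite lexx ler01.
    by move: sct; rewrite mulr0 addr0 -e -eq_le => /eqP.
  have ts1 : 0 < t - s by rewrite subr_gt0 lt_neqAle ne.
  move: sct => /andP[sc ct]; exists ((c - s) / (t - s)).
    by apply/unitIP; rewrite divr_ge0 ?subr_ge0//= ler_pdivrMr// mul1r lerB.
  by rewrite mulrC divfK ?gt_eqF//; ring.
have /unitIP/andP[u0 u1] := uu.
have L : g (s + (t - s) * gridfloor n u) @[n --> \oo] --> g (s + (t - s) * u).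
  apply: (@continuous_cvg _ _ _ _ _ (fun n => s + (t - s) * gridfloor n u) g); first exact: cg.
  apply: cvgD; first exact: cvg_cst.
  by apply: cvgM; [exact: cvg_cst|exact: cvg_gridfloor].
rewrite -(cvg_lim _ L)//; apply: limr_ge; first by apply/cvg_ex; eexists; exact: L.
by apply: nearW => n; apply: rg; exact: truncn_pow2_le.
Qed.

Lemma minseg_norm_gt0 g (s t : R) : continuous g -> s <= t ->
  (0 < minseg (fun x => `|g x|) s t) <-> (forall u, s <= u <= t -> g u <> 0).
Proof.
move=> cg st; have cn : continuous (fun x => `|g x|).
  by move=> x; apply: (@continuous_cvg _ _ _ _ _ g); [exact: norm_continuous|exact: cg].
have [c sct [<- H]] := minseg_attained cn st.
rewrite normr_gt0; split=> [gc u ust gu|gn]; last by apply/eqP; exact: gn.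
by have := H u ust; rewrite gu normr0 normr_le0 (negbTE gc).
Qed.

End continuous_segment.

Lemma cvg_continuous_seq {R : realType} (h : R -> R) (u : nat -> R) (a : R) :
  continuous h -> u n @[n --> \oo] --> a -> h (u n) @[n --> \oo] --> h a.
Proof. by move=> ch ua; exact: (@cvg_comp _ _ _ u h _ _ _ ua (ch a)). Qed.

Section measurable_paths.
Context d (Z : measurableType d) {R : realType}.
Variable F : R -> Z -> R.
Hypothesis mF : forall t, measurable_fun setT (F t).
Hypothesis cF : forall z, continuous (F^~ z).

(** The random time is approximated from below by dyadic times of countable range. *)
Lemma measurable_random_time (tau : Z -> R) : measurable_fun setT tau ->
  (forall z, 0 <= tau z) -> measurable_fun setT (fun z => F (tau z) z).
Proof.
move=> mtau tau0.
apply: (@measurable_fun_cvg _ _ _ _ (fun n z => F ((Num.truncn (2 ^+ n * tau z))%:R / 2 ^+ n) z)).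
  move=> n; apply: (@measurable_countable_index _ _ _ (fun i => F (i%:R / 2 ^+ n))) => //.
  apply: (measurableT_comp measurable_truncn).
  by apply: measurable_funM => //; exact: measurable_cst.
move=> z _; exact: (cvg_continuous_seq (@cF z) (cvg_truncn_pow2 (tau0 z))).
Qed.

Lemma measurable_minseg s t : measurable_fun setT (fun z => minseg (F^~ z) s t).
Proof.
wlog st : s t / s <= t.
  move=> H; have [st|/ltW ts] := leP s t; first exact: H.
  by under eq_fun do rewrite minsegC; exact: H.
apply: measurable_fun_ge_level => r.
rewrite (_ : [set z | _] = [set z | forall n i, (i <= 2 ^ n)%N ->
    r <= F (s + (t - s) * gridpoint n i) z]); last first.
  by apply/seteqP; split => z /= /(ge_minseg_grid r (@cF z) st).
apply: measurable_forall => n; apply: measurable_forall => i; apply: measurable_premise => _.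
by apply: measurable_le_fun; first exact: measurable_cst.
Qed.

End measurable_paths.

Section measurable_excursion.
Context d (Z : measurableType d) {R : realType}.
Variable F : R -> Z -> R.
Hypothesis mF : forall t, measurable_fun setT (F t).
Hypothesis cF : forall z, continuous (F^~ z).
Hypothesis F0 : forall z, F 0 z = 0.

Let nF t z := `|F t z|.

Let mnF t : measurable_fun setT (nF t). Proof. exact: measurable_normr_fun. Qed.

Let cnF z : continuous (nF^~ z).
Proof.
by move=> x; apply: (@continuous_cvg _ _ _ _ _ (F^~ z)); [exact: norm_continuous|exact: cF].
Qed.

(** The uncountable existential becomes one inequality: a continuous path has a zero on the segment
    iff the minimum of its absolute value there is at most 0. *)
Lemma measurable_has_zero s t : s <= t ->
  measurable [set z | exists u, s <= u <= t /\ F u z = 0].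
Proof.
move=> st; rewrite (_ : [set z | _] = [set z | minseg (nF^~ z) s t <= 0]).
  by apply: measurable_le_fun; [exact: measurable_minseg|exact: measurable_cst].
apply/seteqP; split => z /=.
  move=> [u [ust Fu]]; rewrite leNgt; apply/negP => /(minseg_norm_gt0 (@cF z) st).
  by move=> /(_ u ust).
rewrite leNgt => /negP H; apply: contrapT => H'; apply: H.
apply/(minseg_norm_gt0 (@cF z) st) => u ust Fu; apply: H'.
by exists u.
Qed.

Let zeros01 z := [set s | 0 <= s <= 1 /\ F s z = 0].

Let zeros01_sup z : has_sup (zeros01 z).
Proof. by split; [exists 0; split; rewrite ?lexx ?ler01|exists 1 => x [/andP[]]]. Qed.

Lemma last_zero_itv z : 0 <= last_zero (F^~ z) <= 1.
Proof.
rewrite /last_zero; apply/andP; split.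
  by apply: sup_ubound; [exact: (zeros01_sup z).2|split; rewrite ?lexx ?ler01].
by apply: sup_le_ub; [exact: (zeros01_sup z).1|move=> x [/andP[]]].
Qed.

Let closed_limit_zero z (S : set R) (a : R) : (forall e, 0 < e -> exists2 s, S s & `|a - s| < e) ->
  (forall s, S s -> F s z = 0) -> F a z = 0.
Proof.
move=> aS S0; apply/eqP/negPn/negP => Fa.
have /cvgrPdist_lt/(_ `|F a z|) := @cF z a.
rewrite normr_gt0 => /(_ Fa)/nbhs_ballP[e /= e0 H].
have [s Ss as_] := aS e e0.
by have := H s as_; rewrite (S0 s Ss) subr0 ltxx.
Qed.

Lemma last_zeroE z : F (last_zero (F^~ z)) z = 0.
Proof.
apply: (closed_limit_zero (S := zeros01 z)) => [e e0|s [_ //]].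
have [s zs ss] := sup_adherent e0 (zeros01_sup z).
exists s => //; rewrite ger0_norm; last by rewrite subr_ge0; apply: sup_ubound => //; exact: (zeros01_sup z).2.
by rewrite ltrBlDr -ltrBlDl.
Qed.

(** The supremum is attained, so for 0 < r <= 1 reaching level r means having a zero in [r, 1]. *)
Lemma measurable_last_zero : measurable_fun setT (fun z => last_zero (F^~ z)).
Proof.
apply: measurable_fun_ge_level => r.
have [r0|r0] := leP r 0.
  rewrite (_ : [set z | _] = setT)//; apply/seteqP; split => z //= _.
  by apply: le_trans r0 _; have /andP[] := last_zero_itv z.
have [r1|r1] := leP r 1; last first.
  rewrite (_ : [set z | _] = set0)//; apply/seteqP; split => z //= h.
  by have /andP[_] := last_zero_itv z; rewrite leNgt (lt_le_trans r1 h).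
rewrite (_ : [set z | _] = [set z | exists u, r <= u <= 1 /\ F u z = 0]).
  exact: measurable_has_zero.
apply/seteqP; split => z /= h.
  exists (last_zero (F^~ z)); rewrite last_zeroE; split => //; rewrite h/=.
  by have /andP[] := last_zero_itv z.
have [u [/andP[ru u1] Fu]] := h; apply: (le_trans ru).
apply: sup_ubound; first exact: (zeros01_sup z).2.
by split => //; rewrite u1 andbT (le_trans (ltW r0)).
Qed.

Let zeros1 z := [set s | 1 <= s /\ F s z = 0].

Lemma next_zero_none z : ~ (exists s, 1 <= s /\ F s z = 0) -> next_zero (F^~ z) = 0.
Proof.
move=> h; rewrite /next_zero (_ : [set _ | _] = set0) ?inf0//.
by apply/seteqP; split => // s /= hs; apply: h; exists s.
Qed.

Lemma next_zero_some z : (exists s, 1 <= s /\ F s z = 0) ->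
  1 <= next_zero (F^~ z) /\ F (next_zero (F^~ z)) z = 0.
Proof.
move=> ne; have hi : has_inf (zeros1 z) by split => //; exists 1 => s [].
split; first by apply: lb_le_inf => // s [].
apply: (closed_limit_zero (S := zeros1 z)) => [e e0|s [_ //]].
have [s zs ss] := inf_adherent e0 hi.
exists s => //; rewrite distrC ger0_norm; last by rewrite subr_ge0; apply: ge_inf => //; exact: hi.2.
by rewrite ltrBlDl.
Qed.

Lemma next_zero_ge0 z : 0 <= next_zero (F^~ z).
Proof.
have [/next_zero_some[h _]|/next_zero_none ->//] := pselect (exists s, 1 <= s /\ F s z = 0).
exact: le_trans h.
Qed.

Lemma measurable_no_zero : measurable [set z | ~ exists s, 1 <= s /\ F s z = 0].
Proof.
apply: (@measurableC _ _ [set z | exists s, 1 <= s /\ F s z = 0]).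
rewrite (_ : [set z | _] = [set z | exists n : nat, exists u, 1 <= u <= 1 + n%:R /\ F u z = 0]).
  by apply: measurable_exists => n; apply: measurable_has_zero; rewrite lerDl.
apply/seteqP; split => z /=.
  move=> [s [s1 Fs]]; exists (Num.trunc s).+1, s; split => //; rewrite s1/=.
  by rewrite (le_trans (ltW (truncnS_gt s)))// lerDr.
by move=> [n [u [/andP[u1 _] Fu]]]; exists u.
Qed.

(** For a path without zero after 1 the infimum is that of the empty set, which is 0; such paths
    make up the whole level set for 0 <= r < 1. *)
Lemma measurable_next_zero : measurable_fun setT (fun z => next_zero (F^~ z)).
Proof.
apply: measurable_fun_le_level => r.
have [r0|r0] := ltP r 0.
  rewrite (_ : [set z | _] = set0)//; apply/seteqP; split => z //= h.
  by have := next_zero_ge0 z; rewrite leNgt (le_lt_trans h r0).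
have [r1|r1] := ltP r 1.
  rewrite (_ : [set z | _] = [set z | ~ exists s, 1 <= s /\ F s z = 0]).
    exact: measurable_no_zero.
  apply/seteqP; split => z /= h; last by rewrite next_zero_none.
  by move=> /next_zero_some[]; rewrite leNgt (le_lt_trans h r1).
rewrite (_ : [set z | _] = [set z | ~ exists s, 1 <= s /\ F s z = 0] `|`
    [set z | exists u, 1 <= u <= r /\ F u z = 0]).
  by apply: measurableU; [exact: measurable_no_zero|exact: measurable_has_zero].
apply/seteqP; split => z /=.
  move=> h; have [e|e] := pselect (exists s, 1 <= s /\ F s z = 0); last by left.
  by right; have [n1 Fn] := next_zero_some e; exists (next_zero (F^~ z)); rewrite n1 h.
move=> [h|[u [/andP[u1 ur] Fu]]]; first by rewrite next_zero_none.
by apply: le_trans ur; apply: ge_inf => //; exists 1 => s [].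
Qed.

Lemma measurable_rescaled_excursion t : 0 <= t <= 1 ->
  measurable_fun setT (fun z => rescaled_excursion (F^~ z) t).
Proof.
move=> /andP[t0 t1].
have ml := measurable_last_zero; have mn := measurable_next_zero.
apply: measurable_funM.
  apply: measurable_normr_fun; apply: (measurable_random_time (F := F)) => //.
    apply: measurable_funD => //; apply: measurable_funM; first exact: measurable_cst.
    exact: measurable_funB.
  move=> z; have /andP[l0 l1] := last_zero_itv z; have n0 := next_zero_ge0 z.
  (* A convex combination of two nonnegative numbers, so the time is nonnegative even when the next
     zero has its default value 0. *)
  rewrite (_ : _ + _ = (1 - t) * last_zero (F^~ z) + t * next_zero (F^~ z)); last by ring.
  by rewrite addr_ge0// mulr_ge0// subr_ge0.
apply: measurable_invr; apply: measurable_sqrtr; exact: measurable_funB.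
Qed.

End measurable_excursion.

Section measurable_conj.
Context d (Z : measurableType d) {R : realType}.
Variable F : R -> Z -> R.
Hypothesis mF : forall t, unitI t -> measurable_fun setT (F t).
Hypothesis cF : forall z, C0 (F^~ z).

Let F' t := F (clamp t).

Let mF' t : measurable_fun setT (F' t). Proof. by apply: mF; exact: unitI_clamp. Qed.

Let cF' z : continuous (F'^~ z).
Proof. by have [cf _ _] := cF z; exact: (clamp_continuous cf). Qed.

Lemma measurable_minseg_unit s t : unitI s -> unitI t ->
  measurable_fun setT (fun z => minseg (F^~ z) s t).
Proof.
move=> us ut; rewrite (_ : (fun z => _) = fun z => minseg (F'^~ z) s t).
  exact: measurable_minseg.
by apply/funext => z; apply: minseg_eq => u /(unit_segment us ut) uu; rewrite /F' clamp_id.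
Qed.

Lemma measurable_tree_dist s t : unitI s -> unitI t ->
  measurable_fun setT (fun z => tree_dist (F^~ z) s t).
Proof.
move=> us ut; apply: measurable_funB; first by apply: measurable_funD; exact: mF.
by under eq_fun do rewrite mulr2n; apply: measurable_funD; exact: measurable_minseg_unit.
Qed.

Let u0 : unitI (0 : R). Proof. by apply/unitIP; rewrite lexx ler01. Qed.
Let u1 : unitI (1 : R). Proof. by apply/unitIP; rewrite lexx ler01. Qed.

Lemma minvalE z : minval (F^~ z) = minseg (F^~ z) 0 1.
Proof. by rewrite /minval /minseg min_l ?max_r// /unitI; exact: ler01. Qed.

Lemma measurable_minval : measurable_fun setT (fun z => minval (F^~ z)).
Proof. by under eq_fun do rewrite minvalE; exact: measurable_minseg_unit. Qed.

Lemma measurable_argminval : measurable_fun setT (fun z => argminval (F^~ z)).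
Proof.
apply: measurable_fun_le_level => r.
have [r0|r0] := ltP r 0.
  rewrite (_ : [set z | _] = set0)//; apply/seteqP; split => z //= h.
  by have := argminval_ge0 (cF z); rewrite leNgt (le_lt_trans h r0).
have [r1|r1] := leP 1 r.
  rewrite (_ : [set z | _] = setT)//; apply/seteqP; split => z //= _.
  by apply: le_trans r1; exact/ltW/argminval_lt1.
have ur : unitI r by apply/unitIP; rewrite r0 ltW.
(* The leftmost minimiser is at most r iff the minimum over [0, r] already reaches the global
   one. *)
rewrite (_ : [set z | _] = [set z | minseg (F'^~ z) 0 r <= minval (F^~ z)]).
  by apply: measurable_le_fun; [exact: measurable_minseg|exact: measurable_minval].
apply/seteqP; split => z /= h; have [c c0r [cE H]] := minseg_attained (@cF' z) r0.
  rewrite -cE -argminvalE; last exact: cF.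
  have := H (argminval (F^~ z)); rewrite argminval_ge0 ?h; last exact: cF.
  by rewrite {2}/F' clamp_id//; [exact|apply: argminval_unit; exact: cF].
have uc : unitI c by move: c0r => /andP[? ?]; apply/unitIP; lra.
have /andP[_ cr] := c0r; apply: le_trans cr; apply: argminval_le => //.
apply/eqP; rewrite eq_le minval_le// andbT.
by move: h; rewrite -cE /F' clamp_id.
Qed.

Lemma measurable_at_clamp (tau : Z -> R) : measurable_fun setT tau ->
  measurable_fun setT (fun z => F (clamp (tau z)) z).
Proof.
move=> mt; under eq_fun do rewrite -(clamp_id (unitI_clamp _)).
apply: (measurable_random_time mF' cF'); last first.
  by move=> z; have /unitIP/andP[] := unitI_clamp (tau z).
apply: measurable_minr; first exact: measurable_cst.
by apply: measurable_maxr => //; exact: measurable_cst.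
Qed.

Lemma measurable_Conj t : unitI t -> measurable_fun setT (fun z => Conj (F^~ z) t).
Proof.
move=> ut; under eq_fun do rewrite ConjE//.
have ma := measurable_argminval.
apply: measurable_funB; last exact: measurable_minval.
apply: measurable_funD; apply: measurable_at_clamp.
  by apply: measurable_funD => //; exact: measurable_cst.
apply: measurable_funB; last exact: measurable_cst.
by apply: measurable_funD => //; exact: measurable_cst.
Qed.

End measurable_conj.

(** * Construction of the label process *)

Lemma cvg_sum_seq {R : realType} n (f : 'I_n -> nat -> R) (l : 'I_n -> R) :
  (forall k, f k m @[m --> \oo] --> l k) ->
  \sum_(k < n) f k m @[m --> \oo] --> \sum_(k < n) l k.
Proof.
elim: n f l => [|n IH] f l fl.
  by under eq_fun do rewrite big_ord0; rewrite big_ord0; exact: cvg_cst.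
under eq_fun do rewrite big_ord_recr/=; rewrite big_ord_recr/=.
by apply: cvgD => //; apply: IH => k; exact: fl.
Qed.

Section law_limit.
Context {R : realType} d (T : measurableType d) (P : probability T R).

Lemma cvg_integral_bounded (A : set T) (f : R -> R) (Z_ : nat -> T -> R) (Z : T -> R) :
  measurable A -> continuous f -> (forall x, `|f x| <= 1) ->
  (forall n, measurable_fun setT (Z_ n)) -> measurable_fun setT Z ->
  {ae P, forall w, Z_ n w @[n --> \oo] --> Z w} ->
  (\int[P]_(w in A) (f (Z_ n w))%:E @[n --> \oo] --> \int[P]_(w in A) (f (Z w))%:E)%E.
Proof.
move=> mA cf f1 mZ_ mZ ZZ.
have mf : measurable_fun setT f by exact: continuous_measurable_fun.
have := @dominated_convergence _ _ _ P A mA (fun n w => (f (Z_ n w))%:E)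
  (fun w => (f (Z w))%:E) (fun=> 1%:E).
case=> //.
- by move=> n; apply/measurable_EFinP/measurable_funTS; exact: (measurableT_comp mf).
- by apply/measurable_EFinP/measurable_funTS; exact: (measurableT_comp mf).
- apply: filterS ZZ => w Zw _; apply: cvg_EFin; first exact: nearW.
  exact: (cvg_continuous_seq cf Zw).
- exact: finite_measure_integrable_cst.
- by apply: aeW => w n _; rewrite lee_fin.
Qed.

End law_limit.

Section law_limit2.
Context {R : realType} d (T : measurableType d) (P : probability T R)
  d' (T' : measurableType d') (P' : probability T' R).

(** Sines and cosines are bounded and continuous, so their expectations pass to the limit;
    [law_from_trig] over a single index recovers the law. *)
Lemma law_limit (A : set T) (A' : set T') (Z_ : nat -> T -> R) (Z : T -> R)
    (Z'_ : nat -> T' -> R) (Z' : T' -> R) :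
  measurable A -> measurable A' ->
  (forall n, measurable_fun setT (Z_ n)) -> measurable_fun setT Z ->
  (forall n, measurable_fun setT (Z'_ n)) -> measurable_fun setT Z' ->
  {ae P, forall w, Z_ n w @[n --> \oo] --> Z w} ->
  {ae P', forall w, Z'_ n w @[n --> \oo] --> Z' w} ->
  (forall n B, measurable B -> P (A `&` Z_ n @^-1` B) = P' (A' `&` Z'_ n @^-1` B)) ->
  forall B, measurable B -> P (A `&` Z @^-1` B) = P' (A' `&` Z' @^-1` B).
Proof.
move=> mA mA' mZ_ mZ mZ'_ mZ' cZ cZ' eZ B mB.
have key (f : R -> R) : continuous f -> (forall x, `|f x| <= 1) ->
    (\int[P]_(w in A) (f (Z w))%:E = \int[P']_(w in A') (f (Z' w))%:E)%E.
  move=> cf f1; have L := cvg_integral_bounded mA cf f1 mZ_ mZ cZ.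
  have L' := cvg_integral_bounded mA' cf f1 mZ'_ mZ' cZ'.
  rewrite -(cvg_lim _ L)// -(cvg_lim _ L')//; congr (limn _); apply/funext => n.
  apply: (integral_eq_law mA mA' (M := 1)) => //; first exact: continuous_measurable_fun.
  exact: eZ.
have lE e (U : measurableType e) (Y : U -> R) n (c : 'I_n -> R) (t : 'I_n -> unit) w :
    lincomb (fun=> Y) c t w = (\sum_(k < n) c k) * Y w.
  by rewrite /lincomb mulr_suml.
apply: (@law_from_trig R unit setT _ _ P A mA _ _ P' A' mA' (fun=> Z) (fun=> Z') _ _ _ _
  [set x | B (x tt)]) => //.
- move=> n c t _; under eq_integral do rewrite lE.
  under [RHS]eq_integral do rewrite lE.
  apply: (key (fun x => cos ((\sum_(k < n) c k) * x))) => [x|x].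
    by apply: continuous_comp; [exact: mulrl_continuous|exact: continuous_cos].
  by rewrite ler_norml cos_geN1 cos_le1.
- move=> n c t _; under eq_integral do rewrite lE.
  under [RHS]eq_integral do rewrite lE.
  apply: (key (fun x => sin ((\sum_(k < n) c k) * x))) => [x|x].
    by apply: continuous_comp; [exact: mulrl_continuous|exact: continuous_sin].
  by rewrite ler_norml sin_geN1 sin_le1.
- by apply: sub_sigma_algebra; exists tt, B.
Qed.

End law_limit2.

Section product_first.
Context {R : realType} d1 d2 (T1 : measurableType d1) (T2 : measurableType d2)
  (P1 : probability T1 R) (P2 : probability T2 R).
Implicit Types A : set T1.

Lemma product_fst A : measurable A -> (P1 \x P2)%E (fst @^-1` A) = P1 A.
Proof.
move=> mA; have -> : fst @^-1` A = A `*` (@setT T2) by apply/seteqP; split => -[x y] //= [].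
apply: etrans; first by apply: product_measure1E.
by apply: etrans (mule1 _); congr (_ * _)%E; exact: probability_setT.
Qed.

Lemma ae_fst (Q : T1 -> Prop) : {ae P1, forall w, Q w} ->
  {ae (P1 \x P2)%E, forall w, Q w.1}.
Proof.
move=> [N [mN N0 QN]]; exists (fst @^-1` N); split.
- exact: (preimage_measurable measurable_fst).
- by apply: etrans N0; exact: product_fst.
- by move=> w /= nQ; exact: QN.
Qed.

Lemma integral_fst A (f : T1 -> \bar R) : measurable A -> measurable_fun setT f ->
  (forall x, 0 <= f x)%E ->
  (\int[(P1 \x P2)%E]_(w in fst @^-1` A) f w.1 = \int[P1]_(w in A) f w)%E.
Proof.
move=> mA mf f0.
have mfst : measurable_fun setT (@fst T1 T2) by exact: measurable_fst.
transitivity (\int[pushforward (P1 \x P2)%E (@fst T1 T2)]_(w in A) f w)%E.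
  rewrite ge0_integral_pushforward//; exact: measurable_funTS.
by apply: eq_measure_integral => B mB _; exact: product_fst.
Qed.

End product_first.

Section dyadic_enumeration.
Context {R : realType}.

Definition dyadic : set R := [set s | exists n i, (i <= 2 ^ n)%N /\ s = gridpoint n i].

(** An enumeration with repetitions: the numerator is cut at 2^n to stay in [0, 1], and
    [dyadic_index] fixes one index for each number. The repetitions can make the kernel on indices
    singular, which [cholesky] tolerates. *)
Definition dyadic_enum (k : nat) : R :=
  oapp (fun q : nat * nat => gridpoint q.1 (minn q.2 (2 ^ q.1))) 0 (unpickle k).

Definition dyadic_index (s : R) : nat := xget 0%N [set k | dyadic_enum k = s].

Lemma unitI_dyadic_enum k : unitI (dyadic_enum k).
Proof.
rewrite /dyadic_enum; case: unpickle => [[n i]|] /=.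
  by apply: unitI_gridpoint; exact: geq_minr.
by apply/unitIP; rewrite lexx ler01.
Qed.

Lemma dyadic_indexK s : dyadic s -> dyadic_enum (dyadic_index s) = s.
Proof.
move=> [n [i [i2 ->]]]; apply: (@xgetPex _ 0%N [set k | dyadic_enum k = gridpoint n i]).
by exists (pickle (n, i)); rewrite /= /dyadic_enum pickleK/= (minn_idPl i2).
Qed.

Lemma dyadic_unit : dyadic `<=` unitI.
Proof. by move=> _ [n [i [i2 ->]]]; exact: unitI_gridpoint. Qed.

Lemma dyadic_gridpoint n i : (i <= 2 ^ n)%N -> dyadic (gridpoint n i).
Proof. by move=> i2; exists n, i. Qed.

Lemma dyadic_gridfloor n s : unitI s -> dyadic (gridfloor n s).
Proof. by move=> us; apply: dyadic_gridpoint; exact: truncn_pow2_le. Qed.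

End dyadic_enumeration.

Section minseg_continuity.
Context {R : realType}.
Variable g : R -> R.
Hypothesis g0 : forall x, unitI x -> 0 <= g x.

Lemma minseg_near (c e : R) s t s' t' :
  (forall x y, unitI x -> unitI y -> `|x - y| <= e -> `|g x - g y| <= c) ->
  unitI s -> unitI t -> unitI s' -> unitI t' -> `|s - s'| <= e -> `|t - t'| <= e ->
  minseg g s t - c <= minseg g s' t'.
Proof.
move=> gc us ut us' ut' ss tt; apply: le_minseg => x xst.
have ux := unit_segment us' ut' xst.
(* [y] is the projection of [x] to the segment from s to t; as the ends of the two segments differ
   by at most [e], it lies within [e] of [x]. *)
pose y := Num.max (Num.min s t) (Num.min (Num.max s t) x).
have yst : Num.min s t <= y <= Num.max s t.
  apply/andP; split; first by rewrite le_max lexx.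
  rewrite ge_max; apply/andP; split; first by rewrite ge_min !le_max !lexx.
  by rewrite ge_min lexx.
have uy := unit_segment us ut yst.
have xy : `|x - y| <= e.
  have e0 : 0 <= e by exact: le_trans ss.
  have [xs|sx] := ltP x (Num.min s t).
    rewrite (_ : y = Num.min s t); last first.
      by rewrite /y max_l// ge_min (ltW xs) orbT.
    rewrite distrC ger0_norm; last by rewrite subr_ge0 ltW.
    rewrite lerBlDl.
    move: xst => /andP[+ _]; rewrite ge_min => /orP[] h; rewrite ge_min; apply/orP.
      by left; move: ss; rewrite ler_norml => /andP[_ ?]; lra.
    by right; move: tt; rewrite ler_norml => /andP[_ ?]; lra.
  have [tx|xt] := ltP (Num.max s t) x; last by rewrite /y (min_r xt) (max_r sx) subrr normr0.
  rewrite (_ : y = Num.max s t); last first.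
    by rewrite /y (min_l (ltW tx)) max_r// ge_min !le_max !lexx.
  rewrite ger0_norm; last by rewrite subr_ge0 ltW.
  rewrite lerBlDl.
  move: xst => /andP[_]; rewrite le_max => /orP[] h.
    by move: ss; rewrite ler_norml => /andP[? _]; have : s <= Num.max s t by [rewrite le_max lexx]; lra.
  by move: tt; rewrite ler_norml => /andP[? _]; have : t <= Num.max s t by [rewrite le_max lexx orbT]; lra.
have := minseg_le g0 us ut yst; have := gc x y ux uy xy; rewrite ler_norml => /andP[? ?]; lra.
Qed.

Lemma cvg_minseg_gridfloor (rho : R) s t : 0 < rho -> rho < 1 -> modulus rho g ->
  unitI s -> unitI t ->
  minseg g (gridfloor n s) (gridfloor n t) @[n --> \oo] --> minseg g s t.
Proof.
move=> rho0 rho1 [C [N H]] us ut; apply/cvgrPdist_le => e e0.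
have [n0 n0P] := geometric_small rho0 rho1 `|C| e0.
exists (maxn N n0) => // n /=; rewrite geq_max => /andP[Nn n0n].
have us' := unitI_gridfloor n us; have ut' := unitI_gridfloor n ut.
have ds : `|s - gridfloor n s| <= 2^-1 ^+ n by apply: gridfloor_dist; have /unitIP/andP[] := us.
have dt : `|t - gridfloor n t| <= 2^-1 ^+ n by apply: gridfloor_dist; have /unitIP/andP[] := ut.
have Ce : C * rho ^+ n <= e.
  apply: le_trans (ltW n0P); apply: (@le_trans _ _ (`|C| * rho ^+ n)).
    by rewrite ler_wpM2r ?ler_norm// exprn_ge0// ltW.
  by rewrite ler_wpM2l// ler_wiXn2l//; exact: ltW.
have h1 := minseg_near (H n Nn) us ut us' ut' ds dt.
have h2 : minseg g (gridfloor n s) (gridfloor n t) - C * rho ^+ n <= minseg g s t.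
  by apply: (minseg_near (e := 2^-1 ^+ n) (H n Nn)) => //; rewrite distrC.
by rewrite ler_norml; apply/andP; split; lra.
Qed.

End minseg_continuity.

Section label_construction.
Context {R : realType} d (T : measurableType d) (P : probability T R).
Variables (g : R -> T -> R) (rho : R).
Hypothesis mg : forall t, unitI t -> measurable_fun setT (g t).
Hypothesis gC : forall w, Cplus (g^~ w).
Hypotheses (rho0 : 0 < rho) (rho1 : rho < 1).
Hypothesis gm : {ae P, forall w, grid_modulus rho (g^~ w)}.

Local Notation Q := (@bit_measure R).
Local Notation TQ := (T * bit_sequence)%type.
Local Notation PQ := (P \x Q)%E.

Let g0 w x : unitI x -> 0 <= g x w. Proof. by have [_] := gC w; exact. Qed.

Definition dyadic_kernel w i j := minseg (g^~ w) (dyadic_enum i) (dyadic_enum j).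

Lemma psd_dyadic_kernel w : psd_kernel (dyadic_kernel w).
Proof. by apply: psd_minseg => [x|k]; [exact: g0|exact: unitI_dyadic_enum]. Qed.

Let C0g w : C0 (g^~ w). Proof. by have [] := gC w. Qed.

Lemma measurable_schur_iter r i j :
  measurable_fun setT (fun w => schur_iter (dyadic_kernel w) r i j).
Proof.
elim: r i j => [|r IH] i j /=.
  by apply: measurable_minseg_unit => //; exact: unitI_dyadic_enum.
apply: measurable_funB => //; apply: measurable_funM; first exact: measurable_funM.
exact: measurable_invr.
Qed.

Lemma measurable_cholesky i r : measurable_fun setT (fun w => cholesky (dyadic_kernel w) i r).
Proof.
apply: measurable_funM; first exact: measurable_schur_iter.
by apply: measurable_invr; apply: measurable_sqrtr; exact: measurable_schur_iter.
Qed.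

Definition dyadic_label (s : R) (p : TQ) : R :=
  \sum_(r < (dyadic_index s).+1)
    cholesky (dyadic_kernel p.1) (dyadic_index s) r * gaussian_seq r p.2.

Lemma measurable_dyadic_label s : measurable_fun setT (dyadic_label s).
Proof.
apply: measurable_sum => r; apply: measurable_funM.
  exact: (measurableT_comp (measurable_cholesky _ _) measurable_fst).
exact: (measurableT_comp (measurable_gaussian_seq _) measurable_snd).
Qed.

(** The factor is triangular: columns beyond the index vanish, so several labels can be written with
    a common number of normal variables. *)
Lemma dyadic_label_widen s p N : (dyadic_index s < N)%N ->
  dyadic_label s p = \sum_(r < N) cholesky (dyadic_kernel p.1) (dyadic_index s) r * gaussian_seq r p.2.
Proof.
move=> sN; rewrite /dyadic_label.
rewrite (big_ord_widen _ (fun r => cholesky (dyadic_kernel p.1) (dyadic_index s) r * gaussian_seq r p.2) sN).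
rewrite [RHS](bigID (fun r : 'I_N => (r < (dyadic_index s).+1)%N))/=.
rewrite [X in _ + X]big1 ?addr0// => r; rewrite -leqNgt => sr.
by rewrite /cholesky schur_iter0 ?mul0r//; exact: psd_dyadic_kernel.
Qed.

Lemma dyadic_label_law w n (c : 'I_n -> R) (t : 'I_n -> R) B :
  (forall k, dyadic (t k)) -> measurable B ->
  Q [set o | B (lincomb dyadic_label c t (w, o))] =
  centered_normal (lincomb_var (minseg (g^~ w)) c t) B.
Proof.
move=> Dt mB; pose N := (\max_(k < n) dyadic_index (t k)).+1.
have tN k : (dyadic_index (t k) < N)%N by rewrite ltnS; exact: (leq_bigmax k).
have -> : [set o | B (lincomb dyadic_label c t (w, o))] =
    [set o | B (\sum_(r < N) (\sum_(k < n) c k * cholesky (dyadic_kernel w) (dyadic_index (t k)) r)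
      * gaussian_seq r o)].
  apply/funext => o /=; congr B; rewrite /lincomb.
  under [LHS]eq_bigr => k _ do rewrite (dyadic_label_widen (w, o) (tN k)) mulr_sumr.
  rewrite exchange_big/=; apply: eq_bigr => r _; rewrite mulr_suml.
  by apply: eq_bigr => k _; rewrite mulrA.
rewrite (gaussian_seq_law N (fun r => \sum_(k < n) c k * cholesky (dyadic_kernel w) (dyadic_index (t k)) r) mB).
rewrite (cholesky_lincomb c (psd_dyadic_kernel w) tN); congr centered_normal.
apply: eq_bigr => k _; apply: eq_bigr => m _.
by rewrite /dyadic_kernel !dyadic_indexK.
Qed.

Definition fst_events : set (set TQ) := [set A | exists2 A0, measurable A0 & A = fst @^-1` A0].

Lemma measurable_lincomb_var n (c t : 'I_n -> R) : (forall k, unitI (t k)) ->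
  measurable_fun setT (fun w => lincomb_var (minseg (g^~ w)) c t).
Proof.
move=> ut; apply: measurable_sum => k; apply: measurable_sum => m.
by apply: measurable_funM; [exact: measurable_cst|exact: measurable_minseg_unit].
Qed.

(** For a fixed point of the base space the label is Gaussian by [dyadic_label_law]; Fubini
    integrates this over events of the base. *)
Lemma dyadic_label_gaussian : cond_gaussian_on PQ fst_events dyadic dyadic_label
  (fun p => minseg (g^~ p.1)).
Proof.
split=> [s _|n c t B _ Dt mB [A mA ->]]; first exact: measurable_dyadic_label.
have ut k : unitI (t k) by exact: dyadic_unit.
have v0 w : 0 <= lincomb_var (minseg (g^~ w)) c t.
  by apply: lincomb_var_minseg_ge0 => // x; exact: g0.
have mv := measurable_lincomb_var c ut.
have mE : measurable (fst @^-1` A `&` lincomb dyadic_label c t @^-1` B).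
  apply: measurableI; first exact: (preimage_measurable measurable_fst).
  apply: preimage_measurable => //.
  exact: (@measurable_lincomb _ _ dyadic _ _ dyadic_label (fun i _ => measurable_dyadic_label i)).
rewrite (@integral_fst _ _ _ _ _ P Q A (fun w => centered_normal (lincomb_var (minseg (g^~ w)) c t) B))//;
  [|exact: measurable_centered_normal|by move=> w; exact: centered_normal_ge0].
apply: etrans (product_sections1 P Q mE) _.
rewrite [RHS]integral_mkcond; apply: eq_integral => w _.
rewrite /patch; case: ifPn => [/set_mem Aw|/negP nAw].
  rewrite -(dyadic_label_law w c Dt mB); congr (Q _).
  by apply/seteqP; split => o /=; [move=> []|].
rewrite (_ : [set y | _] = set0) ?measure0//.
by apply/seteqP; split => o //= [Aw _]; apply: nAw; exact: mem_set.
Qed.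

Let g1 (t : R) (p : TQ) : R := g t p.1.

Let mtd s t : dyadic s -> dyadic t ->
  measurable_fun setT (fun p : TQ => tree_dist (g1^~ p) s t).
Proof.
move=> /dyadic_unit us /dyadic_unit ut.
exact: (measurableT_comp (measurable_tree_dist mg C0g us ut) measurable_fst).
Qed.

Let mg1 s : dyadic s -> measurable_fun setT (g1 s).
Proof. by move=> /dyadic_unit us; exact: (measurableT_comp (mg us) measurable_fst). Qed.

Let mX s : dyadic s -> measurable_fun setT (dyadic_label s).
Proof. by move=> _; exact: measurable_dyadic_label. Qed.

Let GM : fst_events `<=` measurable.
Proof. by move=> _ [A mA ->]; exact: (preimage_measurable measurable_fst). Qed.

Let Gg (s t r : R) : dyadic s -> dyadic t ->
  fst_events [set p | tree_dist (g1^~ p) s t <= r].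
Proof.
move=> /dyadic_unit us /dyadic_unit ut; exists [set w | tree_dist (g^~ w) s t <= r] => //.
by apply: measurable_le_fun; [exact: measurable_tree_dist|exact: measurable_cst].
Qed.

Definition snake_label (s : R) (p : TQ) : R := label_extension dyadic_label g1 rho s p.

Lemma measurable_snake_label s : unitI s -> measurable_fun setT (snake_label s).
Proof.
move=> us; apply: (measurable_label_extension (D := dyadic)) => //.
- exact: dyadic_gridpoint.
- by move=> p; exact: gC.
Qed.

Lemma snake_label_snake p : snake (g^~ p.1) (snake_label^~ p).
Proof.
by apply: (@label_extension_snake _ _ _ dyadic_label g1 rho) => // q; exact: gC.
Qed.

(** The conditional law passes from dyadic to arbitrary times along the grid approximations, the
    kernel converging with the labels. *)
Lemma snake_label_law n (c t : 'I_n -> R) B A : (forall k, unitI (t k)) ->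
  measurable B -> measurable A ->
  PQ (fst @^-1` A `&` lincomb snake_label c t @^-1` B) =
  (\int[P]_(w in A) centered_normal (lincomb_var (minseg (g^~ w)) c t) B)%E.
Proof.
move=> ut mB mA.
(* The mixed law on the right is realised by the conditional deviation times an independent standard
   normal variable, so that [law_limit] can compare two sequences of random variables. *)
pose V (s : 'I_n -> R) (p : T * R) := Num.sqrt (lincomb_var (minseg (g^~ p.1)) c s) * p.2.
have v0 w s : (forall k, unitI (s k)) -> 0 <= lincomb_var (minseg (g^~ w)) c s.
  by move=> us; apply: lincomb_var_minseg_ge0 => // x; exact: g0.
have mV s : (forall k, unitI (s k)) -> measurable_fun setT (V s).
  move=> us; apply: measurable_funM; last exact: measurable_snd.
  exact: (measurableT_comp (measurable_sqrtr (measurable_lincomb_var c us)) measurable_fst).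
have VE s C : (forall k, unitI (s k)) -> measurable C ->
    (P \x normal_prob 0 1)%E (fst @^-1` A `&` V s @^-1` C) =
    (\int[P]_(w in A) centered_normal (lincomb_var (minseg (g^~ w)) c s) C)%E.
  move=> us mC.
  have mE : measurable (fst @^-1` A `&` V s @^-1` C).
    apply: measurableI; first exact: (preimage_measurable measurable_fst).
    exact: (preimage_measurable (mV s us)).
  rewrite product_sections1// [RHS]integral_mkcond; apply: eq_integral => w _.
  rewrite /patch; case: ifPn => [/set_mem Aw|/negP nAw].
    rewrite (@centered_normalE _ _ (Num.sqrt (lincomb_var (minseg (g^~ w)) c s)))//; last first.
      by rewrite sqr_sqrtr// v0.
    by congr (normal_prob _ _ _); apply/seteqP; split => o /=; [move=> []|].
  rewrite (_ : [set y | _] = set0) ?measure0//.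
  by apply/seteqP; split => o //= [Aw _]; apply: nAw; exact: mem_set.
have ug m k : unitI (gridfloor m (t k)) by exact: unitI_gridfloor.
rewrite -(VE t B ut mB); move: B mB.
apply: (@law_limit _ _ _ PQ _ _ (P \x normal_prob 0 1)%E (fst @^-1` A) (fst @^-1` A)
  (fun m => lincomb dyadic_label c (fun k => gridfloor m (t k))) _
  (fun m => V (fun k => gridfloor m (t k)))).
- exact: (preimage_measurable measurable_fst).
- exact: (preimage_measurable measurable_fst).
- move=> m.
  apply: (@measurable_lincomb _ _ dyadic _ _ dyadic_label (fun i _ => measurable_dyadic_label i)).
  by move=> k; exact: dyadic_gridfloor.
- exact: (@measurable_lincomb _ _ unitI _ _ snake_label measurable_snake_label).
- by move=> m; exact: mV.
- exact: mV.
- have gp : {ae PQ, forall p, good_path dyadic_label g1 rho p}.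
    apply: (good_path_ae dyadic_unit _ mX rho0 rho1 mtd _ GM _ Gg dyadic_label_gaussian).
    + exact: dyadic_gridpoint.
    + by move=> p; exact: gC.
    + by exists setT.
    + exact: (ae_fst Q gm).
  apply: filterS gp => p gp.
  apply: (@cvg_sum_seq _ _ (fun k m => c k * dyadic_label (gridfloor m (t k)) p)
    (fun k => c k * snake_label (t k) p)) => k; apply: cvgM; first exact: cvg_cst.
  by apply: cvg_label_extension => // q; exact: gC.
- apply: filterS (ae_fst (normal_prob 0 1) gm) => p gp; apply: cvgM; last exact: cvg_cst.
  apply: cvg_continuous_seq; first exact: sqrt_continuous.
  apply: (@cvg_sum_seq _ _ (fun k i => \sum_(m < n) c k * c m *
      minseg (g^~ p.1) (gridfloor i (t k)) (gridfloor i (t m)))) => k.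
  apply: (@cvg_sum_seq _ _ (fun m i => c k * c m *
      minseg (g^~ p.1) (gridfloor i (t k)) (gridfloor i (t m)))) => m; apply: cvgM; first exact: cvg_cst.
  apply: (cvg_minseg_gridfloor (g0 p.1) rho0 rho1) => //.
  by apply: grid_modulus_continuous => //; have [[]] := gC p.1.
- move=> m B mB; apply/esym; apply: etrans (VE _ B (ug m) mB) _; apply/esym.
  have Dm k : dyadic (gridfloor m (t k)) by exact: dyadic_gridfloor.
  have GA : fst_events (fst @^-1` A) by exists A.
  apply: etrans (dyadic_label_gaussian.2 n c _ B _ Dm mB GA) _.
  apply: (@integral_fst _ _ _ _ _ P Q A (fun w =>
    centered_normal (lincomb_var (minseg (g^~ w)) c (fun k => gridfloor m (t k))) B)) => //.
    by apply: measurable_centered_normal => // [|w]; [exact: measurable_lincomb_var|exact: v0].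
  by move=> w; exact: centered_normal_ge0.
Qed.

End label_construction.

(** * Laws of functionals *)

Section generated_algebra.
Context {R : realType} (J : Type) (C : set J).

Definition coordinate_sets (T : Type) (Y : J -> T -> R) : set (set T) :=
  [set A | exists j (B : set R), [/\ C j, measurable B & A = Y j @^-1` B]].

Lemma sigma_path_event (T : Type) (Y : J -> T -> R) A : <<s coordinate_sets Y >> A ->
  exists2 E, cylinder_algebra C E & A = path_event Y E.
Proof.
suff : <<s coordinate_sets Y >> `<=`
    [set A | exists2 E, cylinder_algebra C E & A = path_event Y E] by exact.
apply: smallest_sub; last first.
  move=> _ [j [B [Cj mB ->]]]; exists [set x | B (x j)] => //.
  by apply: sub_sigma_algebra; exists j, B.
split.
- by exists set0 => //; exact: sigma_algebra0.
- move=> _ [E cE ->]; exists (~` E); first by rewrite -setTD; exact: sigma_algebraCD.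
  by rewrite setTD.
- move=> F FE.
  pose E n := projT1 (cid2 (FE n)).
  have EP n : cylinder_algebra C (E n) /\ F n = path_event Y (E n).
    by rewrite /E; case: cid2.
  exists (\bigcup_n E n); first by apply: sigma_algebra_bigcup => n; have [] := EP n.
  apply/seteqP; split => w /= [n _].
    by have [_ ->] := EP n; exists n.
  by move=> En; exists n => //; have [_ ->] := EP n.
Qed.

Variables (T : pointedType) (Y : J -> T -> R).

Lemma measurable_coordinate j : C j ->
  measurable_fun setT (Y j : g_sigma_algebraType (coordinate_sets Y) -> R).
Proof.
move=> Cj _ B mB; rewrite setTI.
by apply: sub_sigma_algebra; exists j, B.
Qed.

Lemma path_event_sigma E : cylinder_algebra C E -> <<s coordinate_sets Y >> (path_event Y E).
Proof.
move=> cE; apply: (@measurable_path_event _ _ C _ (g_sigma_algebraType (coordinate_sets Y)) Y).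
  exact: measurable_coordinate.
exact: cE.
Qed.

End generated_algebra.

Section cylinders.
Context {R : realType} (J : Type) (C : set J).
Implicit Types E F : set (J -> R).

Lemma cylinderT : cylinder_algebra C [set: J -> R].
Proof. exact: (@measurableT _ (g_sigma_algebraType _)). Qed.

Lemma cylinderI E F : cylinder_algebra C E -> cylinder_algebra C F -> cylinder_algebra C (E `&` F).
Proof. exact: (@measurableI _ (g_sigma_algebraType _)). Qed.

End cylinders.

(** * Comparison of functionals on two spaces *)

Section join.
Context {R : realType} d (T : measurableType d) (P : probability T R)
  d' (T' : measurableType d') (P' : probability T' R).
Variable (J : Type).

(* A family on [T] and a family on [T'] put together on one space, so that a
   functional measurable for the joint family is the same functional of both. *)
Definition join (I U : Type) (X : I -> T -> U) (X' : I -> T' -> U) i (z : bool * T * T') : U :=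
  if z.1.1 then X i z.1.2 else X' i z.2.

Definition joint_space (C : set J) (Y : J -> T -> R) (Y' : J -> T' -> R) := g_sigma_algebraType (coordinate_sets C (join Y Y')).

(** An event on [X] and the same event on [X'] are traces of one event of the joint space, hence of
    one cylinder set in the conditioning families; this set then serves on both sides. *)
Lemma functional_law (C : set J) (Y : J -> T -> R) (Y' : J -> T' -> R) (I : Type) (D : set I) (X : I -> T -> R) (X' : I -> T' -> R) :
  same_law C P Y P' Y' ->
  (forall i, D i -> measurable_fun setT (join X X' i : joint_space C Y Y' -> R)) ->
  same_law D P X P' X'.
Proof.
move=> YY' mX E cE.
have /sigma_path_event[E' cE' EE'] : <<s coordinate_sets C (join Y Y') >> (path_event (join X X') E).
  exact: (@measurable_path_event _ _ D _ (joint_space C Y Y') (join X X') mX E cE).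
have -> : path_event X E = path_event Y E'.
  apply/seteqP; split => w Ew.
    by have : path_event (join X X') E (true, w, point) by []; rewrite EE'.
  by have : path_event (join Y Y') E' (true, w, point) by []; rewrite -EE'.
have -> : path_event X' E = path_event Y' E'.
  apply/seteqP; split => w Ew.
    by have : path_event (join X X') E (false, point, w) by []; rewrite EE'.
  by have : path_event (join Y Y') E' (false, point, w) by []; rewrite -EE'.
exact: YY'.
Qed.

(** Both measures are pushed to the joint space, where they agree on the generated sigma-algebra. *)
Lemma functional_integral (C : set J) (Y : J -> T -> R) (Y' : J -> T' -> R) E (f : T -> \bar R) (f' : T' -> \bar R) :
  (forall j, C j -> measurable_fun setT (Y j)) ->
  (forall j, C j -> measurable_fun setT (Y' j)) ->
  same_law C P Y P' Y' -> cylinder_algebra C E ->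
  measurable_fun setT (join (fun _ : unit => f) (fun=> f') tt : joint_space C Y Y' -> \bar R) ->
  (forall w, 0 <= f w)%E -> (forall w, 0 <= f' w)%E ->
  (\int[P]_(w in path_event Y E) f w = \int[P']_(w in path_event Y' E) f' w)%E.
Proof.
move=> mY mY' YY' cE mf f0 f'0.
pose phi w : joint_space C Y Y' := (true, w, point).
pose phi' w : joint_space C Y Y' := (false, point, w).
have mphi : measurable_fun setT phi.
  apply: (@measurability _ _ _ _ setT phi (coordinate_sets C (join Y Y')) erefl).
  move=> _ [_ [j [B [Cj mB ->]]] <-].
  by rewrite setTI; exact: (preimage_measurable (mY j Cj) mB).
have mphi' : measurable_fun setT phi'.
  apply: (@measurability _ _ _ _ setT phi' (coordinate_sets C (join Y Y')) erefl).
  move=> _ [_ [j [B [Cj mB ->]]] <-].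
  by rewrite setTI; exact: (preimage_measurable (mY' j Cj) mB).
have mA : measurable (path_event (join Y Y') E : set (joint_space C Y Y')).
  exact: path_event_sigma.
transitivity (\int[pushforward P phi]_(w in path_event (join Y Y') E)
    join (fun _ : unit => f) (fun=> f') tt w)%E.
  rewrite ge0_integral_pushforward//; first exact: measurable_funTS.
  by move=> z _; rewrite /join; case: ifP.
transitivity (\int[pushforward P' phi']_(w in path_event (join Y Y') E)
    join (fun _ : unit => f) (fun=> f') tt w)%E.
  apply: eq_measure_integral => A /sigma_path_event[E' cE' ->] _.
  exact: YY'.
rewrite ge0_integral_pushforward//; first exact: measurable_funTS.
by move=> z _; rewrite /join; case: ifP.
Qed.

(** A pi-lambda argument on intersections of one cylinder set from each part. *)
Lemma same_law_union (C1 C2 : set J) (Y : J -> T -> R) (Y' : J -> T' -> R) :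
  (forall j, (C1 `|` C2) j -> measurable_fun setT (Y j)) ->
  (forall j, (C1 `|` C2) j -> measurable_fun setT (Y' j)) ->
  (forall E1 E2, cylinder_algebra C1 E1 -> cylinder_algebra C2 E2 ->
    P (path_event Y E1 `&` path_event Y E2) = P' (path_event Y' E1 `&` path_event Y' E2)) ->
  same_law (C1 `|` C2) P Y P' Y'.
Proof.
move=> mY mY' H.
have sub1 (E : set (J -> R)) : cylinder_algebra C1 E -> cylinder_algebra (C1 `|` C2) E.
  by apply: sub_smallest2r => //; move=> _ [j [B [? ? ->]]]; exists j, B; split => //; left.
have sub2 (E : set (J -> R)) : cylinder_algebra C2 E -> cylinder_algebra (C1 `|` C2) E.
  by apply: sub_smallest2r => //; move=> _ [j [B [? ? ->]]]; exists j, B; split => //; right.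
pose G := [set E : set (J -> R) | exists E1 E2, [/\ cylinder_algebra C1 E1,
  cylinder_algebra C2 E2 & E = E1 `&` E2]].
pose U := g_sigma_algebraType G.
have GS : cylinder_algebra (C1 `|` C2) `<=` <<s G >>.
  apply: smallest_sub; first exact: smallest_sigma_algebra.
  move=> _ [j [B [[Cj|Cj] mB ->]]]; apply: sub_sigma_algebra.
    exists [set x | B (x j)], setT; split; [|exact: cylinderT|by rewrite setIT].
    by apply: sub_sigma_algebra; exists j, B.
  exists setT, [set x | B (x j)]; split; [exact: cylinderT| |by rewrite setTI].
  by apply: sub_sigma_algebra; exists j, B.
have SG : <<s G >> `<=` cylinder_algebra (C1 `|` C2).
  apply: smallest_sub; first exact: smallest_sigma_algebra.
  by move=> _ [E1 [E2 [c1 c2 ->]]]; apply: cylinderI; [exact: sub1|exact: sub2].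
move=> E /GS GE.
apply: (@dynkin_induction _ U G (fun E => P (path_event Y E) = P' (path_event Y' E))) GE.
- by [].
- move=> _ _ [E1 [E2 [c1 c2 ->]]] [F1 [F2 [e1 e2 ->]]]; exists (E1 `&` F1), (E2 `&` F2).
  by split; [exact: cylinderI|exact: cylinderI|rewrite setIACA].
- by apply: etrans (probability_setT P) _; apply/esym/probability_setT.
- by move=> _ [E1 [E2 [c1 c2 ->]]]; exact: H.
- move=> S /SG cS PS; have mS := measurable_path_event mY cS.
  have mS' := measurable_path_event mY' cS.
  by apply: etrans (probability_setC P mS) _; rewrite PS; apply/esym/probability_setC.
- move=> F mF tF PF.
  have cF n : cylinder_algebra (C1 `|` C2) (F n) by apply: SG; exact: mF.
  have mS n := measurable_path_event mY (cF n); have mS' n := measurable_path_event mY' (cF n).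
  have tS : trivIset setT (fun n => path_event Y (F n)).
    by move=> i j _ _ [w [Fi Fj]]; apply: (tF i j) => //; exists (Y^~ w).
  have tS' : trivIset setT (fun n => path_event Y' (F n)).
    by move=> i j _ _ [w [Fi Fj]]; apply: (tF i j) => //; exists (Y'^~ w).
  have SP := measure_semi_sigma_additive _ mS tS (bigcupT_measurable _ mS).
  have SP' := measure_semi_sigma_additive _ mS' tS' (bigcupT_measurable _ mS').
  transitivity (limn (fun n => \sum_(0 <= i < n) P (path_event Y (F i)))%E).
    by apply/esym; apply: cvg_lim => //; exact: SP.
  transitivity (limn (fun n => \sum_(0 <= i < n) P' (path_event Y' (F i)))%E).
    by congr (limn _); apply/funext => n; apply: eq_bigr => i _; exact: PF.
  by apply: cvg_lim => //; exact: SP'.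
Qed.

End join.

(** * Brownian motion and the normalized excursion *)

Section half_line.
Context {R : realType}.
Implicit Types f : R -> R.

Definition pos_part (x : R) : R := Num.max 0 x.

Lemma pos_part_ge0 x : 0 <= pos_part x. Proof. by rewrite le_max lexx. Qed.

Lemma pos_part_id x : 0 <= x -> pos_part x = x.
Proof. by move=> x0; rewrite /pos_part max_r. Qed.

Lemma pos_part_dist x y : `|pos_part x - pos_part y| <= `|x - y|.
Proof.
rewrite /pos_part; have h1 := ler_norm (x - y); have := ler_norm (y - x); rewrite distrC => h2.
case: (leP 0 x) => ?; case: (leP 0 y) => ?; rewrite ?subr0 ?sub0r ?normrN ?normr0 ?normr_ge0//.
- by rewrite (ger0_norm (x := x))//; lra.
- by rewrite (ger0_norm (x := y))//; lra.
Qed.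

Lemma pos_part_continuous f : {within `[0, +oo[, continuous f} -> continuous (f \o pos_part).
Proof.
move=> /subspace_continuousP cf x; apply/cvgrPdist_lt => e e0.
have px : `[0, +oo[%classic (pos_part x) by rewrite /= in_itv/= pos_part_ge0.
have /cvgrPdist_lt/(_ e e0) := cf _ px.
rewrite near_withinE => /nbhs_ballP[d /= d0 H].
apply/nbhs_ballP; exists d => // y /= xy; apply: H; last by rewrite /= in_itv/= pos_part_ge0.
by apply: le_lt_trans (pos_part_dist x y) _.
Qed.

Lemma rescaled_excursion_pos_part f t : 0 <= t <= 1 -> f 0 = 0 ->
  rescaled_excursion f t = rescaled_excursion (f \o pos_part) t.
Proof.
move=> /andP[t0 t1] f0.
have lE : last_zero f = last_zero (f \o pos_part).
  rewrite /last_zero; congr sup; apply/seteqP.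
  by split => s /= [/andP[s0 s1]]; rewrite ?pos_part_id// => fs; rewrite s0.
have nE : next_zero f = next_zero (f \o pos_part).
  rewrite /next_zero; congr inf; apply/seteqP.
  by split => s /= [s1]; rewrite ?pos_part_id//; exact: le_trans s1.
have l0 : 0 <= last_zero f.
  apply: sup_ubound; first by exists 1 => x [/andP[]].
  by rewrite /= lexx ler01.
have n0 : 0 <= next_zero f.
  have [[x Sx]|S0] := pselect ([set s | 1 <= s /\ f s = 0] !=set0).
    by apply: lb_le_inf; [exists x|move=> y [y1 _]; exact: le_trans y1].
  by rewrite /next_zero (_ : [set _ | _] = set0) ?inf0//; apply: contrapT => /eqP/set0P.
rewrite /rescaled_excursion -lE -nE /= pos_part_id//.
rewrite (_ : _ + _ = (1 - t) * last_zero f + t * next_zero f); last by ring.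
by rewrite addr_ge0// mulr_ge0// subr_ge0.
Qed.

End half_line.

Section excursion_paths.
Context {R : realType} d (Z : measurableType d).
Variable F : R -> Z -> R.
Hypothesis cF : forall z, continuous (F^~ z).
Hypothesis F0 : forall z, F 0 z = 0.

Lemma next_zeroE z : F (next_zero (F^~ z)) z = 0.
Proof.
have [/(next_zero_some (@cF))[]//|/next_zero_none ->] := pselect (exists s, 1 <= s /\ F s z = 0).
exact: F0.
Qed.

Lemma rescaled_excursion_Cplus z : Cplus (rescaled_excursion (F^~ z)).
Proof.
split; last by move=> x _; rewrite /rescaled_excursion divr_ge0// sqrtr_ge0.
rewrite /rescaled_excursion; split.
- set a := last_zero _; set b := next_zero _.
  have cq : continuous (fun t : R => a + t * (b - a)).
    by move=> x; apply: cvgD; [exact: cvg_cst|apply: cvgM; [exact: cvg_id|exact: cvg_cst]].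
  have cFq : continuous (fun t : R => F (a + t * (b - a)) z).
    move=> x; apply: (@continuous_comp _ _ _ (fun t : R => a + t * (b - a)) (F^~ z)).
      exact: cq.
    exact: cF.
  apply: continuous_within_unit => x; apply: cvgM; last exact: cvg_cst.
  by apply: cvg_norm; exact: cFq.
- by rewrite mul0r addr0 (last_zeroE (@cF) F0) normr0 mul0r.
- by rewrite mul1r addrC subrK next_zeroE normr0 mul0r.
Qed.

Lemma rescaled_excursion_modulus z (rho : R) (N : R) : 0 < N -> next_zero (F^~ z) <= N ->
  modulus rho (fun u => F (N * u) z) -> modulus rho (rescaled_excursion (F^~ z)).
Proof.
move=> N0 bN [C [N1 H]]; rewrite /rescaled_excursion.
set a := last_zero _; set b := next_zero _.
have /andP[a0 a1] : 0 <= a <= 1 by exact: (last_zero_itv F0).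
(* Happens when there is no zero after 1, with the default b = 0, or when 1 is itself a zero: the
   root and its inverse are then 0, and so is the path. *)
have [ab|ab] := leP (b - a) 0.
  exists 0, 0%N => n _ s t _ _ _.
  by rewrite ler0_sqrtr// invr0 !mulr0 subrr normr0 mul0r.
exists (C / Num.sqrt (b - a)), N1 => n Nn s t us ut st.
have U x : unitI x -> unitI ((a + x * (b - a)) / N).
  move=> /unitIP/andP[x0 x1]; apply/unitIP; apply/andP; split.
    by rewrite divr_ge0 ?(ltW N0)// addr_ge0// mulr_ge0// ltW.
  rewrite ler_pdivrMr// mul1r (le_trans _ bN)// -/b.
  rewrite -[leRHS](subrK a) addrC lerD2r.
  by apply: ler_piMl => //; exact: ltW.
have V x : a + x * (b - a) = N * ((a + x * (b - a)) / N).
  by rewrite [RHS]mulrCA divff ?mulr1// gt_eqF.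
rewrite -mulrBl normrM [X in _ * X]ger0_norm ?invr_ge0 ?sqrtr_ge0//.
rewrite mulrAC ler_wpM2r ?invr_ge0 ?sqrtr_ge0//.
apply: le_trans (ler_dist_dist _ _) _.
rewrite (V s) (V t); apply: H => //; try exact: U.
apply: le_trans st; rewrite -mulrBl opprD addrACA subrr add0r -mulrBl -mulrA normrM.
rewrite ler_piMr// ger0_norm ?divr_ge0 ?(ltW N0) ?(ltW ab)//.
by rewrite ler_pdivrMr// mul1r (le_trans _ bN)// -/b gerBl.
Qed.

End excursion_paths.

Section brownian_modulus.
Context {R : realType} d (T : measurableType d) (P : probability T R).
Variable W : R -> T -> R.
Hypothesis BW : brownian_motion P W.

Lemma minseg_id (s t : R) : unitI s -> unitI t -> minseg (fun u => u) s t = Num.min s t.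
Proof.
move=> us ut; have p (x : R) : unitI x -> 0 <= x by move=> /unitIP/andP[].
apply/eqP; rewrite eq_le; apply/andP; split.
  by rewrite le_min (minseg_lel p us ut) (minseg_ler p us ut).
by apply: le_minseg => x /andP[].
Qed.

(** The lifetime u -> u has modulus rate 1/2, so this is the rate of a label over it. *)
Definition brownian_rate : R := theta_of (2^-1 : R).

Lemma brownian_rate_itv : 0 < brownian_rate /\ brownian_rate < 1.
Proof.
have [] := @sigma_theta R (2^-1) _ _ => //; rewrite ?invr_gt0 ?ltr0n// invf_lt1 ?ltr0n//.
by rewrite ltr1n.
Qed.

Let pos u : unitI u -> forall N : nat, `[0, +oo[%classic (N.+1%:R * u : R).
Proof. by move=> /unitIP/andP[u0 _] N; rewrite /= in_itv/= andbT mulr_ge0. Qed.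

(** Brownian motion on [0, N + 1], scaled to [0, 1], is the label of the deterministic lifetime u ->
    u, as the minimum of u over [s, t] is min(s, t). This lifetime does not vanish at 1, so only the
    bound over pairs is borrowed from the snakes; continuity belongs to the definition of the
    motion. *)
Lemma brownian_modulus_ae (N : nat) :
  {ae P, forall w, modulus brownian_rate (fun u => W (N.+1%:R * u) w)}.
Proof.
have h0 : 0 < 2^-1 :> R by rewrite invr_gt0.
have h1 : 2^-1 < 1 :> R by rewrite invf_lt1// ltr1n.
have [[mW gW] W0 cW] := BW.
have [s0 rs st t0 t1] := sigma_theta h0 h1.
set S := Num.sqrt N.+1%:R : R.
have S0 : 0 < S by rewrite sqrtr_gt0.
have S2 : S ^+ 2 = N.+1%:R by rewrite sqr_sqrtr.
pose X u w := S^-1 * W (N.+1%:R * u) w.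
pose G : set (set T) := [set A | A = setT \/ A = set0].
pose g (u : R) (_ : T) := u.
have gid w : g^~ w = (fun u => u) by [].
have g0 w x : unitI x -> 0 <= g x w by move=> /unitIP/andP[].
have GM : G `<=` measurable by move=> _ [->|->].
have mg s t : unitI s -> unitI t -> measurable_fun setT (fun w => tree_dist (g^~ w) s t).
  by move=> _ _; under eq_fun do rewrite gid; exact: measurable_cst.
have Gg (s t r : R) : unitI s -> unitI t -> G [set w | tree_dist (g^~ w) s t <= r].
  move=> _ _; have [h|h] := boolP (tree_dist (fun u => u) s t <= r).
    by left; apply/seteqP; split.
  by right; apply/seteqP; split => // w /=; rewrite gid (negbTE h).
have GX : cond_gaussian_on P G unitI X (fun w => minseg (g^~ w)).
  split=> [u uu|n c t B A ut mB [->|->]].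
  - by apply: measurable_funM; [exact: measurable_cst|apply: mW; exact: pos].
  - rewrite setTI.
    have -> : lincomb X c t = lincomb W (fun k => c k / S) (fun k => N.+1%:R * t k).
      by apply/funext => w; apply: eq_bigr => k _; rewrite /X mulrA.
    rewrite gW//; last by move=> k; exact: pos.
    under eq_integral do rewrite gid.
    have -> : lincomb_var (fun s t => Num.min s t) (fun k => c k / S) (fun k => N.+1%:R * t k) =
        lincomb_var (minseg (fun u => u)) c t.
      apply: eq_bigr => k _; apply: eq_bigr => m _.
      rewrite minseg_id// -minr_pMr// -S2; field.
      by rewrite gt_eqF.
    rewrite integral_cst//; apply: etrans (esym (mule1 _)) _; congr (_ * _)%E.
    by apply/esym; exact: probability_setT.
  - by rewrite set0I measure0 integral_set0.
have := pairs_modulus_ae GM (fun x (h : unitI x) => h) g0 mg Gg GX s0 st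
  (fun n i i2 => unitI_gridpoint i2).
apply: filterS => w pm.
have mid : modulus (2^-1) (fun u : R => u).
  by exists 1, 0%N => n _ s t _ _; rewrite mul1r.
have gX : grid_modulus brownian_rate (X^~ w).
  by apply: (pairs_grid_modulus h0 rs t0 t1 _ mid pm); exact: g0.
have cX : continuous (fun u : R => W (pos_part (N.+1%:R * u)) w).
  move=> x; apply: (@continuous_comp _ _ _ (fun u : R => N.+1%:R * u) (fun u => W (pos_part u) w)).
    exact: mulrl_continuous.
  exact: (pos_part_continuous (cW w)).
have [] := @grid_modulus_continuous R brownian_rate (X^~ w) t0 t1 _ gX.
  apply: (@eq_within_unit _ (fun u => S^-1 * W (pos_part (N.+1%:R * u)) w)).
    move=> x ux; rewrite pos_part_id//.
    by have := pos ux N; rewrite /= in_itv/= andbT.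
  apply: continuous_within_unit => x; apply: cvgM; [exact: cvg_cst|exact: cX].
move=> C [N1 H]; exists (S * C), N1 => n Nn s t us ut s_t.
have := H n Nn s t us ut s_t; rewrite /X -mulrBr normrM (ger0_norm (x := S^-1)) ?invr_ge0 ?(ltW S0)//.
by rewrite ler_pdivrMl// mulrA.
Qed.

Let F t w := W (pos_part t) w.

Let cF w : continuous (F^~ w).
Proof. by have [_ _ cW] := BW; exact: (pos_part_continuous (cW w)). Qed.

Let F0 w : F 0 w = 0.
Proof. by have [_ W0 _] := BW; rewrite /F pos_part_id. Qed.

(** The end of the excursion is random, so the modulus is taken on all intervals [0, N + 1] at
    once. *)
Lemma brownian_excursion_modulus_ae :
  {ae P, forall w, modulus brownian_rate (rescaled_excursion (W^~ w))}.
Proof.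
have := ae_foralln brownian_modulus_ae; apply: filterS => w H.
have : modulus brownian_rate (rescaled_excursion (F^~ w)).
  pose N := Num.trunc (next_zero (F^~ w)).
  have RM := @rescaled_excursion_modulus _ _ _ F F0 w brownian_rate N.+1%:R; apply: RM => //.
    by apply/ltW; exact: truncnS_gt.
  have [C [N1 H1]] := H N; exists C, N1 => n Nn s t us ut st.
  have p (x : R) : unitI x -> pos_part (N.+1%:R * x) = N.+1%:R * x.
    by move=> ux; rewrite pos_part_id//; have := pos ux N; rewrite /= in_itv/= andbT.
  by rewrite /F !p//; exact: H1.
move=> [C [N1 H1]]; exists C, N1 => n Nn s t us ut st.
have [_ W0 _] := BW.
have e x : unitI x -> rescaled_excursion (W^~ w) x = rescaled_excursion (F^~ w) x.
  by move=> /unitIP ux; rewrite rescaled_excursion_pos_part.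
by rewrite !e//; exact: H1.
Qed.

End brownian_modulus.

Section excursion_law.
Context {R : realType}.

Lemma measurable_brownian_excursion d (T : measurableType d) (P : probability T R) W t :
  brownian_motion P W -> unitI t ->
  measurable_fun setT (fun w => rescaled_excursion (W^~ w) t).
Proof.
move=> [[mW gW] W0 cW] /unitIP ut; pose F t w := W (pos_part t) w.
have mF s : measurable_fun setT (F s) by apply: mW; rewrite /= in_itv/= pos_part_ge0.
have cF w : continuous (F^~ w) by exact: (pos_part_continuous (cW w)).
have F0 w : F 0 w = 0 by rewrite /F pos_part_id.
have : measurable_fun setT (fun w => rescaled_excursion (F^~ w) t).
  exact: measurable_rescaled_excursion.
by apply: eq_measurable_fun => w _; exact/esym/rescaled_excursion_pos_part.
Qed.

Lemma brownian_motion_law d (T : measurableType d) (P : probability T R) W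
    d' (T' : measurableType d') (P' : probability T' R) W' :
  brownian_motion P W -> brownian_motion P' W' -> same_law (`[0, +oo[ : set R) P W P' W'.
Proof.
move=> [[mW gW] _ _] [[mW' gW'] _ _] E cE.
rewrite -[path_event W E]setTI -[path_event W' E]setTI.
apply: (@law_from_lincomb R R `[0, +oo[ _ _ P setT measurableT _ _ P' setT measurableT W W'
  mW mW' _ E cE) => n c t B Dt mB.
by rewrite !setTI gW// gW'.
Qed.

Lemma rescaled_excursion_law d (T : measurableType d) (P : probability T R) W
    d' (T' : measurableType d') (P' : probability T' R) W' :
  brownian_motion P W -> brownian_motion P' W' ->
  same_law unitI P (fun t w => rescaled_excursion (W^~ w) t)
    P' (fun t w => rescaled_excursion (W'^~ w) t).
Proof.
move=> BW BW'; apply: (functional_law (brownian_motion_law BW BW')) => t ut.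
pose F (s : R) (z : joint_space `[0, +oo[ W W') := join W W' (pos_part s) z.
have mF s : measurable_fun setT (F s).
  by apply: measurable_coordinate; rewrite /= in_itv/= pos_part_ge0.
have [_ W0 cW] := BW; have [_ W'0 cW'] := BW'.
have cF z : continuous (F^~ z).
  move: z => [[[] w] w']; first exact: (pos_part_continuous (cW w)).
  exact: (pos_part_continuous (cW' w')).
have F0 z : F 0 z = 0 by rewrite /F /join pos_part_id//; case: ifP.
have m := measurable_rescaled_excursion mF (@cF) F0 ((unitIP t).1 ut).
have : measurable_fun setT (fun z => rescaled_excursion (F^~ z) t) by exact: m.
apply: eq_measurable_fun => z _.
rewrite /join /F; case: ifP => bz.
  apply: etrans (esym (rescaled_excursion_pos_part ((unitIP t).1 ut) (W0 z.1.2))).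
  by congr rescaled_excursion; apply/funext => s; rewrite /join bz.
apply: etrans (esym (rescaled_excursion_pos_part ((unitIP t).1 ut) (W'0 z.2))).
by congr rescaled_excursion; apply/funext => s; rewrite /join bz.
Qed.

Lemma brownian_excursion_law d (T : measurableType d) (P : probability T R) X
    d' (T' : measurableType d') (P' : probability T' R) X' :
  brownian_excursion P X -> brownian_excursion P' X' -> same_law unitI P X P' X'.
Proof.
move=> [_ _ [e [U [Q [W [BW XW]]]]]] [_ _ [e' [U' [Q' [W' [BW' XW']]]]]] E cE.
by rewrite XW// XW'//; exact: rescaled_excursion_law.
Qed.

Lemma grid_modulus_cylinder (r : R) : cylinder_algebra unitI [set x : R -> R | grid_modulus r x].
Proof.
apply: (@measurable_grid_modulus R _ (g_sigma_algebraType [set E | exists i (B : set R),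
  [/\ unitI i, measurable B & E = [set x : R -> R | B (x i)]]]) (fun t x => x t) unitI).
  by move=> n i; exact: unitI_gridpoint.
move=> s us _ B mB; rewrite setTI; apply: sub_sigma_algebra.
by exists s, B.
Qed.

(** An excursion is known only through its law. The modulus transfers because on the grid it is a
    cylinder event, at the price of a slightly larger rate. *)
Lemma excursion_modulus_ae d (T : measurableType d) (P : probability T R) X :
  brownian_excursion P X ->
  {ae P, forall w, grid_modulus ((1 + brownian_rate) / 2) (X^~ w)}.
Proof.
move=> [mX _ [e [U [Q [W [BW XW]]]]]].
set r := (1 + brownian_rate) / 2.
have cE := grid_modulus_cylinder r.
have [b0 b1] := @brownian_rate_itv R.
have br : brownian_rate < r by rewrite /r; lra.
have aeW : {ae Q, forall w, grid_modulus r (rescaled_excursion (W^~ w))}.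
  apply: filterS (brownian_excursion_modulus_ae BW) => w.
  exact: modulus_grid.
have cEc : cylinder_algebra unitI (~` [set x : R -> R | grid_modulus r x]).
  by rewrite -setTD; exact: sigma_algebraCD.
exists (path_event X (~` [set x : R -> R | grid_modulus r x])); split => //.
  exact: (measurable_path_event mX cEc).
rewrite XW//; apply: measure_negligible => //.
apply: (@measurable_path_event _ _ unitI _ _ (fun t w => rescaled_excursion (W^~ w) t)) cEc.
by move=> t; exact: (measurable_brownian_excursion BW).
Qed.

End excursion_law.

(** * Existence of Brownian motion *)

Section brownian_motion_existence.
Context {R : realType}.

(** Slope 2 up to 1/2, so that on the first half the minimum over [s, t] is 2 min(s, t) and l_(u /
    2) has the covariance of Brownian motion in u; the descent brings the lifetime into [Cplus]. *)
Definition tent (x : R) : R := 1 - `|2 * x - 1|.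

Lemma tent_dist x y : `|tent x - tent y| <= 2 * `|x - y|.
Proof.
have -> : tent x - tent y = `|2 * y - 1| - `|2 * x - 1| by rewrite /tent; ring.
apply: le_trans (ler_dist_dist _ _) _.
rewrite (_ : 2 * y - 1 - (2 * x - 1) = - (2 * (x - y))); last by ring.
by rewrite normrN normrM ger0_norm.
Qed.

Lemma tent_modulus : modulus (2^-1) tent.
Proof.
exists 2, 0%N => n _ s t _ _ st; apply: le_trans (tent_dist s t) _.
by rewrite ler_pM2l.
Qed.

Lemma tent_Cplus : Cplus tent.
Proof.
split; last first.
  move=> x /unitIP/andP[x0 x1]; rewrite /tent subr_ge0 ler_norml; apply/andP; split; lra.
split; rewrite /tent.
- apply: (modulus_continuous _ _ tent_modulus); first by rewrite invr_gt0.
  by rewrite invf_lt1// ltr1n.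
- by rewrite mulr0 sub0r normrN normr1 subrr.
- by rewrite mulr1 (_ : 2 - 1 = 1 :> R) ?normr1 ?subrr//; ring.
Qed.

Lemma minseg_tent s t : 0 <= s <= 2^-1 -> 0 <= t <= 2^-1 ->
  minseg tent s t = 2 * Num.min s t.
Proof.
have E (x : R) : 0 <= x <= 2^-1 -> tent x = 2 * x.
  move=> /andP[x0 x1]; rewrite /tent ler0_norm; first by ring.
  by rewrite subr_le0 -ler_pdivlMl// mulr1.
have h1 : 2^-1 <= 1 :> R by rewrite invf_le1// ler1n.
have U (x : R) : 0 <= x <= 2^-1 -> unitI x.
  by move=> /andP[x0 x1]; apply/unitIP; rewrite x0 (le_trans x1).
move=> hs ht; have [_ p] := tent_Cplus.
apply/eqP; rewrite eq_le; apply/andP; split.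
  have := minseg_lel p (U s hs) (U t ht); have := minseg_ler p (U s hs) (U t ht).
  by rewrite !E//; case: (leP s t).
apply: le_minseg => x /andP[mx xm]; rewrite E ?ler_pM2l//.
move: hs ht => /andP[s0 s1] /andP[t0 t1]; apply/andP; split.
  by apply: le_trans mx; rewrite le_min s0.
by apply: le_trans xm _; rewrite ge_max s1.
Qed.

Let Q := @bit_measure R.
Let g (t : R) (_ : @bit_sequence) : R := tent t.
(** Any rate strictly between 1/2, that of the tent, and 1 would do. *)
Let l := snake_label g (3 / 4).

Let tau (t : R) : R := `|t| / (2 * (1 + `|t|)).

Let tau_itv t : 0 <= tau t <= 2^-1.
Proof.
have t1 : 0 < 1 + `|t| by rewrite ltr_pwDl.
rewrite /tau divr_ge0// ?mulr_ge0 ?(ltW t1)//= ler_pdivrMr ?mulr_gt0// mulrA.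
by rewrite mulVf// mul1r lerDr.
Qed.

Let unit_tau t : unitI (tau t).
Proof.
have /andP[h0 h1] := tau_itv t; apply/unitIP; rewrite h0 (le_trans h1)//.
by rewrite invf_le1// ler1n.
Qed.

Let unit_half : unitI (2^-1 : R).
Proof. by apply/unitIP; rewrite invr_ge0 ler0n invf_le1// ler1n. Qed.

(* Time inversion turns a Brownian motion on [0, 1] into one on the half line:
   W_t = (1 + t) B_(t / (1 + t)) - t B_1, with B_u = l_(u / 2). *)
Definition brownian_path (t : R) p : R :=
  (1 + `|t|) * l (tau t) p - `|t| * l (2^-1) p.

Let mg t : unitI t -> measurable_fun setT (g t).
Proof. by move=> _; exact: measurable_cst. Qed.

Let gC w : Cplus (g^~ w). Proof. exact: tent_Cplus. Qed.

Let gm : {ae Q, forall w, grid_modulus (3 / 4) (g^~ w)}.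
Proof.
apply: aeW => w; apply: modulus_grid tent_modulus; first by rewrite invr_gt0.
by rewrite ltr_pdivlMr//; lra.
Qed.

Let q0 : 0 < 3 / 4 :> R. Proof. by lra. Qed.
Let q1 : 3 / 4 < 1 :> R. Proof. by lra. Qed.

Lemma brownian_motion_exists : brownian_motion (Q \x Q)%E brownian_path.
Proof.
have lS p : snake (g^~ p.1) (l^~ p) by exact: snake_label_snake.
have ml s : unitI s -> measurable_fun setT (l s) by exact: measurable_snake_label.
split; last 2 first.
- move=> p; have [_ [_ l0 _] _] := lS p.
  by rewrite /brownian_path /tau normr0 mul0r l0 !(mulr0, mul0r) subrr.
- move=> p; apply: continuous_subspaceT => t.
  have [_ [cl _ _] _] := lS p.
  have cn : `|x| @[x --> t] --> `|t| by exact: norm_continuous.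
  have t1 : 2 * (1 + `|t|) != 0 by rewrite mulf_neq0// gt_eqF// ltr_pwDl.
  have ctau : tau x @[x --> t] --> tau t.
    apply: cvgM => //; apply: cvgV => //; apply: cvgM; first exact: cvg_cst.
    by apply: cvgD => //; exact: cvg_cst.
  apply: cvgB; last by apply: cvgM => //; exact: cvg_cst.
  apply: cvgM; first by apply: cvgD => //; exact: cvg_cst.
  have cc := clamp_continuous cl.
  rewrite (_ : (fun x => l (tau x) p) = (l^~ p \o clamp) \o tau); last first.
    by apply/funext => x /=; rewrite clamp_id.
  rewrite -[X in _ --> l X p](clamp_id (unit_tau t)).
  exact: (@cvg_comp _ _ _ tau (l^~ p \o clamp) _ _ _ ctau (cc (tau t))).
split=> [t _|n c t B Dt mB].
  by apply: measurable_funB; apply: measurable_funM => //; try exact: ml; exact: measurable_cst.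
have t0 k : 0 <= t k by have := Dt k; rewrite /= in_itv/= andbT.
(* The coefficient of B_1 = l_(1/2), collected from all the times. *)
pose a := - \sum_(k < n) c k * t k.
pose c' k := c k * (1 + t k).
have -> : lincomb brownian_path c t = lincomb l
    (fun k : 'I_n.+1 => oapp c' a (unlift ord0 k))
    (fun k => oapp (tau \o t) (2^-1) (unlift ord0 k)).
  apply/funext => p; rewrite /lincomb big_ord_recl unlift_none/=.
  under [in RHS]eq_bigr do rewrite liftK/=.
  rewrite /a mulNr mulr_suml addrC -sumrB; apply: eq_bigr => k _.
  by rewrite /brownian_path ger0_norm// /c'; ring.
rewrite -[_ @^-1` B]setTI -(preimage_setT (@fst (@bit_sequence) (@bit_sequence))).
have ut (k : 'I_n.+1) : unitI (oapp (tau \o t) (2^-1) (unlift ord0 k)).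
  by case: (unlift ord0 k) => [j|]; [exact: unit_tau|exact: unit_half].
apply: etrans (@snake_label_law R _ _ Q g _ mg gC q0 q1 gm n.+1
  (fun k : 'I_n.+1 => oapp c' a (unlift ord0 k))
  (fun k => oapp (tau \o t) (2^-1) (unlift ord0 k)) B setT ut mB measurableT) _.
set v := lincomb_var (minseg tent) (fun k : 'I_n.+1 => oapp c' a (unlift ord0 k))
  (fun k => oapp (tau \o t) (2^-1) (unlift ord0 k)).
apply: etrans (integral_cst Q measurableT (centered_normal v B)) _; apply: etrans (_ : _ = _ * 1)%E _.
  by congr (_ * _)%E; exact: probability_setT.
rewrite mule1 /v {v}.
congr centered_normal; rewrite lincomb_var_cons; last by move=> i j; exact: minsegC.
have tE k : tau (t k) = t k / (2 * (1 + t k)) by rewrite /tau ger0_norm.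
have n1 k : 1 + t k != 0 by rewrite gt_eqF// ltr_pwDl.
have K1 : minseg tent 2^-1 2^-1 = 1.
  by rewrite minseg_tent ?minxx ?divff// lexx invr_ge0 ler0n.
have K2 k : minseg tent (tau (t k)) 2^-1 = t k / (1 + t k).
  have /andP[h0 h1] := tau_itv (t k).
  by rewrite minseg_tent ?min_l// ?lexx ?invr_ge0 ?ler0n ?tau_itv// tE; field.
have K3 k m : (1 + t k) * (1 + t m) * minseg tent (tau (t k)) (tau (t m)) =
    Num.min (t k) (t m) + t k * t m.
  rewrite minseg_tent ?tau_itv// !tE.
  have p k' : 0 < 1 + t k' by rewrite ltr_pwDl.
  rewrite mulrA minr_pMr ?mulr_ge0 ?(ltW (p _))//.
  rewrite (_ : _ * (t k / _) = t k + t k * t m); last by field.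
  rewrite (_ : _ * (t m / _) = t m + t k * t m); last by field.
  by rewrite addr_minl.
rewrite K1 mulr1.
under eq_bigr do rewrite K2 /c' -mulrA (mulrC (1 + _)) divfK//.
rewrite -[X in _ * X](opprK (\sum_(k < n) c k * t k)) -/a.
(* The excess terms t_k t_m sum to a^2; with a^2 from the variance of B_1 and -2 a^2 from the cross
   term they cancel. *)
have -> : lincomb_var (minseg tent) c' (tau \o t) =
    lincomb_var (fun s t => Num.min s t) c t + a ^+ 2.
  rewrite /lincomb_var /a sqrrN expr2 mulr_suml -big_split/=; apply: eq_bigr => k _.
  rewrite mulr_sumr -big_split/=; apply: eq_bigr => m _.
  have -> : c' k * c' m * minseg tent (tau (t k)) (tau (t m)) = c k * c m *
    ((1 + t k) * (1 + t m) * minseg tent (tau (t k)) (tau (t m))) by rewrite /c'; ring.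
  by rewrite K3; ring.
by ring.
Qed.

Lemma brownian_excursion_exists :
  brownian_excursion (Q \x Q)%E (fun t w => rescaled_excursion (brownian_path^~ w) t).
Proof.
have BW := brownian_motion_exists.
have [[mW gW] W0 cW] := BW.
have e (w : bit_sequence * bit_sequence) x : unitI x ->
    rescaled_excursion (brownian_path^~ w) x = rescaled_excursion (brownian_path^~ w \o pos_part) x.
  by move=> /unitIP ux; rewrite rescaled_excursion_pos_part.
pose F t w := brownian_path (pos_part t) w.
have cF w : continuous (F^~ w) by exact: (pos_part_continuous (cW w)).
have F0 w : F 0 w = 0 by rewrite /F pos_part_id.
split.
- by move=> t ut; exact: (measurable_brownian_excursion BW).
- move=> w; have [[c0 f0 f1] p] := rescaled_excursion_Cplus (@cF) F0 w.
  have u0 : unitI (0 : R) by apply/unitIP; rewrite lexx ler01.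
  have u1 : unitI (1 : R) by apply/unitIP; rewrite lexx ler01.
  split; last by move=> x ux; rewrite e//; exact: p.
  split; rewrite ?e//.
  by apply: eq_within_unit c0 => x ux; rewrite e.
- by exists _, _, (Q \x Q)%E, brownian_path; split.
Qed.

End brownian_motion_existence.

(** * Iterated snakes *)

Section lifetime_regularity.
Context {R : realType} d (T : measurableType d) (P : probability T R).
Implicit Types (h l : nat -> R -> T -> R).

(* The part of [snake_recursion P h l j] that determines [h j], before [l j] is chosen. *)
Definition lifetime_recursion h l (j : nat) : Prop :=
  [/\ brownian_excursion P (h 1%N),
      forall i, (0 < i < j)%N -> label_process P h l i,
      forall i, (0 < i < j)%N -> forall w, C0 (l i ^~ w) &
      forall i, (1 < i <= j)%N -> forall w t, unitI t -> h i t w = Conj (l i.-1 ^~ w) t].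

Lemma snake_lifetime_recursion h l j : snake_recursion P h l j -> lifetime_recursion h l j.
Proof.
case=> eh lp Cl hC; split => // i /andP[i0 ij]; apply: lp.
by rewrite i0 ltnW.
Qed.

Lemma lifetime_recursionW h l i j : (i <= j)%N ->
  lifetime_recursion h l j -> lifetime_recursion h l i.
Proof.
move=> ij [eh lp Cl hC]; split => // k.
- by move=> /andP[k0 ki]; apply: lp; rewrite k0 (leq_trans ki).
- by move=> /andP[k0 ki]; apply: Cl; rewrite k0 (leq_trans ki).
- by move=> /andP[k0 ki]; apply: hC; rewrite k0 (leq_trans ki).
Qed.

Lemma eq_Cplus (f g : R -> R) : (forall x, unitI x -> f x = g x) -> Cplus f -> Cplus g.
Proof.
move=> fg [[cf f0 f1] p]; have u0 : unitI (0 : R) by apply/unitIP; rewrite lexx ler01.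
have u1 : unitI (1 : R) by apply/unitIP; rewrite lexx ler01.
split; last by move=> x ux; rewrite -fg//; exact: p.
by split; rewrite -?fg//; exact: eq_within_unit cf.
Qed.

Lemma lifetime_Cplus h l j w : (0 < j)%N -> lifetime_recursion h l j -> Cplus (h j ^~ w).
Proof.
move=> j0 [[_ Ch _] _ Cl hC]; have [->|j1] := eqVneq j 1%N; first exact: Ch.
apply: (@eq_Cplus (Conj (l j.-1 ^~ w))); last by apply/Conj_Cplus/Cl; lia.
by move=> x ux; rewrite hC//; lia.
Qed.

Lemma measurable_lifetime h l j t : (0 < j)%N -> unitI t -> lifetime_recursion h l j ->
  measurable_fun setT (h j t).
Proof.
move=> j0 ut [[mh _ _] lp Cl hC]; have [->|j1] := eqVneq j 1%N; first exact: mh.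
have : measurable_fun setT (fun w => Conj (l j.-1 ^~ w) t).
  apply: measurable_Conj => // [s us|w]; last by apply: Cl; lia.
  by have [m _] := lp j.-1 ltac:(lia); exact: m.
by apply: eq_measurable_fun => w _; rewrite hC//; lia.
Qed.

Lemma measurable_tours h l j a b : lifetime_recursion h l j -> (a <= j)%N -> (b < j)%N ->
  forall k, stages a b k -> measurable_fun setT (tours h l k).
Proof.
move=> rh aj bj [[i t]|[i t]] [/andP[i0 ij] ut] /=.
  by apply: (@measurable_lifetime h l) => //; apply: lifetime_recursionW rh; lia.
by have [_ lp _ _] := rh; have [m _] := lp i ltac:(lia); exact: m.
Qed.

Section one_stage.
Variables (h l : nat -> R -> T -> R) (j : nat).
Hypotheses (j0 : (0 < j)%N) (rh : lifetime_recursion h l j) (lj : label_process P h l j).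

Let G : set (set T) := [set A | exists2 E, cylinder_algebra (stages j j.-1) E &
  A = path_event (tours h l) E].

Let mh t : unitI t -> measurable_fun setT (h j t).
Proof. by move=> ut; exact: measurable_lifetime rh. Qed.

Let Ch w : Cplus (h j ^~ w). Proof. exact: lifetime_Cplus rh. Qed.

Let C0h w : C0 (h j ^~ w). Proof. by have [] := Ch w. Qed.

Let mt k : stages j j.-1 k -> measurable_fun setT (tours h l k).
Proof. by apply: (measurable_tours rh (leqnn j)); lia. Qed.

Let GM : G `<=` measurable.
Proof. by move=> _ [E cE ->]; exact: (measurable_path_event mt cE). Qed.

Let GT : G setT. Proof. by exists setT => //; exact: cylinderT. Qed.

Let Gg (s t r : R) : unitI s -> unitI t -> G [set w | tree_dist (h j ^~ w) s t <= r].
Proof.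
move=> us ut; suff : <<s coordinate_sets (stages j j.-1) (tours h l) >>
    [set w | tree_dist (h j ^~ w) s t <= r] by move=> /sigma_path_event[E cE ->]; exists E.
(* The tree distance is measured again on [T] equipped only with the sigma-algebra of the past,
   which contains the lifetime [h j]. *)
pose U := g_sigma_algebraType (coordinate_sets (stages j j.-1) (tours h l)).
have mhU u : unitI u -> measurable_fun setT (h j u : U -> R).
  move=> uu; apply: (@measurable_coordinate R _ (stages j j.-1) T (tours h l) (inl (j, u))).
  by rewrite /= j0 leqnn.
have := @measurable_tree_dist _ U R (h j) mhU C0h s t us ut.
by move=> m; apply: (@measurable_le_fun _ U R) => //; exact: measurable_cst.
Qed.

Let GX : cond_gaussian_on P G unitI (l j) (fun w => minseg (h j ^~ w)).
Proof.
have [ml law] := lj; split => // n c t B A ut mB [E cE ->].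
exact: law.
Qed.

Let mtd s t : unitI s -> unitI t ->
  measurable_fun setT (fun w => tree_dist (h j ^~ w) s t).
Proof. exact: measurable_tree_dist. Qed.

Variable rho : R.
Hypotheses (rho0 : 0 < rho) (rho1 : rho < 1).
Hypothesis gm : {ae P, forall w, grid_modulus rho (h j ^~ w)}.

Lemma label_grid_modulus_ae : {ae P, forall w, grid_modulus (theta_of rho) (l j ^~ w)}.
Proof.
have := good_path_ae (fun x (ux : unitI x) => ux) (fun n i => @unitI_gridpoint R n i)
  lj.1 rho0 rho1 mtd Ch GM GT Gg GX gm.
by apply: filterS => w gw; exact: (good_grid_modulus rho0 rho1 Ch gw).
Qed.

Lemma label_continuous_version : exists l' : R -> T -> R,
  is_version P unitI (l j) l' /\ forall w, snake (h j ^~ w) (l' ^~ w).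
Proof.
exists (label_extension (l j) (h j) rho); split; last exact: label_extension_snake.
move=> s us; split.
  apply: (measurable_label_extension (D := unitI)) => //; last exact: lj.1.
  by move=> n i; exact: unitI_gridpoint.
apply: (label_extension_version (D := unitI) _ _ lj.1 rho0 rho1 mtd Ch GM GT Gg GX gm) => //.
by move=> n i; exact: unitI_gridpoint.
Qed.

End one_stage.

(** One stage sends rho to [theta_of rho]. Conjugation keeps that rate but not the constant, so the
    midpoint to 1 is taken to return to a grid modulus. Continuity of the chosen labels turns their
    dyadic bounds into a modulus at all times. *)
Lemma lifetime_grid_modulus_ae h l j : (0 < j)%N -> lifetime_recursion h l j ->
  exists rho : R, [/\ 0 < rho, rho < 1 & {ae P, forall w, grid_modulus rho (h j ^~ w)}].
Proof.
elim: j => // -[|j] IH _ rh.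
  have [eh _ _ _] := rh; exists ((1 + brownian_rate) / 2).
  by have [b0 b1] := @brownian_rate_itv R; split; [lra|lra|exact: excursion_modulus_ae].
have rj : lifetime_recursion h l j.+1 by apply: lifetime_recursionW rh.
have [rho [rho0 rho1 gm]] := IH isT rj.
have [_ lp Cl hC] := rh.
have [_ _ _ t0 t1] := sigma_theta rho0 rho1; set th := theta_of rho in t0 t1.
have lj : label_process P h l j.+1 by apply: lp; lia.
exists ((1 + th) / 2); split; [lra|lra|].
apply: filterS (label_grid_modulus_ae (ltn0Sn j) rj lj rho0 rho1 gm) => w gl.
have Clw : C0 (l j.+1 ^~ w) by apply: Cl; lia.
have [cl _ _] := Clw.
have ml := grid_modulus_continuous t0 t1 cl gl.
have [|N NP] := @modulus_grid R th ((1 + th) / 2) _ t0 _ (Conj_modulus Clw ml); first by lra.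
exists N => n Nn i i2; rewrite !hC ?ltnS//=; try by apply: unitI_gridpoint; lia.
exact: NP.
Qed.

Theorem label_version h l j : (0 < j)%N -> snake_recursion P h l j ->
  exists l' : R -> T -> R, is_version P unitI (l j) l' /\ forall w, C0 (l' ^~ w).
Proof.
move=> j0 sr; have rh := snake_lifetime_recursion sr.
have [_ lp _ _] := sr; have lj : label_process P h l j by apply: lp; rewrite j0 leqnn.
have [rho [rho0 rho1 gm]] := lifetime_grid_modulus_ae j0 rh.
have [l' [vl sl]] := label_continuous_version j0 rh lj rho0 rho1 gm.
by exists l'; split => // w; have [] := sl w.
Qed.

End lifetime_regularity.

(** * Uniqueness in law *)

Section uniqueness.
Context {R : realType} d (T : measurableType d) (P : probability T R)
  d' (T' : measurableType d') (P' : probability T' R).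
Variables (h l : nat -> R -> T -> R) (h' l' : nat -> R -> T' -> R).

Local Notation same a b := (same_law (stages a b) P (tours h l) P' (tours h' l')).

Let H (i : nat) (t : R) (z : bool * T * T') : R := join (tours h l) (tours h' l') (inl (i, t)) z.
Let L (i : nat) (t : R) (z : bool * T * T') : R := join (tours h l) (tours h' l') (inr (i, t)) z.

Lemma same_law_first_stage : brownian_excursion P (h 1%N) -> brownian_excursion P' (h' 1%N) ->
  same 1 0.
Proof.
move=> eh eh'; apply: (functional_law (brownian_excursion_law eh eh')).
move=> [[i t]|[i t]] /= [/andP[i0 i1] ut]; last by lia.
have -> : i = 1%N by lia.
have := @measurable_coordinate R R unitI _ (join (h 1%N) (h' 1%N)) t ut.
by apply: eq_measurable_fun => z _; move: z => [[[] w] w'].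
Qed.

Lemma same_law_next_lifetime j : (0 < j)%N ->
  (forall w, C0 (l j ^~ w)) -> (forall w, C0 (l' j ^~ w)) ->
  (forall w t, unitI t -> h j.+1 t w = Conj (l j ^~ w) t) ->
  (forall w t, unitI t -> h' j.+1 t w = Conj (l' j ^~ w) t) ->
  same j j -> same j.+1 j.
Proof.
move=> j0 Cl Cl' hC hC' S; apply: (functional_law S) => k sk.
have [sk'|nk] := pselect (stages j j k); first exact: measurable_coordinate.
case: k sk nk => [[i t]|[i t]] /= [/andP[i0 ij] ut] nk; last by case: nk; rewrite i0 ij.
have -> : i = j.+1.
  by apply/eqP; rewrite eqn_leq ij ltnNge; apply/negP => ji; apply: nk; rewrite i0 ji.
pose U := joint_space (stages j j) (tours h l) (tours h' l').
have mL s : unitI s -> measurable_fun setT (L j s : U -> R).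
  move=> us; apply: measurable_coordinate; split => //.
  by rewrite j0 leqnn.
have CL z : C0 (L j ^~ z).
  by move: z => [[[] w] w']; [exact: Cl|exact: Cl'].
have := @measurable_Conj _ U R (L j) mL CL t ut.
apply: eq_measurable_fun => z _.
by move: z => [[[] w] w'] /=; rewrite /join/= ?hC ?hC'.
Qed.

(** For an event of the past and a linear combination of the new label, the joint probability is the
    integral of one functional of the past, so [functional_integral] applies; [same_law_union] joins
    past and label. *)
Lemma same_law_next_label j : (0 < j)%N ->
  lifetime_recursion P h l j -> lifetime_recursion P' h' l' j ->
  label_process P h l j -> label_process P' h' l' j ->
  same j j.-1 -> same j j.
Proof.
move=> j0 rh rh' lj lj' S.
pose C2 : set ((nat * R) + (nat * R)) :=
  [set k | if k is inr (i, t) then i = j /\ unitI t else False].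
have -> : stages j j = stages j j.-1 `|` C2.
  apply/seteqP; split => -[[i t]|[i t]] /=.
  - by left.
  - move=> [/andP[i0 ij] ut]; have [->|nij] := eqVneq i j; first by right.
    by left; split => //; rewrite i0/=; move: ij nij; lia.
  - by case.
  - by case=> [[/andP[i0 ij] ut]|[-> ut]]; split => //; lia.
have mt k : stages j j.-1 k -> measurable_fun setT (tours h l k).
  by apply: (measurable_tours rh (leqnn j)); lia.
have mt' k : stages j j.-1 k -> measurable_fun setT (tours h' l' k).
  by apply: (measurable_tours rh' (leqnn j)); lia.
have m2 k : C2 k -> measurable_fun setT (tours h l k).
  by case: k => [//|[i t]] /= [-> ut]; exact: lj.1.
have m2' k : C2 k -> measurable_fun setT (tours h' l' k).
  by case: k => [//|[i t]] /= [-> ut]; exact: lj'.1.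
apply: same_law_union => [k|k|E1 E2 c1 c2]; first by case; [exact: mt|exact: m2].
  by case; [exact: mt'|exact: m2'].
have mA := measurable_path_event mt c1; have mA' := measurable_path_event mt' c1.
apply: (@law_from_lincomb R _ C2 _ _ P _ mA _ _ P' _ mA' (tours h l) (tours h' l') m2 m2' _ E2 c2).
move=> n c k B Ck mB.
(* Every index in [C2] has the form inr (j, s); its time s is read off here. *)
pose t m : R := if k m is inr q then q.2 else 0.
have kE m : k m = inr (j, t m).
  by rewrite /t; have := Ck m; case: (k m) => [//|[i s]] /= [-> _].
have ut m : unitI (t m).
  by rewrite /t; have := Ck m; case: (k m) => [//|[i s]] /= [].
have -> : lincomb (tours h l) c k = lincomb (l j) c t.
  by apply/funext => w; apply: eq_bigr => m _; rewrite kE.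
have -> : lincomb (tours h' l') c k = lincomb (l' j) c t.
  by apply/funext => w; apply: eq_bigr => m _; rewrite kE.
rewrite lj.2// lj'.2//.
pose U := joint_space (stages j j.-1) (tours h l) (tours h' l').
have mH s : unitI s -> measurable_fun setT (H j s : U -> R).
  move=> us; apply: measurable_coordinate; split => //.
  by rewrite j0 leqnn.
have CH z : Cplus (H j ^~ z).
  by move: z => [[[] w] w']; [exact: (lifetime_Cplus w j0 rh)|exact: (lifetime_Cplus w' j0 rh')].
apply: (functional_integral mt mt' S c1).
- have m := @measurable_lincomb_var R _ U (H j) mH CH n c t ut.
  have : measurable_fun setT (fun z : U => centered_normal (lincomb_var (minseg (H j ^~ z)) c t) B).
    apply: measurable_centered_normal => // z; apply: lincomb_var_minseg_ge0 => //.
    by have [_] := CH z.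
  by apply: eq_measurable_fun => z _; move: z => [[[] w] w'].
- by move=> w; exact: centered_normal_ge0.
- by move=> w; exact: centered_normal_ge0.
Qed.

Theorem brownian_snakes_law D : (0 < D)%N ->
  brownian_snakes P h l D -> brownian_snakes P' h' l' D -> same D D.
Proof.
move=> D0 [sr sn] [sr' sn'].
suff S j : (0 < j <= D)%N -> same j j by apply: S; rewrite D0 leqnn.
have rh := snake_lifetime_recursion sr; have rh' := snake_lifetime_recursion sr'.
have [eh lp Cl hC] := sr; have [eh' lp' Cl' hC'] := sr'.
elim: j => // j IH jD; apply: same_law_next_label => //.
- by apply: lifetime_recursionW rh; lia.
- by apply: lifetime_recursionW rh'; lia.
- by apply: lp; lia.
- by apply: lp'; lia.
case: j IH jD => [|j] IH jD; first exact: same_law_first_stage.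
apply: same_law_next_lifetime => //=.
- by apply: Cl; lia.
- by apply: Cl'; lia.
- by move=> w t ut; rewrite hC//; lia.
- by move=> w t ut; rewrite hC'//; lia.
- by apply: IH; lia.
Qed.

End uniqueness.

(** * Existence of the iterated snakes *)

Section existence.
Context {R : realType}.

(** Used because the processes on an enlarged space agree with the old ones only at the stages
    already built. *)
Lemma cylinder_ext (J : Type) (C : set J) (E : set (J -> R)) (x y : J -> R) :
  cylinder_algebra C E -> (forall j, C j -> x j = y j) -> E x -> E y.
Proof.
move=> cE xy; suff : E x <-> E y by case.
move: E cE; suff : cylinder_algebra C `<=` [set E | E x <-> E y] by exact.
apply: smallest_sub; last by move=> _ [j [B [Cj mB ->]]] /=; rewrite xy.
split=> //= [A [Axy Ayx]|F Fxy].
  by split=> -[_ nA]; split => // ?; apply: nA; [exact: Ayx|exact: Axy].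
by split=> -[n _ Fn]; exists n => //; have [f1 f2] := Fxy n; [exact: f1|exact: f2].
Qed.

Lemma brownian_excursion_fst d (T : measurableType d) (P : probability T R)
    d' (U : measurableType d') (Q : probability U R) (X : R -> T -> R) :
  brownian_excursion P X -> brownian_excursion (P \x Q)%E (fun t p => X t p.1).
Proof.
move=> [mX CX [e [V [M [W [BW XW]]]]]]; split.
- by move=> t ut; exact: (measurableT_comp (mX t ut) measurable_fst).
- by move=> p; exact: CX.
- exists e, V, M, W; split => // E cE; rewrite -XW//.
  apply: etrans (product_fst P Q (measurable_path_event mX cE)) _.
  by [].
Qed.

Lemma cond_gaussian_fst d (T : measurableType d) (P : probability T R)
    d' (U : measurableType d') (Q : probability U R)
    (J : Type) (C : set J) (Y : J -> T -> R) (Y' : J -> T * U -> R)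
    (h l : R -> T -> R) :
  (forall j, C j -> measurable_fun setT (Y j)) ->
  (forall j, C j -> forall p, Y' j p = Y j p.1) ->
  (forall t, unitI t -> measurable_fun setT (h t)) -> (forall w, Cplus (h ^~ w)) ->
  cond_gaussian_process P C Y unitI l (fun w => minseg (h ^~ w)) ->
  cond_gaussian_process (P \x Q)%E C Y' unitI (fun t p => l t p.1) (fun p => minseg (h ^~ p.1)).
Proof.
move=> mY YY mh Ch [ml law]; split.
  by move=> t ut; exact: (measurableT_comp (ml t ut) measurable_fst).
move=> n c t B E ut mB cE.
have -> : path_event Y' E = fst @^-1` path_event Y E.
  by apply/seteqP; split => p; apply: (cylinder_ext cE) => j Cj; rewrite YY.
have mA := measurable_path_event mY cE.
transitivity ((P \x Q)%E (fst @^-1` (path_event Y E `&` lincomb l c t @^-1` B))) => //.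
apply: etrans (product_fst P Q _) _.
  by apply: measurableI => //; apply: preimage_measurable => //; exact: (measurable_lincomb ml).
rewrite law//; apply/esym.
apply: (@integral_fst _ _ _ _ _ P Q _ (fun w => centered_normal (lincomb_var (minseg (h ^~ w)) c t) B)) => //.
  apply: measurable_centered_normal => //; first exact: measurable_lincomb_var.
  by move=> w; apply: lincomb_var_minseg_ge0 => //; have [] := Ch w.
by move=> w; exact: centered_normal_ge0.
Qed.

(** Stages already built are lifted along the first projection, which keeps their joint law; the
    fresh bits yield the label [j] by [snake_label], and its conjugate is the lifetime [j.+1]. *)
Lemma lifetime_recursion_extend d (T : measurableType d) (P : probability T R) h l j :
  (0 < j)%N -> lifetime_recursion P h l j ->
  (forall i, (0 < i < j)%N -> forall w, snake (h i ^~ w) (l i ^~ w)) ->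
  exists (d' : measure_display) (T' : measurableType d') (P' : probability T' R)
    (h' l' : nat -> R -> T' -> R), lifetime_recursion P' h' l' j.+1 /\
    forall i, (0 < i < j.+1)%N -> forall w, snake (h' i ^~ w) (l' i ^~ w).
Proof.
move=> j0 rh sn; have [rho [rho0 rho1 gm]] := lifetime_grid_modulus_ae j0 rh.
have mh i t : (0 < i <= j)%N -> unitI t -> measurable_fun setT (h i t).
  by move=> /andP[i0 ij] ut; apply: measurable_lifetime ut (lifetime_recursionW ij rh).
have Ch i w : (0 < i <= j)%N -> Cplus (h i ^~ w).
  by move=> /andP[i0 ij]; exact: lifetime_Cplus (lifetime_recursionW ij rh).
have jj : (0 < j <= j)%N by rewrite j0 leqnn.
pose lj := snake_label (h j) rho.
pose l' i : R -> T * bit_sequence -> R := if i == j then lj else fun t p => l i t p.1.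
pose h' i : R -> T * bit_sequence -> R :=
  if i == j.+1 then fun t p => Conj (lj ^~ p) t else fun t p => h i t p.1.
have h'E i : (i <= j)%N -> h' i = fun t p => h i t p.1.
  by move=> ij; rewrite /h' ltn_eqF.
have l'E i : (i < j)%N -> l' i = fun t p => l i t p.1.
  by move=> ij; rewrite /l' ltn_eqF.
have l'j : l' j = lj by rewrite /l' eqxx.
have [eh lp Cl hC] := rh.
have sj p : snake (h j ^~ p.1) (lj ^~ p).
  by apply: snake_label_snake => // w; exact: Ch.
have tE i k : (0 < i <= j)%N -> stages i i.-1 k -> forall p, tours h' l' k p = tours h l k p.1.
  move=> /andP[i0 ij]; case: k => [[a t]|[a t]] /= [/andP[a0 ai] ut] p.
    by rewrite h'E//; lia.
  by rewrite l'E//; lia.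
have mt i k : (0 < i <= j)%N -> stages i i.-1 k -> measurable_fun setT (tours h l k).
  by move=> /andP[i0 ij]; apply: (measurable_tours rh); lia.
exists _, _, (P \x @bit_measure R)%E, h', l'; split; [split|].
- by rewrite h'E//; exact: brownian_excursion_fst.
- move=> i /andP[i0]; rewrite ltnS leq_eqVlt => /orP[/eqP ->|ij]; last first.
    rewrite /label_process l'E// h'E; last exact: ltnW.
    have iij : (0 < i <= j)%N by rewrite i0 ltnW.
    apply: (cond_gaussian_fst _ (Y := tours h l)).
    + by move=> k; exact: mt.
    + by move=> k; exact: tE.
    + by move=> t; exact: mh.
    + by move=> w; exact: Ch.
    + by apply: lp; rewrite i0.
  rewrite /label_process l'j h'E//; split.
    by move=> t ut; apply: measurable_snake_label => // [s us|w]; [exact: mh|exact: Ch].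
  move=> n c t B E ut mB cE.
  have -> : path_event (tours h' l') E = fst @^-1` path_event (tours h l) E.
    apply/seteqP; split => p; apply: (cylinder_ext cE) => k sk.
      by rewrite (tE j).
    by rewrite (tE j).
  have mA : measurable (path_event (tours h l) E).
    by apply: (measurable_path_event _ cE) => k; exact: mt.
  apply: etrans (snake_label_law _ _ rho0 rho1 gm c ut mB mA) _.
  + by move=> s us; exact: mh.
  + by move=> w; exact: Ch.
  apply/esym.
  apply: (@integral_fst _ _ _ _ _ P (@bit_measure R) _
    (fun w => centered_normal (lincomb_var (minseg (h j ^~ w)) c t) B)) => //.
    apply: measurable_centered_normal => //.
      by apply: measurable_lincomb_var => // [s us|w]; [exact: mh|exact: Ch].
    by move=> w; apply: lincomb_var_minseg_ge0 => //; have [] := Ch j w jj.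
  by move=> w; exact: centered_normal_ge0.
- move=> i /andP[i0]; rewrite ltnS leq_eqVlt => /orP[/eqP ->|ij] p.
    by rewrite l'j; have [] := sj p.
  by rewrite l'E//; apply: Cl; rewrite i0.
- move=> i /andP[i1]; rewrite leq_eqVlt => /orP[/eqP ->|ij] p t ut.
    by rewrite /h' eqxx /= l'j.
  by rewrite h'E// l'E; [rewrite hC// i1|lia].
- move=> i /andP[i0]; rewrite ltnS leq_eqVlt => /orP[/eqP ->|ij] p.
    by rewrite l'j h'E//; exact: sj.
  by rewrite l'E// h'E; [apply: sn; rewrite i0|exact: ltnW].
Qed.

Lemma lifetime_recursion_exists j : (0 < j)%N ->
  exists (d : measure_display) (T : measurableType d) (P : probability T R)
    (h l : nat -> R -> T -> R), lifetime_recursion P h l j /\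
    forall i, (0 < i < j)%N -> forall w, snake (h i ^~ w) (l i ^~ w).
Proof.
elim: j => // -[|j] IH _; last first.
  have [d [T [P [h [l [rh sn]]]]]] := IH isT.
  exact: (lifetime_recursion_extend (ltn0Sn j) rh sn).
exists _, _, (@bit_measure R \x @bit_measure R)%E.
exists (fun _ t w => rescaled_excursion (brownian_path^~ w) t), (fun _ _ _ => 0).
(* With one lifetime and no label, the remaining conditions range over no index. *)
split; last by move=> i; lia.
split; [exact: brownian_excursion_exists|lia|lia|lia].
Qed.

(** The recursion of lifetimes up to [D.+1] contains all labels up to [D]; the last lifetime is
    dropped. *)
Theorem brownian_snakes_exist D : (0 < D)%N ->
  exists (d : measure_display) (T : measurableType d) (P : probability T R)
    (h l : nat -> R -> T -> R), brownian_snakes P h l D.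
Proof.
move=> D0; have [d [T [P [h [l [[eh lp Cl hC] sn]]]]]] := lifetime_recursion_exists (ltn0Sn D).
exists d, T, P, h, l; split; last by move=> i iD; apply: sn; lia.
split=> // i iD.
- by apply: Cl; lia.
- by apply: hC; lia.
Qed.

End existence.

Theorem theorem2p12 (R : realType) :
  (forall (j : nat) (d : measure_display) (T : measurableType d)
          (P : probability T R) (h l : nat -> R -> T -> R),
     (1 <= j)%N -> snake_recursion P h l j ->
     exists l' : R -> T -> R,
       is_version P unitI (l j) l' /\ forall w, C0 (l' ^~ w))
  /\
  (forall D : nat, (1 <= D)%N ->
     (exists (d : measure_display) (T : measurableType d)
             (P : probability T R) (h l : nat -> R -> T -> R),
        brownian_snakes P h l D)
     /\
     (forall (d : measure_display) (T : measurableType d)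
             (P : probability T R) (h l : nat -> R -> T -> R)
             (d' : measure_display) (T' : measurableType d')
             (P' : probability T' R) (h' l' : nat -> R -> T' -> R),
        brownian_snakes P h l D -> brownian_snakes P' h' l' D ->
        same_law (stages D D) P (tours h l) P' (tours h' l'))).
Proof.
split; first by move=> j d T P h l; exact: label_version.
move=> D D0; split; first exact: brownian_snakes_exist.
by move=> d T P h l d' T' P' h' l'; exact: brownian_snakes_law.
Qed.
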